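(* Let $M$ be a path-connected closed $n$-manifold which is an open book, with a diffeomorphism $M\cong (\partial V\times D^2)\cup_{\rm id} V_h$, where $V$ is a smooth compact $(n-1)$-manifold with $\partial V\neq\emptyset$ and $h\colon V\to V$ is a self-diffeomorphism restricting to the identity on $\partial V$. Suppose that $h\simeq {\rm id}$ relative to $\partial V$. Then there is a homotopy equivalence \[ \Omega M\simeq \Omega V\times \Omega \Sigma^2 F, \] where $F$ is the homotopy fibre of the inclusion $\partial V\to V$. Consequently, there is an isomorphism \[ \pi_\ast(M)\cong \pi_\ast(V)\oplus \pi_\ast(\Sigma^2 F). \]
   Context: All spaces and maps are pointed; the basepoint of $V$ is chosen in $\partial V$. $\Omega X$ is the based loop space and $\Sigma X$ the suspension of $X$. The mapping torus of $h$ is $V_h=(V\times [0,1])/\sim$ with $(v,0)\sim(h(v),1)$; since $h$ is the identity on $\partial V$, its boundary is $\partial V\times S^1$. The notation $(\partial V\times D^2)\cup_{\rm id}V_h$ means the union of $\partial V\times D^2$ and $V_h$ over the common subspace $\partial V\times S^1$. A closed $n$-manifold $M$ is an open book if it is diffeomorphic to $(\partial V\times D^2)\cup_{\rm id}V_h$ for some such $V$ and $h$; $h$ is called the monodromy. *)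

(* Defs.v *)
From HB Require Import structures.
From mathcomp Require Import all_boot all_order all_algebra generic_quotient.
From mathcomp Require Import all_classical all_reals all_analysis homotopy.
From Stdlib Require Import Relation_Operators.
Import Order.TTheory GRing.Theory Num.Theory numFieldNormedType.Exports.
Set Implicit Arguments.
Unset Strict Implicit.
Unset Printing Implicit Defensive.
Local Open Scope classical_set_scope.
Local Open Scope ring_scope.
Local Open Scope quotient_scope.

Section UnitInterval.
Variable R : realType.

Definition unit_interval : Type := set_type [set t : R | 0 <= t <= 1].
HB.instance Definition _ := Topological.on unit_interval.

Lemma clampP (t : R) : Num.max 0 (Num.min t 1) \in [set t : R | 0 <= t <= 1].
Proof.
by apply/mem_set => /=; rewrite le_max lexx ge_max ler01 ge_min lexx orbT.
Qed.

Definition clamp (t : R) : unit_interval :=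
  exist (fun x => x \in [set t : R | 0 <= t <= 1]) _ (clampP t).

Definition ival (t : unit_interval) : R := set_val t.

Lemma ival_continuous : continuous ival.
Proof. exact: initial_continuous. Qed.

Lemma ival_inj : injective ival.
Proof. exact: val_inj. Qed.

Lemma ival_itv (t : unit_interval) : 0 <= ival t <= 1.
Proof. by case: t => t /= t01; exact: (set_mem t01). Qed.

Lemma clampK (t : R) : 0 <= t <= 1 -> ival (clamp t) = t.
Proof. by case/andP=> t0 t1; rewrite /ival/= set_valE /= min_l// max_r. Qed.

Lemma ivalK (t : unit_interval) : clamp (ival t) = t.
Proof. by apply: ival_inj; rewrite clampK// ival_itv. Qed.

Definition I0 : unit_interval := clamp 0.
Definition I1 : unit_interval := clamp 1.

Lemma ival0 : ival I0 = 0. Proof. by rewrite clampK// lexx ler01. Qed.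
Lemma ival1 : ival I1 = 1. Proof. by rewrite clampK// lexx ler01. Qed.

Lemma I0_neq_I1 : I0 != I1.
Proof.
by apply/eqP => /(congr1 ival)/eqP; rewrite ival0 ival1 eq_sym oner_eq0.
Qed.

HB.instance Definition _ := isBiPointed.Build unit_interval I0_neq_I1.

Lemma clamp_continuous : continuous clamp.
Proof.
apply: (@continuous_comp_initial unit_interval R R ival clamp).
move=> t; rewrite /comp /ival /= set_valE /=.
apply: (@continuous_max R R (fun=> 0) (fun t => Num.min t 1)).
  exact: cvg_cst.
by apply: (@continuous_min R R id (fun=> 1)); [exact: cvg_id|exact: cvg_cst].
Qed.

Lemma clamp_ge1 (t : R) : 1 <= t -> clamp t = I1.
Proof.
by move=> t1; apply: ival_inj; rewrite ival1 /ival /= set_valE /= min_r// max_r.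
Qed.

Lemma clamp_le0 (t : R) : t <= 0 -> clamp t = I0.
Proof.
move=> t0; apply: ival_inj; rewrite ival0 /ival /= set_valE /= min_l ?max_l//.
by rewrite (le_trans t0).
Qed.

End UnitInterval.

Section QuotientSpace.
Variables (T : topologicalType) (r : T -> T -> Prop).

Definition gen_equiv : rel T := fun x y => `[< clos_refl_sym_trans T r x y >].

Lemma gen_equiv_equiv : equiv_class_of gen_equiv.
Proof.
split=> [x|x y|y x z].
- by apply/asboolP; exact: rst_refl.
- by apply/asboolP/asboolP => ?; exact: rst_sym.
- by move=> /asboolP xy /asboolP yz; apply/asboolP; exact: (rst_trans _ _ _ _ _ xy yz).
Qed.

Canonical gen_equivRel := EquivRelPack gen_equiv_equiv.

Definition qspace : topologicalType :=
  quotient_topology {eq_quot gen_equivRel}.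

Definition qproj (x : T) : qspace := \pi_({eq_quot gen_equivRel}) x.

End QuotientSpace.

Section Homotopy.
Variable R : realType.
Local Notation I := (unit_interval R).

Definition homotopic_rel (X Y : topologicalType) (A : set X) (f g : X -> Y) :=
  exists H : X * I -> Y,
    [/\ continuous H,
        forall x, H (x, I0 R) = f x,
        forall x, H (x, I1 R) = g x &
        forall a t, A a -> H (a, t) = f a].

Definition pointed_homotopy_equivalent (X Y : topologicalType) (x0 : X)
    (y0 : Y) :=
  exists (f : X -> Y) (g : Y -> X),
    [/\ continuous f, continuous g, f x0 = y0 /\ g y0 = x0,
        homotopic_rel [set x0] (g \o f) id &
        homotopic_rel [set y0] (f \o g) id].

Definition path_connected_space (X : topologicalType) :=
  forall x y : X, inhabited {path I from x to y}.

Definition loop_space (X : topologicalType) (x0 : X) : topologicalType :=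
  {path I from x0 to x0}.

Definition loop_pt (X : topologicalType) (x0 : X) : loop_space x0 := cst x0.

Definition reduced_susp_rel (X : topologicalType) (x0 : X) (p q : X * I) :=
  let C := [set u : X * I | [\/ u.2 = I0 R, u.2 = I1 R | u.1 = x0]] in
  C p /\ C q.

Definition reduced_susp (X : topologicalType) (x0 : X) : topologicalType :=
  qspace (reduced_susp_rel x0).

Definition reduced_susp_pt (X : topologicalType) (x0 : X) : reduced_susp x0 :=
  qproj (reduced_susp_rel x0) (x0, I0 R).

Definition hofiber (X Y : topologicalType) (f : X -> Y) (y0 : Y) :
    topologicalType :=
  set_type [set p : X * {compact-open, I -> Y} |
    [/\ continuous (p.2 : I -> Y), p.2 (I0 R) = y0 & p.2 (I1 R) = f p.1]].

Lemma hofiber_ptP (X Y : topologicalType) (f : X -> Y) (x0 : X) :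
  ((x0, cst (f x0)) : X * {compact-open, I -> Y}) \in
  [set p : X * {compact-open, I -> Y} |
    [/\ continuous (p.2 : I -> Y), p.2 (I0 R) = f x0 & p.2 (I1 R) = f p.1]].
Proof. by apply/mem_set; split=> //=; exact: cst_continuous. Qed.

Definition hofiber_pt (X Y : topologicalType) (f : X -> Y) (x0 : X) :
  hofiber f (f x0) := SigSub (hofiber_ptP f x0).

End Homotopy.

Section HomotopyEquivalenceRelation.
Variable R : realType.
Local Notation I := (unit_interval R).

Lemma paste_continuous (X Y : topologicalType) (c : X -> R) (a : R)
    (f g : X -> Y) :
  continuous c -> continuous f -> continuous g ->
  (forall x, c x = a -> f x = g x) ->
  continuous (fun x => if c x <= a then f x else g x).
Proof.
move=> cc cf cg fg; 
pose h x := if c x <= a then f x else g x; rewrite -/h.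
apply/continuous_subspace_setT.
have -> : [set: X] = [set x | c x <= a] `|` [set x | a <= c x].
  by rewrite eqEsubset; split=> // x _; case/orP: (le_total (c x) a); [left|right].
apply: withinU_continuous.
- by move/continuous_closedP: cc => /(_ _ (@closed_le R a)).
- by move/continuous_closedP: cc => /(_ _ (@closed_ge R a)).
- apply: (@subspace_eq_continuous _ _ _ f); last exact: continuous_subspaceT.
  by move=> x /set_mem /= cx; rewrite /from_subspace /= /h cx.
- apply: (@subspace_eq_continuous _ _ _ g); last exact: continuous_subspaceT.
  move=> x /set_mem /= cx; rewrite /from_subspace /= /h; case: ifPn => // cx'.
  by apply/esym/fg/le_anti/andP.
Qed.


Definition lo (t : I) : I := clamp (2 * ival t).
Definition hi (t : I) : I := clamp (2 * ival t - 1).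

Lemma pair_continuous (T X Y : topologicalType) (u : T -> X) (v : T -> Y) :
  continuous u -> continuous v -> continuous (fun x => (u x, v x)).
Proof.
move=> cu cv x U [[P Q] /= [Pu Qv] PQU].
have /= Px : nbhs x (u @^-1` P) := cu x _ Pu.
have /= Qx : nbhs x (v @^-1` Q) := cv x _ Qv.
apply: (filterS _ (filterI Px Qx)) => y [Py Qy].
exact: (PQU (u y, v y)).
Qed.

Lemma affine_continuous (T : topologicalType) (a b : R) (u : T -> R) :
  continuous u -> continuous (fun t => clamp (a * u t + b)).
Proof.
move=> cu t; apply: (@continuous_comp _ _ _ (fun t => a * u t + b) (@clamp R));
  last exact: clamp_continuous.
apply: (@continuousD _ _ _ (fun t => a * u t) (fun=> b));
  last exact: cst_continuous.
by apply: (@continuousM _ _ (fun=> a) u); [exact: cst_continuous|exact: cu].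
Qed.

Lemma lo_continuous : continuous lo.
Proof.
under [lo]funext => t do rewrite /lo -[_ * _]addr0.
by apply: affine_continuous; exact: ival_continuous.
Qed.

Lemma hi_continuous : continuous hi.
Proof. by apply: affine_continuous; exact: ival_continuous. Qed.

Lemma lo_half (t : I) : ival t = 2^-1 -> lo t = I1 R.
Proof. by move=> th; rewrite /lo th mulfV// clamp_ge1. Qed.

Lemma hi_half (t : I) : ival t = 2^-1 -> hi t = I0 R.
Proof. by move=> th; rewrite /hi th mulfV// subrr clamp_le0. Qed.

Lemma lo0 : lo (I0 R) = I0 R.
Proof. by rewrite /lo ival0 mulr0 clamp_le0. Qed.

Lemma hi1 : hi (I1 R) = I1 R.
Proof. by rewrite /hi ival1 mulr1 -[X in X - _]/(1 + 1) addrK clamp_ge1. Qed.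

Lemma half_lt1 : 2^-1 < 1 :> R.
Proof. by rewrite invf_lt1// ltr1n. Qed.

Variables (X Y : topologicalType) (A : set X).
Implicit Types f g h : X -> Y.

Lemma ival_snd_continuous (T : topologicalType) :
  continuous (fun p : T * I => ival p.2).
Proof.
move=> p; apply: (@continuous_comp _ _ _ snd (@ival R)).
  exact: cvg_snd.
exact: ival_continuous.
Qed.

Lemma continuous_pair_comp (H : X * I -> Y) (u : X * I -> I) :
  continuous H -> continuous u -> continuous (fun p => H (p.1, u p)).
Proof.
move=> cH cu p.
apply: (@continuous_comp _ _ _ (fun p => (p.1, u p)) H); last exact: cH.
by apply: pair_continuous => {}p; [exact: cvg_fst|exact: cu].
Qed.

Lemma homotopic_refl f : continuous f -> homotopic_rel R A f f.
Proof.
move=> cf; exists (fun p => f p.1); split=> // p.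
by apply: continuous_comp; [exact: cvg_fst|exact: cf].
Qed.

Lemma homotopic_sym f g : homotopic_rel R A f g -> homotopic_rel R A g f.
Proof.
case=> H [cH H0 H1 HA]; exists (fun p => H (p.1, clamp (1 - ival p.2))); split.
- apply: (continuous_pair_comp cH).
  under eq_fun => q do rewrite addrC -mulN1r.
  exact/affine_continuous/ival_snd_continuous.
- by move=> x; rewrite /= ival0 subr0 clamp_ge1.
- by move=> x; rewrite /= ival1 subrr clamp_le0.
- by move=> a t Aa /=; rewrite HA// -H1 HA.
Qed.

Lemma homotopic_trans f g h :
  homotopic_rel R A f g -> homotopic_rel R A g h -> homotopic_rel R A f h.
Proof.
case=> H [cH H0 H1 HA] [K [cK K0 K1 KA]].
exists (fun p => if ival p.2 <= 2^-1 then H (p.1, lo p.2)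
                 else K (p.1, hi p.2)); split.
- apply: (@paste_continuous _ _ (fun p => ival p.2)).
  + exact: ival_snd_continuous.
  + apply: (continuous_pair_comp cH) => p.
    by apply: continuous_comp; [exact: cvg_snd|exact: lo_continuous].
  + apply: (continuous_pair_comp cK) => p.
    by apply: continuous_comp; [exact: cvg_snd|exact: hi_continuous].
  + by move=> p /= ph; rewrite lo_half// hi_half// H1 K0.
- by move=> x; rewrite /= ival0 invr_ge0 ler0n lo0.
- by move=> x; rewrite /= ival1 leNgt half_lt1 /= hi1.
- move=> a t Aa /=; case: ifP => _; first by rewrite HA.
  by rewrite KA// -H1 HA.
Qed.

End HomotopyEquivalenceRelation.

Section HomotopyGroups.
Variable R : realType.
Local Notation I := (unit_interval R).
Variables (X : topologicalType) (x0 : X).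

Definition cube (k : nat) : topologicalType := {ptws 'I_k -> I}.

Definition cube_boundary (k : nat) : set (cube k) :=
  [set x | exists i, x i = I0 R \/ x i = I1 R].

Definition spheroid (k : nat) : Type :=
  set_type [set f : cube k -> X |
    continuous f /\ forall x, cube_boundary x -> f x = x0].
HB.instance Definition _ k := Choice.on (spheroid k).

Definition spheroid_homotopic k : rel (spheroid k) := fun f g =>
  `[< homotopic_rel R (@cube_boundary k) (set_val f) (set_val g) >].

Lemma spheroid_homotopic_equiv k : equiv_class_of (@spheroid_homotopic k).
Proof.
split=> [f|f g|g f h].
- by apply/asboolP/homotopic_refl; case: f => f fP; have [] := set_mem fP.
- by apply/asboolP/asboolP => /homotopic_sym.
- move=> /asboolP fg /asboolP gh; apply/asboolP; exact: homotopic_trans fg gh.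
Qed.

Canonical spheroid_equivRel k := EquivRelPack (@spheroid_homotopic_equiv k).

Definition hgroup (k : nat) : Type := {eq_quot (spheroid_equivRel k)}.

Definition hgroup_class k (f : spheroid k) : hgroup k :=
  \pi_({eq_quot (spheroid_equivRel k)}) f.

Definition set_coord0 k (x : cube k.+1) (t : I) : cube k.+1 :=
  fun i => if i == ord0 then t else x i.

Definition concat_fun k (f g : cube k.+1 -> X) (x : cube k.+1) : X :=
  if ival (x ord0) <= 2^-1 then f (set_coord0 x (lo (x ord0)))
  else g (set_coord0 x (hi (x ord0))).

Lemma coord0_continuous k : continuous (fun x : cube k.+1 => x ord0).
Proof. exact: (@proj_continuous 'I_k.+1 (fun=> I) ord0). Qed.

Lemma set_coord0_continuous k (u : I -> I) : continuous u ->
  continuous (fun x : cube k.+1 => set_coord0 x (u (x ord0))).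
Proof.
move=> cu x.
have FF := fmap_filter (fun x : cube k.+1 => set_coord0 x (u (x ord0)))
  (nbhs_filter x).
apply/cvg_sup => i.
have ci : continuous (fun x : cube k.+1 => set_coord0 x (u (x ord0)) i).
  move=> y; rewrite /set_coord0; case: (i == ord0).
    apply: (@continuous_comp _ _ _ (fun x : cube k.+1 => x ord0) u).
      exact: coord0_continuous.
    exact: cu.
  exact: (@proj_continuous 'I_k.+1 (fun=> I) i).
move=> U [? /= [[W oW <-]]] /= Wx /filterS; apply.
by apply: ci; exact: open_nbhs_nbhs.
Qed.

Lemma set_coord0_boundary k (x : cube k.+1) (t : I) :
  t = I0 R \/ t = I1 R -> cube_boundary (set_coord0 x t).
Proof. by move=> t01; exists ord0; rewrite /set_coord0 eqxx. Qed.

Lemma set_coord0_lo_hi k (x : cube k.+1) : cube_boundary x ->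
  if ival (x ord0) <= 2^-1 then cube_boundary (set_coord0 x (lo (x ord0)))
  else cube_boundary (set_coord0 x (hi (x ord0))).
Proof.
move=> [i]; case: (eqVneq i ord0) => [->|i0] xi; last first.
  by case: ifP => _; exists i; rewrite /set_coord0 (negbTE i0).
case: xi => ->.
  by rewrite ival0 invr_ge0 ler0n lo0; apply: set_coord0_boundary; left.
by rewrite ival1 leNgt half_lt1 /= hi1; apply: set_coord0_boundary; right.
Qed.

Lemma concatP k (f g : spheroid k.+1) :
  concat_fun (set_val f) (set_val g) \in [set f : cube k.+1 -> X |
    continuous f /\ forall x, cube_boundary x -> f x = x0].
Proof.
case: f => f /= fP; case: g => g /= gP; rewrite !set_valE /=.
have [cf f0] := set_mem fP; have [cg g0] := set_mem gP.
apply/mem_set; split=> [|x /set_coord0_lo_hi].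
  apply: (@paste_continuous R _ _ (fun x : cube k.+1 => ival (x ord0))).
  - move=> x; apply: continuous_comp; first exact: coord0_continuous.
    exact: ival_continuous.
  - move=> x; apply: continuous_comp; last exact: cf.
    exact: (set_coord0_continuous (@lo_continuous R)).
  - move=> x; apply: continuous_comp; last exact: cg.
    exact: (set_coord0_continuous (@hi_continuous R)).
  - move=> x xh; rewrite f0; last first.
      by apply: set_coord0_boundary; right; exact: lo_half.
    by rewrite g0//; apply: set_coord0_boundary; left; exact: hi_half.
by rewrite /concat_fun; case: ifP => _ bx; [exact: f0|exact: g0].
Qed.

Definition concat k (f g : spheroid k.+1) : spheroid k.+1 :=
  SigSub (concatP f g).

Lemma concat_homotopic k (f f' g g' : spheroid k.+1) :
  spheroid_homotopic f f' -> spheroid_homotopic g g' ->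
  spheroid_homotopic (concat f g) (concat f' g').
Proof.
move=> /asboolP[H [cH H0 H1 HA]] /asboolP[K [cK K0 K1 KA]]; apply/asboolP.
have [cf f0] := set_mem (svalP f); have [cg g0] := set_mem (svalP g).
have cc (u : I -> I) : continuous u ->
    continuous (fun p : cube k.+1 * I => (set_coord0 p.1 (u (p.1 ord0)), p.2)).
  move=> cu; apply: pair_continuous => [p|p]; last exact: cvg_snd.
  apply: (@continuous_comp _ _ _ fst
    (fun x : cube k.+1 => set_coord0 x (u (x ord0)))); first exact: cvg_fst.
  exact: set_coord0_continuous.
exists (fun p => if ival (p.1 ord0) <= 2^-1
                 then H (set_coord0 p.1 (lo (p.1 ord0)), p.2)
                 else K (set_coord0 p.1 (hi (p.1 ord0)), p.2)); split.
- apply: (@paste_continuous R _ _ (fun p : cube k.+1 * I => ival (p.1 ord0))).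
  + move=> p; apply: (@continuous_comp _ _ _ fst
      (fun x : cube k.+1 => ival (x ord0))); first exact: cvg_fst.
    apply: continuous_comp; first exact: coord0_continuous.
    exact: ival_continuous.
  + move=> p; apply: (continuous_comp (cc _ (@lo_continuous R) p)); exact: cH.
  + move=> p; apply: (continuous_comp (cc _ (@hi_continuous R) p)); exact: cK.
  + move=> p ph; have bl : cube_boundary (set_coord0 p.1 (lo (p.1 ord0))).
      by apply: set_coord0_boundary; right; exact: lo_half.
    have bh : cube_boundary (set_coord0 p.1 (hi (p.1 ord0))).
      by apply: set_coord0_boundary; left; exact: hi_half.
    by rewrite HA// KA//; apply: etrans (f0 _ bl) (esym (g0 _ bh)).
- by move=> x; rewrite /= H0 K0.
- by move=> x; rewrite /= H1 K1.
- move=> x t /set_coord0_lo_hi /=; rewrite set_valE /= /concat_fun.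
  by case: ifP => _ bx; [exact: HA|exact: KA].
Qed.

Definition hgroup_mul k (a b : hgroup k.+1) : hgroup k.+1 :=
  hgroup_class (concat (repr (a : {eq_quot (spheroid_equivRel k.+1)}))
                   (repr (b : {eq_quot (spheroid_equivRel k.+1)}))).

Lemma hgroup_mulE k (f g : spheroid k.+1) :
  hgroup_mul (hgroup_class f) (hgroup_class g) = hgroup_class (concat f g).
Proof.
by apply/eqmodP/concat_homotopic;
  apply/(@eqmodP _ (spheroid_equivRel k.+1)); rewrite reprK.
Qed.

End HomotopyGroups.

Arguments hgroup_mul {R X x0 k}.
Arguments hofiber_pt R {X Y}.


Definition group_iso_prod (A G H : Type) (mA : A -> A -> A) (mG : G -> G -> G)
    (mH : H -> H -> H) :=
  exists phi : A -> G * H, bijective phi /\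
    forall a b, phi (mA a b) =
      (mG (phi a).1 (phi b).1, mH (phi a).2 (phi b).2).

Section Smooth.
Variable R : realType.

Fixpoint Ck (k : nat) (N P : nat) (W : set 'rV[R]_N)
    (f : 'rV[R]_N -> 'rV[R]_P) : Prop :=
  if k is k'.+1 then
    (forall x, W x -> differentiable f x) /\
    (forall v, Ck k' W (fun x => 'D_v f x))
  else forall x, W x -> {for x, continuous f}.

Definition Cinfty (N P : nat) (W : set 'rV[R]_N) (f : 'rV[R]_N -> 'rV[R]_P) :=
  forall k, Ck k W f.

Record chart (X : Type) (N : nat) :=
  Chart { cdom : set X; cmap : X -> 'rV[R]_N }.

Definition atlas (X : Type) (N : nat) := set (chart X N).

(* Smoothness on a subset S is meant in the sense of local smooth extension:
   near each point of S, the expression of f in charts is the restriction of a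
   smooth map defined on an open subset of the coordinate space. This covers
   charts with values in a half-space, or in any subset of 'rV_N. *)
Definition smooth_on (X Y : topologicalType) (N P : nat) (AX : atlas X N)
    (AY : atlas Y P) (S : set X) (f : X -> Y) :=
  {within S, continuous f} /\
  forall a b x, AX a -> AY b -> S x -> cdom a x -> cdom b (f x) ->
    exists (W : set 'rV[R]_N) (g : 'rV[R]_N -> 'rV[R]_P),
      [/\ open W, W (cmap a x), Cinfty W g &
        forall y, S y -> cdom a y -> W (cmap a y) -> cdom b (f y) ->
          cmap b (f y) = g (cmap a y)].

Definition diffeomorphism (X Y : topologicalType) (N P : nat) (AX : atlas X N)
    (AY : atlas Y P) (f : X -> Y) :=
  smooth_on AX AY setT f /\
  exists g : Y -> X, [/\ cancel f g, cancel g f & smooth_on AY AX setT g].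

(* The inverse is smooth on the image in the sense of local extensions, so f is
   a diffeomorphism onto a submanifold, possibly with boundary. *)
Definition smooth_embedding (X Y : topologicalType) (N P : nat)
    (AX : atlas X N) (AY : atlas Y P) (f : X -> Y) :=
  smooth_on AX AY setT f /\
  exists g : Y -> X, cancel f g /\ smooth_on AY AX (range f) g.

Definition half_space (m : nat) : set 'rV[R]_m :=
  [set x | forall i : 'I_m, val i = 0%N -> 0 <= x 0 i].

Definition smooth_manifold (m : nat) (X : topologicalType) (A : atlas X m) :=
  [/\ hausdorff_space X,
      @second_countable X,
      forall x, exists2 a, A a & cdom a x,
      forall a, A a ->
        [/\ open (cdom a),
            forall x, cdom a x -> {for x, continuous (cmap a)},
            {in cdom a &, injective (cmap a)} &
            forall U, open U -> U `<=` cdom a ->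
              exists2 O, open O & cmap a @` U = O `&` @half_space m] &
      smooth_on A A setT id].

Definition boundary (m : nat) (X : topologicalType) (A : atlas X m) : set X :=
  [set x | exists a, [/\ A a, cdom a x &
    exists2 i : 'I_m, val i = 0%N & cmap a x 0 i = 0]].

Definition sub_atlas (m : nat) (X : topologicalType) (A : atlas X m)
    (S : set X) : atlas S m :=
  [set c | exists2 a, A a &
    c = Chart (set_val @^-1` cdom a) (fun x : S => cmap a (set_val x))].

Definition prod_atlas (m p : nat) (X Y : Type) (A : atlas X m)
    (B : atlas Y p) : atlas (X * Y)%type (m + p) :=
  [set c | exists a b, [/\ A a, B b &
    c = Chart (cdom a `*` cdom b) (fun z => row_mx (cmap a z.1) (cmap b z.2))]].

Definition disk : topologicalType :=
  set_type [set z : 'rV[R]_2 | z 0 0 ^+ 2 + z 0 1 ^+ 2 <= 1].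

Definition disk_atlas : atlas disk 2 := [set Chart setT (fun z => set_val z)].

(* e^(2 i pi t) *)
Definition circle (t : R) : 'rV[R]_2 :=
  \row_(j < 2) if j == 0 then cos (2 * pi * t) else sin (2 * pi * t).

End Smooth.

Section OpenBook.
Variables (R : realType) (m : nat) (V : topologicalType) (A : atlas R V m).
Variable h : V -> V.
Local Notation I := (unit_interval R).

Definition torus_rel (p q : V * I) :=
  exists v, p = (v, I0 R) /\ q = (h v, I1 R).

Definition mapping_torus : topologicalType := qspace torus_rel.

Definition torus_proj (v : V) (t : I) : mapping_torus :=
  qproj torus_rel (v, t).

(* Charts away from the seam t = 0 ~ 1, where [v, t] is read as (v, t), and
   across the seam, where [v, t] is read as (h v, t) for t < 1/2 and as
   (v, t - 1) for t > 1/2; these agree on [v, 0] = [h v, 1]. *)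
Definition torus_atlas : atlas R mapping_torus (m + 1) :=
  [set c | exists2 a, A a &
    (cdom c = [set x | exists v t,
        [/\ x = torus_proj v t, cdom a v & 0 < ival t < 1]] /\
     forall v t, cdom a v -> 0 < ival t < 1 ->
       cmap c (torus_proj v t) = row_mx (cmap a v) (ival t)%:M)] `|`
  [set c | exists2 a, A a &
    [/\ cdom c = [set x | exists v t, x = torus_proj v t /\
          ((ival t < 2^-1 /\ cdom a (h v)) \/ (2^-1 < ival t /\ cdom a v))],
        forall v t, ival t < 2^-1 -> cdom a (h v) ->
          cmap c (torus_proj v t) = row_mx (cmap a (h v)) (ival t)%:M &
        forall v t, 2^-1 < ival t -> cdom a v ->
          cmap c (torus_proj v t) = row_mx (cmap a v) (ival t - 1)%:M]].

Definition bdry : topologicalType := boundary A.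

Definition bdry_incl (b : bdry) : V := set_val b.

Definition book_piece (b : bool) : topologicalType :=
  if b then ((bdry * disk R)%type : topologicalType) else mapping_torus.

Definition book_rel (p q : {b : bool & book_piece b}) :=
  exists (b : bdry) (z : disk R) (t : I),
    [/\ set_val z = circle (ival t),
        p = existT book_piece true (b, z) &
        q = existT book_piece false (torus_proj (bdry_incl b) t)].

Definition open_book : topologicalType := qspace book_rel.

Definition book_binding (p : bdry * disk R) : open_book :=
  qproj book_rel (existT book_piece true p).

Definition book_page (x : mapping_torus) : open_book :=
  qproj book_rel (existT book_piece false x).

(* The smooth structure on the union obtained by gluing along the boundary is
   the one, unique up to diffeomorphism, for which both pieces are smoothly
   embedded: a diffeomorphism from the open book to M is therefore a
   homeomorphism which restricts to a smooth embedding of each piece. *)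
Definition open_book_diffeo (n : nat) (M : topologicalType) (AM : atlas R M n)
    (Phi : open_book -> M) :=
  [/\ continuous Phi,
      exists Psi : M -> open_book,
        [/\ continuous Psi, cancel Phi Psi & cancel Psi Phi],
      smooth_embedding (prod_atlas (@sub_atlas R m V A (boundary A))
        (@disk_atlas R)) AM (Phi \o book_binding) &
      smooth_embedding torus_atlas AM (Phi \o book_page)].

End OpenBook.

(* Main.v *)
(** Write p : M -> V for the projection of the open book onto the page, which
    exists because h is homotopic to the identity. Up to homotopy M is
    X = {(v, w) in V x D^2 : v in dV or |w| = 1}, the page is a section of p, and
    the homotopy fibre of p over v0 consists of the pairs (g, w) where g is a path
    in V from v0 and g(1) lies in dV or |w| = 1, i.e. it is the union of PV x S^1
    and F x D^2. Since PV is contractible and F is well pointed (chart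
    contractions at a boundary point), collapsing the contractible subspace made
    of PV x S^1 and {f0} x D^2 is a homotopy equivalence onto the double
    suspension of F.

    Because p has a section, a family of loops in X is, uniquely up to homotopy, a
    loop in the page followed by a loop in the fibre. For families over the loop
    spaces this gives the equivalence by Yoneda; for families over cubes it gives
    the statement on homotopy groups, where the bijection is a homomorphism by
    Eckmann-Hilton in degree at least 2, and in degree 1 because the fibre is
    simply connected. *)
From HB Require Import structures.
Require Import Defs.
From mathcomp Require Import all_boot all_order all_algebra generic_quotient.
From mathcomp Require Import all_classical all_reals all_analysis homotopy.
From mathcomp Require Import ring lra.
From Stdlib Require Import Relation_Operators.
Import Order.TTheory GRing.Theory Num.Theory numFieldNormedType.Exports.
Set Implicit Arguments.
Unset Strict Implicit.
Unset Printing Implicit Defensive.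
Local Open Scope classical_set_scope.
Local Open Scope ring_scope.
Local Open Scope quotient_scope.

(** * Continuity *)

(** All homotopies are strict at base points, since both conclusions are pointed, while [m0] is an
    arbitrary point of [M]; the base point is carried to [m0] by pushing it through chart balls
    along a path. The disk is traded for the square [I * I] so that its two coordinates become the
    two suspension coordinates. The recurring obstacle is that the open book and the suspensions are
    quotients, and a homotopy on a quotient must be continuous on its product with [I]. For the open
    book this comes from compactness of the two pieces and the Hausdorff property inherited from
    [M]; for the suspensions of [F], a space of paths, it comes from the exponential law with a
    compact Hausdorff parameter. Collapsing is a homotopy equivalence because the contraction of the
    collapsed subspace is the restriction of a homotopy of the whole fibre that preserves this
    subspace and fixes the base point. Smoothness gives the invariance of the boundary: hence
    [boundary AV] is closed, and a straight-line contraction read in a single chart preserves it. *)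

Lemma comp_cont (X Y Z : topologicalType) (f : Y -> Z) (u : X -> Y) :
  continuous f -> continuous u -> continuous (fun x => f (u x)).
Proof. by move=> cf cu x; apply: continuous_comp; [exact: cu|exact: cf]. Qed.

Lemma id_cont (X : topologicalType) : continuous (fun x : X => x).
Proof. by move=> x; exact: cvg_id. Qed.

Lemma cst_cont (X Y : topologicalType) (c : Y) : continuous (fun _ : X => c).
Proof. by move=> x; exact: cvg_cst. Qed.

Lemma fst_cont (X Y Z : topologicalType) (u : X -> Y * Z) :
  continuous u -> continuous (fun x => (u x).1).
Proof. by move=> cu; apply: (@comp_cont _ _ _ fst u) => // p; exact: cvg_fst. Qed.

Lemma snd_cont (X Y Z : topologicalType) (u : X -> Y * Z) :
  continuous u -> continuous (fun x => (u x).2).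
Proof. by move=> cu; apply: (@comp_cont _ _ _ snd u) => // p; exact: cvg_snd. Qed.

Section RealContinuity.
Variables (R : realType) (X : topologicalType).
Implicit Types u v : X -> R.

Lemma add_cont u v : continuous u -> continuous v ->
  continuous (fun x => u x + v x).
Proof. by move=> cu cv x; apply: continuousD; [exact: cu|exact: cv]. Qed.

Lemma opp_cont u : continuous u -> continuous (fun x => - u x).
Proof. by move=> cu x; apply: continuousN; exact: cu. Qed.

Lemma mul_cont u v : continuous u -> continuous v ->
  continuous (fun x => u x * v x).
Proof. by move=> cu cv x; apply: continuousM; [exact: cu|exact: cv]. Qed.

Lemma max_cont u v : continuous u -> continuous v ->
  continuous (fun x => Num.max (u x) (v x)).
Proof. by move=> cu cv x; apply: continuous_max; [exact: cu|exact: cv]. Qed.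

Lemma min_cont u v : continuous u -> continuous v ->
  continuous (fun x => Num.min (u x) (v x)).
Proof. by move=> cu cv x; apply: continuous_min; [exact: cu|exact: cv]. Qed.

Lemma norm_cont u : continuous u -> continuous (fun x => `|u x|).
Proof. by move=> cu; apply: comp_cont => //; exact: norm_continuous. Qed.

Lemma clamp_cont u : continuous u -> continuous (fun x => clamp (u x)).
Proof. by move=> cu; apply: comp_cont => //; exact: clamp_continuous. Qed.

Lemma ival_cont (u : X -> unit_interval R) :
  continuous u -> continuous (fun x => ival (u x)).
Proof. by move=> cu; apply: comp_cont => //; exact: ival_continuous. Qed.

End RealContinuity.

Section Interpolation.
Variable R : realType.
Local Notation I := (unit_interval R).

Definition lerp (s i j : I) : I := clamp ((1 - ival s) * ival i + ival s * ival j).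

Definition inv_I (i : I) : I := clamp (1 - ival i).

Lemma lerp_cont (X : topologicalType) (u v w : X -> I) :
  continuous u -> continuous v -> continuous w ->
  continuous (fun x => lerp (u x) (v x) (w x)).
Proof.
move=> cu cv cw; apply: clamp_cont; apply: add_cont; apply: mul_cont.
- by apply: add_cont; [exact: cst_cont|apply: opp_cont; exact: ival_cont].
- exact: ival_cont.
- exact: ival_cont.
- exact: ival_cont.
Qed.

Lemma inv_continuous : continuous inv_I.
Proof.
apply: clamp_cont; apply: add_cont; first exact: cst_cont.
by apply: opp_cont; apply: ival_cont; exact: id_cont.
Qed.

End Interpolation.
Arguments inv_I {R}.

Ltac ct := cbv beta; tryif solve [done] then idtac else
 lazymatch goal with |- forall y, @continuous_at _ _ y ?F => lazymatch F with
 | fun x => x => exact: id_cont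
 | fun _ => ?c => apply: (@cst_cont _ _ c)
 | fun x => (@?u x, @?v x) => apply: (@pair_continuous _ _ _ u v); ct
 | fun x => fst (@?u x) => apply: (@fst_cont _ _ _ u); ct
 | fun x => snd (@?u x) => apply: (@snd_cont _ _ _ u); ct
 | fun x => clamp (@?u x) => apply: (@clamp_cont _ _ u); ct
 | fun x => ival (@?u x) => apply: (@ival_cont _ _ u); ct
 | fun x => lo (@?u x) => apply: (@comp_cont _ _ _ _ u); [exact: lo_continuous|ct]
 | fun x => hi (@?u x) => apply: (@comp_cont _ _ _ _ u); [exact: hi_continuous|ct]
 | fun x => (@?u x + @?v x)%R => apply: (@add_cont _ _ u v); ct
 | fun x => (@?u x * @?v x)%R => apply: (@mul_cont _ _ u v); ct
 | fun x => (- @?u x)%R => apply: (@opp_cont _ _ u); ct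
 | fun x => Num.max (@?u x) (@?v x) => apply: (@max_cont _ _ u v); ct
 | fun x => Num.min (@?u x) (@?v x) => apply: (@min_cont _ _ u v); ct
 | fun x => `|@?u x|%R => apply: (@norm_cont _ _ u); ct
 | fun x => lerp (@?u x) (@?v x) (@?w x) => apply: (@lerp_cont _ _ u v w); ct
 | fun x => inv_I (@?u x) => apply: (@comp_cont _ _ _ _ u); [exact: inv_continuous|ct]
 | fun x => ?f (@?u x) => first [apply: (@comp_cont _ _ _ f u); [try done|ct]|idtac]
 | @fst _ _ => let y := fresh in move=> y; exact: cvg_fst
 | @snd _ _ => let y := fresh in move=> y; exact: cvg_snd
 | _ => idtac end
 | |- _ => idtac end.

(** Guards the case split below: a minimum or maximum is split only when its arguments contain no
    further one, so nested ones are resolved from the inside and each branch is linear. *)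
Ltac flat t := lazymatch t with
  | context [@Order.min] => fail | context [@Order.max] => fail | _ => idtac end.

Ltac mm := repeat match goal with
  | |- context [Order.min ?a ?b] => flat a; flat b; case: (leP a b) => ?
  | |- context [Order.max ?a ?b] => flat a; flat b; case: (leP a b) => ?
  end; try lra.

(** * The unit interval *)

Section Interval.
Variable R : realType.
Local Notation I := (unit_interval R).
Implicit Types (i s t : I).

Lemma ival_ge0 i : 0 <= ival i. Proof. by have /andP[] := ival_itv i. Qed.
Lemma ival_le1 i : ival i <= 1. Proof. by have /andP[] := ival_itv i. Qed.

Lemma ival_lo i : ival i <= 2^-1 -> ival (lo i) = 2 * ival i.
Proof.
by move=> ih; rewrite /lo clampK// mulr_ge0 ?ival_ge0//=; lra.
Qed.

Lemma ival_hi i : 2^-1 <= ival i -> ival (hi i) = 2 * ival i - 1.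
Proof. by move=> ih; rewrite /hi clampK//; have := ival_le1 i; lra. Qed.

Lemma lo_hi i : 2^-1 <= ival i -> lo i = I1 R.
Proof. by move=> ih; rewrite /lo clamp_ge1//; lra. Qed.

Lemma hi_lo i : ival i <= 2^-1 -> hi i = I0 R.
Proof. by move=> ih; rewrite /hi clamp_le0//; lra. Qed.

Lemma lerpE s i j :
  ival (lerp s i j) = (1 - ival s) * ival i + ival s * ival j.
Proof.
rewrite clampK//; have := ival_itv s; have := ival_itv i; have := ival_itv j.
move=> /andP[? ?] /andP[? ?] /andP[? ?]; apply/andP; split; nra.
Qed.

Lemma lerp0 i j : lerp (I0 R) i j = i.
Proof. by apply: ival_inj; rewrite lerpE ival0; lra. Qed.

Lemma lerp1 i j : lerp (I1 R) i j = j.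
Proof. by apply: ival_inj; rewrite lerpE ival1; lra. Qed.

Lemma lerp_id s i : lerp s i i = i.
Proof. by apply: ival_inj; rewrite lerpE; lra. Qed.

Lemma ival_inv i : ival (inv_I i) = 1 - ival i.
Proof. by rewrite clampK//; have := ival_itv i; lra. Qed.

Lemma inv_I0 : inv_I (I0 R) = I1 R.
Proof. by apply: ival_inj; rewrite ival_inv ival0 ival1 subr0. Qed.

Lemma inv_I1 : inv_I (I1 R) = I0 R.
Proof. by apply: ival_inj; rewrite ival_inv ival0 ival1 subrr. Qed.

Lemma inv_IK : involutive (@inv_I R).
Proof. by move=> i; apply: ival_inj; rewrite !ival_inv; lra. Qed.

End Interval.

(** * Families of paths and their concatenation *)

Section Families.
Variable R : realType.
Local Notation I := (unit_interval R).
Local Notation i0 := (I0 R).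
Local Notation i1 := (I1 R).

(** The subspace on which a family of loops is prescribed. For [A] the boundary of a cube it is the
    boundary of the next cube, and iterating it describes families of double loops. *)
Definition rel_ends (T : topologicalType) (A : set T) : set (T * I) :=
  [set p | [\/ A p.1, p.2 = i0 | p.2 = i1]].

Definition fhom (T X : topologicalType) (A : set T) (f g : T * I -> X) :=
  homotopic_rel R (rel_ends A) f g.

Definition fcat (T X : Type) (f g : T * I -> X) (p : T * I) : X :=
  if ival p.2 <= 2^-1 then f (p.1, lo p.2) else g (p.1, hi p.2).

Definition frev (T X : Type) (f : T * I -> X) (p : T * I) : X :=
  f (p.1, inv_I p.2).

Definition reparam (T X : Type) (f : T * I -> X) (phi : I -> I) (p : T * I) : X :=
  f (p.1, phi p.2).

(** The uncurried form of a map of pairs from [(T, A)] to the loop space at [x0] and its constant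
    loop. *)
Definition floop (T X : topologicalType) (A : set T) (x0 : X) (f : T * I -> X) :=
  continuous f /\ forall p, rel_ends A p -> f p = x0.

Section OneSpace.
Variables (T X : topologicalType) (A : set T).
Implicit Types f g k : T * I -> X.

Lemma cat_continuous f g : continuous f -> continuous g ->
  (forall t, f (t, i1) = g (t, i0)) -> continuous (fcat f g).
Proof.
move=> cf cg fg; apply: (@paste_continuous R _ _ (fun p => ival p.2)); [ct..|].
by move=> [t i] /= ih; rewrite lo_half// hi_half.
Qed.

Lemma cat0 f g t : fcat f g (t, i0) = f (t, i0).
Proof. by rewrite /fcat /= ival0 invr_ge0 ler0n lo0. Qed.

Lemma cat1 f g t : fcat f g (t, i1) = g (t, i1).
Proof. by rewrite /fcat /= ival1 leNgt half_lt1 /= hi1. Qed.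

Lemma rev_continuous f : continuous f -> continuous (frev f).
Proof. by move=> cf; rewrite /frev; ct. Qed.

Lemma frevK f : frev (frev f) = f.
Proof. by apply/funext => -[t i]; rewrite /frev /= inv_IK. Qed.

(** The interval is convex, so [phi] moves to [psi] along segments that are stationary at the two
    ends; over [A] the family does not depend on time at all. All the group laws below reduce to
    this. *)
Lemma hom_reparam f (phi psi : I -> I) : continuous f ->
  continuous phi -> continuous psi -> phi i0 = psi i0 -> phi i1 = psi i1 ->
  (forall a i j, A a -> f (a, i) = f (a, j)) ->
  fhom A (reparam f phi) (reparam f psi).
Proof.
move=> cf cphi cpsi e0 e1 fA.
exists (fun p => f (p.1.1, lerp p.2 (phi p.1.2) (psi p.1.2))); split.
- by ct.
- by move=> p; rewrite /= lerp0.
- by move=> p; rewrite /= lerp1.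
- move=> [t i] s; rewrite /rel_ends /reparam /= => -[At|->|->]; first exact: fA.
    by rewrite e0 lerp_id.
  by rewrite e1 lerp_id.
Qed.

Lemma hom_cat f f' g g' : (forall t, f (t, i1) = g (t, i0)) ->
  fhom A f f' -> fhom A g g' -> fhom A (fcat f g) (fcat f' g').
Proof.
move=> fg [H [cH H0 H1 HA]] [K [cK K0 K1 KA]].
exists (fun p => if ival p.1.2 <= 2^-1 then H ((p.1.1, lo p.1.2), p.2)
                 else K ((p.1.1, hi p.1.2), p.2)); split.
- apply: (@paste_continuous R _ _ (fun p => ival p.1.2)); [by ct..|].
  move=> [[t i] s] /= ih; rewrite lo_half// hi_half// HA ?KA ?fg//.
    by constructor 2.
  by constructor 3.
- by move=> p; rewrite /= H0 K0.
- by move=> p; rewrite /= H1 K1.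
- move=> [t i] s /= ti; rewrite /fcat /=; case: ifPn => ih.
    rewrite HA//; case: ti => /= [At|->|i_1]; first by constructor 1.
      by rewrite lo0; constructor 2.
    by move: ih; rewrite i_1 ival1 leNgt half_lt1.
  rewrite KA//; case: ti => /= [At|i_0|->]; first by constructor 1.
    by move: ih; rewrite i_0 ival0 invr_ge0 ler0n.
  by rewrite hi1; constructor 3.
Qed.

Lemma hom_refl f : continuous f -> fhom A f f.
Proof. exact: homotopic_refl. Qed.

Lemma hom_sym f g : fhom A f g -> fhom A g f.
Proof. exact: homotopic_sym. Qed.

Lemma hom_trans f g k : fhom A f g -> fhom A g k -> fhom A f k.
Proof. exact: homotopic_trans. Qed.

Lemma hom_cont_l f g : fhom A f g -> continuous f.
Proof.
move=> [H [cH H0 _ _]].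
suff -> : f = (fun p => H (p, i0)) by ct.
by apply/funext.
Qed.

Lemma hom_cont_r f g : fhom A f g -> continuous g.
Proof. by move/hom_sym/hom_cont_l. Qed.

(** Stated for composable families of paths rather than loops, because it is also applied to the
    arcs stored in the homotopy fibre. *)
Lemma hom_cat_assoc f g k : continuous f -> continuous g -> continuous k ->
  (forall t, f (t, i1) = g (t, i0)) -> (forall t, g (t, i1) = k (t, i0)) ->
  (forall a i j, A a -> fcat f (fcat g k) (a, i) = fcat f (fcat g k) (a, j)) ->
  fhom A (fcat (fcat f g) k) (fcat f (fcat g k)).
Proof.
move=> cf cg ck fg gk cA.
(* The usual reassociation of the interval. Its slopes 2, 1, 1/2 decrease, with breaks at 1/4 and
   1/2, so it is the minimum of its three affine pieces. *)
pose phi i : I := clamp (Num.min (2 * ival i)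
                        (Num.min (ival i + 4^-1) (2^-1 * ival i + 2^-1))).
have -> : fcat (fcat f g) k = reparam (fcat f (fcat g k)) phi.
  apply/funext => -[t i]; rewrite /reparam /fcat /=.
  have [i_ge0 i_le1] := (ival_ge0 i, ival_le1 i).
  case: (leP (ival i) 4^-1) => i4.
    have pE : ival (phi i) = 2 * ival i.
      by rewrite /phi clampK; mm.
    rewrite pE !ifT; [|lra|rewrite ival_lo; lra|lra].
    congr (f (_, _)); apply: ival_inj; rewrite [LHS]ival_lo ?[RHS]ival_lo ?pE.
    - by rewrite ival_lo; lra.
    - by lra.
    - by rewrite ival_lo; lra.
  case: (leP (ival i) 2^-1) => i2.
    have pE : ival (phi i) = ival i + 4^-1.
      by rewrite /phi clampK; mm.
    have loE : ival (lo i) = 2 * ival i by rewrite ival_lo.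
    have hiE : ival (hi (phi i)) = 2 * ival i - 2^-1 by rewrite ival_hi pE; lra.
    rewrite loE pE hiE ifF; last by lra.
    rewrite ifF; last by lra.
    rewrite ifT; last by lra.
    congr (g (_, _)); apply: ival_inj; rewrite ival_hi ?loE; last lra.
    by rewrite ival_lo hiE; lra.
  have pE : ival (phi i) = 2^-1 * ival i + 2^-1.
    by rewrite /phi clampK; mm.
  have hiE : ival (hi (phi i)) = ival i by rewrite ival_hi pE; lra.
  rewrite pE hiE ifF; last by lra.
  rewrite ifF; last by lra.
  congr (k (_, _)); apply: ival_inj; rewrite ival_hi ?ival_hi ?hiE//; lra.
have -> : fcat f (fcat g k) = reparam (fcat f (fcat g k)) id.
  by apply/funext => -[].
apply: hom_reparam.
- apply: cat_continuous => //; first exact: cat_continuous.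
  by move=> t; rewrite cat0.
- by rewrite /phi; ct.
- by ct.
- by apply: ival_inj; rewrite /phi ival0 clampK; mm.
- by apply: ival_inj; rewrite /phi ival1 clampK; mm.
- by move=> a i j Aa; apply: cA.
Qed.

Lemma hom_cat_cst f : continuous f -> (forall a i j, A a -> f (a, i) = f (a, j)) ->
  fhom A (fcat f (fun p => f (p.1, i1))) f.
Proof.
move=> cf fA; have -> : fcat f (fun p => f (p.1, i1)) = reparam f (@lo R).
  apply/funext => -[t i]; rewrite /fcat /reparam /=; case: leP => // ih.
  by rewrite lo_hi// ltW.
have {2}-> : f = reparam f id by apply/funext => -[].
apply: hom_reparam => //; first exact: lo_continuous; first exact: id_cont.
  by rewrite lo0.
by rewrite lo_hi// ival1 ltW// half_lt1.
Qed.

Lemma hom_cst_cat f : continuous f -> (forall a i j, A a -> f (a, i) = f (a, j)) ->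
  fhom A (fcat (fun p => f (p.1, i0)) f) f.
Proof.
move=> cf fA; have -> : fcat (fun p => f (p.1, i0)) f = reparam f (@hi R).
  apply/funext => -[t i]; rewrite /fcat /reparam /=; case: leP => // ih.
  by rewrite hi_lo.
have {2}-> : f = reparam f id by apply/funext => -[].
apply: hom_reparam => //; first exact: hi_continuous; first exact: id_cont.
  by rewrite hi_lo// ival0; lra.
by rewrite hi1.
Qed.

Lemma hom_cat_rev f : continuous f -> (forall a i j, A a -> f (a, i) = f (a, j)) ->
  fhom A (fcat f (frev f)) (fun p => f (p.1, i0)).
Proof.
(* A path followed by its reverse is the path composed with a tent function; the tent takes the
   value 0 at both ends, as does the constant reparametrisation 0. *)
move=> cf fA; pose tent i : I := clamp (Num.min (2 * ival i) (2 - 2 * ival i)).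
have -> : fcat f (frev f) = reparam f tent.
  apply/funext => -[t i]; rewrite /fcat /frev /reparam /=.
  have [i_ge0 i_le1] := (ival_ge0 i, ival_le1 i).
  case: leP => ih; congr (f (_, _)); apply: ival_inj.
    by rewrite ival_lo// /tent clampK; mm.
  by rewrite ival_inv ival_hi ?ltW// /tent clampK; mm.
have -> : (fun p : T * I => f (p.1, i0)) = reparam f (fun=> i0) by [].
apply: hom_reparam => //; first by rewrite /tent; ct.
- exact: cst_continuous.
- by rewrite /tent ival0 clamp_le0// ge_min mulr0 lexx.
- by rewrite /tent ival1 clamp_le0// ge_min; lra.
Qed.

Lemma hom_rev_cat f : continuous f -> (forall a i j, A a -> f (a, i) = f (a, j)) ->
  fhom A (fcat (frev f) f) (fun p => f (p.1, i1)).
Proof.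
move=> cf fA; rewrite -{2}(frevK f) -inv_I0.
apply: (@hom_cat_rev (frev f)); first exact: rev_continuous.
by move=> a i j Aa; exact: fA.
Qed.

End OneSpace.

Lemma hom_push (T X Y : topologicalType) (A : set T) (k : X -> Y)
    (f g : T * I -> X) :
  continuous k -> fhom A f g -> fhom A (fun p => k (f p)) (fun p => k (g p)).
Proof.
move=> ck [H [cH H0 H1 HA]]; exists (fun p => k (H p)); split.
- by ct.
- by move=> p; rewrite H0.
- by move=> p; rewrite H1.
- by move=> p s /HA ->.
Qed.

Lemma push_cat (T X Y : Type) (k : X -> Y) (f g : T * I -> X) :
  (fun p => k (fcat f g p)) = fcat (fun p => k (f p)) (fun p => k (g p)).
Proof. by apply/funext => p; rewrite /fcat; case: ifP. Qed.

Lemma hom_pull (S T X : topologicalType) (B : set S) (A : set T) (u : S -> T)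
    (f g : T * I -> X) :
  continuous u -> (forall b, B b -> A (u b)) -> fhom A f g ->
  fhom B (fun p => f (u p.1, p.2)) (fun p => g (u p.1, p.2)).
Proof.
move=> cu uBA [H [cH H0 H1 HA]].
exists (fun p => H ((u p.1.1, p.1.2), p.2)); split.
- by ct.
- by move=> p; rewrite /= H0.
- by move=> p; rewrite /= H1.
- move=> [b i] s /= bi; rewrite HA//.
  by case: bi => /= [/uBA|->|->]; [constructor 1|constructor 2|constructor 3].
Qed.

Section Loops.
Variables (T X : topologicalType) (A : set T) (x0 : X).
Implicit Types f g k : T * I -> X.

Lemma floop_cst : floop A x0 (fun=> x0).
Proof. by split => //; exact: cst_continuous. Qed.

Lemma floop0 f t : floop A x0 f -> f (t, i0) = x0.
Proof. by move=> [_ ->//]; constructor 2. Qed.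

Lemma floop1 f t : floop A x0 f -> f (t, i1) = x0.
Proof. by move=> [_ ->//]; constructor 3. Qed.

Lemma floopA f a i : floop A x0 f -> A a -> f (a, i) = x0.
Proof. by move=> [_ fe] Aa; rewrite fe//; constructor 1. Qed.

Lemma floop_cstA f : floop A x0 f -> forall a i j, A a -> f (a, i) = f (a, j).
Proof. by move=> lf a i j Aa; rewrite !(floopA _ lf). Qed.

Lemma floop_cat f g : floop A x0 f -> floop A x0 g -> floop A x0 (fcat f g).
Proof.
move=> lf lg; split.
  apply: cat_continuous; [by case: lf|by case: lg|].
  by move=> t; rewrite (floop1 _ lf) (floop0 _ lg).
move=> [t i]; rewrite /rel_ends /frev /= => -[At|->|->].
- by rewrite /fcat; case: ifP => _; rewrite ?(floopA _ lf) ?(floopA _ lg).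
- by rewrite cat0 (floop0 _ lf).
- by rewrite cat1 (floop1 _ lg).
Qed.

Lemma floop_rev f : floop A x0 f -> floop A x0 (frev f).
Proof.
move=> lf; split; first by apply: rev_continuous; case: lf.
move=> [t i]; rewrite /rel_ends /frev /= => -[At|->|->].
- by rewrite (floopA _ lf).
- by rewrite inv_I0 (floop1 _ lf).
- by rewrite inv_I1 (floop0 _ lf).
Qed.

Lemma floop_hom f g : floop A x0 f -> fhom A f g -> floop A x0 g.
Proof.
move=> lf fg; split; first exact: hom_cont_r fg.
by case: fg => H [_ _ H1 HA] p pA; rewrite -H1 HA//; case: lf => _ ->.
Qed.

Lemma floop_homr f g : floop A x0 g -> fhom A f g -> floop A x0 f.
Proof. by move=> lg /hom_sym; exact: floop_hom. Qed.

Lemma hom_catA f g k : floop A x0 f -> floop A x0 g -> floop A x0 k ->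
  fhom A (fcat (fcat f g) k) (fcat f (fcat g k)).
Proof.
move=> lf lg lk; apply: hom_cat_assoc; [by case: lf|by case: lg|by case: lk|..].
- by move=> t; rewrite (floop1 _ lf) (floop0 _ lg).
- by move=> t; rewrite (floop1 _ lg) (floop0 _ lk).
- by apply: floop_cstA; apply: floop_cat => //; exact: floop_cat.
Qed.

Lemma hom_cat2 f f' g g' : floop A x0 f -> floop A x0 g ->
  fhom A f f' -> fhom A g g' -> fhom A (fcat f g) (fcat f' g').
Proof.
by move=> lf lg; apply: hom_cat => t; rewrite (floop1 _ lf) (floop0 _ lg).
Qed.

Lemma hom_catr1 f g : floop A x0 f -> fhom A g (fun=> x0) -> fhom A (fcat f g) f.
Proof.
move=> lf g1; have lg := floop_homr floop_cst g1.
apply: (hom_trans (hom_cat2 lf lg (hom_refl _ _) g1)); first by case: lf.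
have -> : (fun=> x0) = (fun p : T * I => f (p.1, i1)).
  by apply/funext => p; rewrite (floop1 _ lf).
apply: hom_cat_cst; [by case: lf|exact: floop_cstA].
Qed.

Lemma hom_catl1 f g : floop A x0 g -> fhom A f (fun=> x0) -> fhom A (fcat f g) g.
Proof.
move=> lg f1; have lf := floop_homr floop_cst f1.
apply: (hom_trans (hom_cat2 lf lg f1 (hom_refl _ _))); first by case: lg.
have -> : (fun=> x0) = (fun p : T * I => g (p.1, i0)).
  by apply/funext => p; rewrite (floop0 _ lg).
apply: hom_cst_cat; [by case: lg|exact: floop_cstA].
Qed.

Lemma hom_catrev f : floop A x0 f -> fhom A (fcat f (frev f)) (fun=> x0).
Proof.
move=> lf; have -> : (fun=> x0) = (fun p : T * I => f (p.1, i0)).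
  by apply/funext => p; rewrite (floop0 _ lf).
apply: hom_cat_rev; [by case: lf|exact: floop_cstA].
Qed.

Lemma hom_revcat f : floop A x0 f -> fhom A (fcat (frev f) f) (fun=> x0).
Proof. by move=> lf; rewrite -{2}(frevK f); apply: hom_catrev; exact: floop_rev. Qed.

Lemma hom_catKr f g : floop A x0 f -> floop A x0 g ->
  fhom A (fcat f (fcat (frev f) g)) g.
Proof.
move=> lf lg; apply: hom_trans (hom_sym (hom_catA lf (floop_rev lf) lg)) _.
by apply: hom_catl1 => //; exact: hom_catrev.
Qed.

Lemma hom_catK f g : floop A x0 f -> floop A x0 g ->
  fhom A (fcat (frev f) (fcat f g)) g.
Proof.
by move=> lf lg; rewrite -{2}(frevK f); apply: hom_catKr => //; exact: floop_rev.
Qed.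

Lemma hom_cat_cancel f g k : floop A x0 f -> floop A x0 g -> floop A x0 k ->
  fhom A (fcat f g) (fcat f k) -> fhom A g k.
Proof.
move=> lf lg lk fgk; apply: hom_trans (hom_sym (hom_catK lf lg)) _.
apply: hom_trans (hom_catK lf lk).
have lr := floop_rev lf.
apply: hom_cat2 => //; [exact: floop_cat|by apply: hom_refl; case: lr].
Qed.

End Loops.

Lemma floop_push (T X Y : topologicalType) (A : set T) (x0 : X) (k : X -> Y)
    (f : T * I -> X) :
  continuous k -> floop A x0 f -> floop A (k x0) (fun p => k (f p)).
Proof. by move=> ck [cf fe]; split=> [|p /fe ->//]; ct. Qed.

End Families.

(** * Subspaces and path spaces *)

Lemma sub_cont (X T : topologicalType) (A : set T) (f : X -> A) :
  continuous (fun x => set_val (f x)) -> continuous f.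
Proof. by move=> cf; exact: continuous_comp_initial. Qed.

Lemma val_cont (X T : topologicalType) (A : set T) (f : X -> A) :
  continuous f -> continuous (fun x => set_val (f x)).
Proof. by move=> cf; apply: comp_cont cf; exact: initial_continuous. Qed.

Section PathSpaces.
Variable R : realType.
Local Notation I := (unit_interval R).

Lemma I_compact : compact [set: I].
Proof.
have -> : [set: I] = @clamp R @` `[0, 1]%classic.
  apply/seteqP; split => // t _; exists (ival t); last exact: ivalK.
  by rewrite /= in_itv /= ival_itv.
apply: continuous_compact; last exact: segment_compact.
by apply: continuous_subspaceT; exact: clamp_continuous.
Qed.

Lemma I_hausdorff : hausdorff_space I.
Proof.
move=> s t st; apply: ival_inj; apply: (@Rhausdorff R) => U W Us Wt.
have [z [Uz Wz]] := st _ _ (@ival_continuous R s _ Us) (@ival_continuous R t _ Wt).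
by exists (ival z).
Qed.

Lemma curry_cont (Y V : topologicalType) (N : Y * I -> V) : continuous N ->
  continuous ((fun y i => N (y, i)) : Y -> {compact-open, I -> V}).
Proof. exact: continuous_curry_fun. Qed.

(** The whole of [K] serves as a compact neighbourhood of each of its points, which is what the
    exponential law asks for. *)
Lemma uncurry_compact_cont (Y K V : topologicalType) (f : Y -> {compact-open, K -> V}) :
  compact [set: K] -> hausdorff_space K ->
  continuous f -> (forall y, continuous (f y : K -> V)) ->
  continuous (fun p : Y * K => (f p.1 : K -> V) p.2).
Proof.
move=> cptK hK cf cfy.
have -> : (fun p : Y * K => (f p.1 : K -> V) p.2) = uncurry (f : Y -> K -> V).
  by apply/funext => -[].
apply: continuous_uncurry => // t _; exists setT; first exact: filterT.
by split; [exact: cptK|exact: closedT].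
Qed.

Lemma uncurry_cont (Y V : topologicalType) (f : Y -> {compact-open, I -> V}) :
  continuous f -> (forall y, continuous (f y : I -> V)) ->
  continuous (fun p : Y * I => (f p.1 : I -> V) p.2).
Proof. by apply: uncurry_compact_cont; [exact: I_compact|exact: I_hausdorff]. Qed.

(** * Loop spaces and families of loops *)

Section Loop.
Variables (X : topologicalType) (x0 : X).

(** Made total, with the constant loop as default, so that a loop can be built from a bare function
    and the proofs be supplied afterwards by [to_loopE]. *)
Definition to_loop (w : I -> X) : loop_space R x0 :=
  match pselect [/\ continuous w, w zero = x0 & w one = x0] with
  | left h => @mk_path I X x0 x0 w (and3_rect (fun a _ _ => a) h)
       (and3_rect (fun _ b _ => b) h) (and3_rect (fun _ _ c => c) h)
  | right _ => loop_pt R x0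
  end.

Lemma to_loopE (w : I -> X) : continuous w -> w (I0 R) = x0 -> w (I1 R) = x0 ->
  (to_loop w : I -> X) = w.
Proof. by move=> cw w0 w1; rewrite /to_loop; case: pselect => [h|[]]. Qed.

Lemma loop_cont (T : topologicalType) (f : T -> loop_space R x0) :
  continuous ((fun t => f t : I -> X) : T -> {compact-open, I -> X}) ->
  continuous f.
Proof.
move=> cf z U [?]; case; case=> W oW <- Wz /filterS; apply.
exact: (cf z W (open_nbhs_nbhs (conj oW Wz))).
Qed.

Lemma ev_cont (T : topologicalType) (f : T -> loop_space R x0) :
  continuous f -> continuous (fun p : T * I => (f p.1 : I -> X) p.2).
Proof.
move=> cf; apply: (@uncurry_cont T X (fun t => (f t : I -> X))).
  apply: (@comp_cont _ _ _ (fun w : loop_space R x0 =>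
    (w : I -> X) : {compact-open, I -> X})) cf.
  exact: (@initial_continuous (loop_space R x0) {compact-open, I -> X}).
by move=> t; exact: cts_fun.
Qed.

Lemma to_loop_cont (T : topologicalType) (w : T * I -> X) :
  continuous w -> (forall t, w (t, I0 R) = x0) -> (forall t, w (t, I1 R) = x0) ->
  continuous (fun t => to_loop (fun i => w (t, i))).
Proof.
move=> cw w0 w1; apply: loop_cont.
have -> : (fun t => (to_loop (fun i => w (t, i)) : I -> X)) = fun t i => w (t, i).
  by apply/funext => t; rewrite to_loopE//; ct.
exact: curry_cont.
Qed.

End Loop.

Lemma hom_to_loop (T X : topologicalType) (x0 : X) (A : set T) (f g : T * I -> X) :
  floop A x0 f -> fhom A f g ->
  homotopic_rel R A (fun t => to_loop x0 (fun i => f (t, i)))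
                    (fun t => to_loop x0 (fun i => g (t, i))).
Proof.
move=> [cf fe] [H [cH H0 H1 HA]].
exists (fun p => to_loop x0 (fun i => H ((p.1, i), p.2))); split.
- apply: (@to_loop_cont _ _ _ (fun p => H ((p.1.1, p.2), p.1.2))); first by ct.
    by move=> -[t s]; rewrite /= HA ?fe//; constructor 2.
  by move=> -[t s]; rewrite /= HA ?fe//; constructor 3.
- by move=> t; congr to_loop; apply/funext => i; rewrite /= H0.
- by move=> t; congr to_loop; apply/funext => i; rewrite /= H1.
- by move=> a t Aa; congr to_loop; apply/funext => i; rewrite /= HA//; constructor 1.
Qed.

(** * Splittings *)

(* Testing against all parameter spaces [(T, A)] covers both the loop spaces and
   the homotopy groups. *)
Definition splits (M V S : topologicalType) (m : M) (v : V) (s : S)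
    (sg : V -> M) (tau : S -> M) :=
  [/\ continuous sg, continuous tau, sg v = m, tau s = m &
  forall (T : topologicalType) (A : set T),
    (forall w : T * I -> M, floop A m w -> exists a b, [/\ floop A v a, floop A s b &
      fhom A w (fcat (fun p => sg (a p)) (fun p => tau (b p)))]) /\
    (forall (a : T * I -> V) (b : T * I -> S) a' b', floop A v a -> floop A s b ->
      floop A v a' -> floop A s b' ->
      fhom A (fcat (fun p => sg (a p)) (fun p => tau (b p)))
            (fcat (fun p => sg (a' p)) (fun p => tau (b' p))) ->
      fhom A a a' /\ fhom A b b')].

(** A family of loops sends [rel_ends A] to [x0], where the homotopy is stationary. This is why
    equivalences are required to be pointed with pointed homotopies. *)
Lemma hom_homotopic (T X Y : topologicalType) (A : set T) (x0 : X)
    (f g : X -> Y) (w : T * I -> X) :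
  floop A x0 w -> homotopic_rel R [set x0] f g ->
  fhom A (fun p => f (w p)) (fun p => g (w p)).
Proof.
move=> [cw we] [H [cH H0 H1 HA]]; exists (fun p => H (w p.1, p.2)); split.
- by ct.
- by move=> p; rewrite H0.
- by move=> p; rewrite H1.
- by move=> p s /we wp; rewrite /= HA.
Qed.

(** Lets the splitting be proved for the model (the book and its homotopy fibre) and then be
    transported to [M] and the double suspension. *)
Lemma splits_equiv (M M' V S S' : topologicalType) (m : M) (m' : M') (v : V)
    (s : S) (s' : S') (sg : V -> M) (tau : S -> M) :
  pointed_homotopy_equivalent R m m' -> pointed_homotopy_equivalent R s s' ->
  splits m v s sg tau ->
  exists sg' tau', splits m' v s' sg' tau'.
Proof.
move=> [f [g [cf cg [fm gm] gf fg]]] [c [j [cc cj [cs js] jc cj1]]].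
move=> [csg ctau sgv taus H].
exists (fun x => f (sg x)), (fun y => f (tau (j y))); split.
- by ct.
- by ct.
- by rewrite sgv.
- by rewrite js taus.
move=> T A; have [surj inj] := H T A; split.
  move=> w lw; have lgw : floop A m (fun p => g (w p)).
    by rewrite -gm; exact: floop_push.
  have [a [b [la lb wab]]] := surj _ lgw.
  have lcb : floop A s' (fun p => c (b p)) by rewrite -cs; exact: floop_push.
  exists a, (fun p => c (b p)); split => //.
  apply: hom_trans (hom_sym (hom_homotopic lw fg)) _.
  apply: hom_trans (hom_push cf wab) _; rewrite push_cat.
  have lsa : floop A m (fun p => sg (a p)) by rewrite -sgv; exact: floop_push.
  have ltb : floop A m (fun p => tau (b p)) by rewrite -taus; exact: floop_push.
  apply: (@hom_cat2 _ _ _ _ m').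
  - by rewrite -fm; apply: floop_push.
  - by rewrite -fm; apply: floop_push.
  - by apply: hom_refl; case: lsa => ? _; ct.
  - apply: (hom_push cf); apply: (hom_push ctau); apply: hom_sym.
    exact: (hom_homotopic lb jc).
move=> a b a' b' la lb la' lb' E.
(* Applying [g] to a product formed in [M'] returns, up to homotopy, the product formed in [M], so
   that injectivity there applies. *)
have push (d : T * I -> V) (e : T * I -> S') : floop A v d -> floop A s' e ->
    fhom A (fun p => g (fcat (fun p => f (sg (d p))) (fun p => f (tau (j (e p)))) p))
          (fcat (fun p => sg (d p)) (fun p => tau (j (e p)))).
  move=> ld le; rewrite push_cat.
  have lsd : floop A m (fun p => sg (d p)) by rewrite -sgv; exact: floop_push.
  have lte : floop A m (fun p => tau (j (e p))).
    by rewrite -taus -js; do 2 apply: floop_push => //.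
  apply: (@hom_cat2 _ _ _ _ m); [rewrite -gm -fm; do 2 apply: floop_push => //..| |].
  - exact: (hom_homotopic lsd gf).
  - exact: (hom_homotopic lte gf).
have {}E := hom_trans (hom_sym (push _ _ la lb))
  (hom_trans (hom_push cg E) (push _ _ la' lb')).
have lj (e : T * I -> S') : floop A s' e -> floop A s (fun p => j (e p)).
  by move=> le; rewrite -js; exact: floop_push.
have [aa' bb'] := inj _ _ _ _ la (lj _ lb) la' (lj _ lb') E; split => //.
apply: hom_trans (hom_sym (hom_homotopic lb cj1)) _.
by apply: hom_trans (hom_push cc bb') _; exact: (hom_homotopic lb' cj1).
Qed.

(* Yoneda: the universal families of loops are those given by evaluation. *)
Lemma splits_loop_space (M V S : topologicalType) (m : M) (v : V) (s : S) sg tau :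
  splits m v s sg tau ->
  pointed_homotopy_equivalent R
    (X := loop_space R m) (Y := (loop_space R v * loop_space R s)%type)
    (loop_pt R m) (loop_pt R v, loop_pt R s).
Proof.
move=> [csg ctau sgv taus H].
pose ev : loop_space R m * I -> M := fun p => (p.1 : I -> M) p.2.
have lev : floop [set loop_pt R m] m ev.
  split; first by apply: (@ev_cont _ _ _ (fun w : loop_space R m => w)); ct.
  move=> [w i]; rewrite /rel_ends /ev /= => -[->//|->|->].
    by rewrite (@path_zero I M m m).
  by rewrite (@path_one I M m m).
pose L := (loop_space R v * loop_space R s)%type.
pose l0 : L := (loop_pt R v, loop_pt R s).
pose ev1 : L * I -> V := fun p => (p.1.1 : I -> V) p.2.
pose ev2 : L * I -> S := fun p => (p.1.2 : I -> S) p.2.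
have lev1 : floop [set l0] v ev1.
  split; first by apply: (@ev_cont _ _ _ (fun l : L => l.1)); ct.
  move=> [w i]; rewrite /rel_ends /ev1 /= => -[->//|->|->].
    by rewrite (@path_zero I V v v).
  by rewrite (@path_one I V v v).
have lev2 : floop [set l0] s ev2.
  split; first by apply: (@ev_cont _ _ _ (fun l : L => l.2)); ct.
  move=> [w i]; rewrite /rel_ends /ev2 /= => -[->//|->|->].
    by rewrite (@path_zero I S s s).
  by rewrite (@path_one I S s s).
(* Existence, applied to the universal family over the loop space of [M], produces the two
   components of [F]. *)
have [/(_ _ lev)[a [b [la lb evab]]] _] := H _ [set loop_pt R m].
pose th : L * I -> M := fcat (fun p => sg (ev1 p)) (fun p => tau (ev2 p)).
have lth : floop [set l0] m th.
  by apply: floop_cat; [rewrite -sgv|rewrite -taus]; exact: floop_push.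
pose G (l : L) : loop_space R m := to_loop m (fun i => th (l, i)).
pose F (w : loop_space R m) : L :=
  (to_loop v (fun i => a (w, i)), to_loop s (fun i => b (w, i))).
have GE l i : (G l : I -> M) i = th (l, i).
  rewrite /G to_loopE//.
  - by case: lth => clth _; ct.
  - by rewrite (floop0 _ lth).
  - by rewrite (floop1 _ lth).
have FE1 w i : ((F w).1 : I -> V) i = a (w, i).
  rewrite /F /= to_loopE//.
  - by case: la => ? _; ct.
  - by rewrite (floop0 _ la).
  - by rewrite (floop1 _ la).
have FE2 w i : ((F w).2 : I -> S) i = b (w, i).
  rewrite /F /= to_loopE//.
  - by case: lb => ? _; ct.
  - by rewrite (floop0 _ lb).
  - by rewrite (floop1 _ lb).
have cG : continuous G.
  apply: to_loop_cont; first by case: lth.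
  - by move=> l; rewrite (floop0 _ lth).
  - by move=> l; rewrite (floop1 _ lth).
have cF : continuous F.
  apply: pair_continuous; apply: to_loop_cont.
  - by case: la.
  - by move=> l; rewrite (floop0 _ la).
  - by move=> l; rewrite (floop1 _ la).
  - by case: lb.
  - by move=> l; rewrite (floop0 _ lb).
  - by move=> l; rewrite (floop1 _ lb).
have F0 : F (loop_pt R m) = l0.
  congr pair; apply/path_eqP => i.
    by rewrite FE1 (floopA _ la).
  by rewrite FE2 (floopA _ lb).
have G0 : G l0 = loop_pt R m by apply/path_eqP => i; rewrite GE (floopA _ lth).
have GFhom : fhom [set loop_pt R m] (fun p => th (F p.1, p.2)) ev.
  apply: hom_trans (hom_sym evab); have -> : (fun p : loop_space R m * I => th (F p.1, p.2)) =
      fcat (fun p => sg (a p)) (fun p => tau (b p)).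
    apply/funext => -[w i]; rewrite /th /fcat /ev1 /ev2 /=.
    by case: ifP => _; rewrite ?FE1 ?FE2.
  apply: hom_refl; apply: cat_continuous.
  - by case: la => ? _; ct.
  - by case: lb => ? _; ct.
  - by move=> w; rewrite (floop1 _ la) (floop0 _ lb) sgv taus.
have lthF : floop [set loop_pt R m] m (fun p => th (F p.1, p.2)).
  exact: (floop_homr lev).
have id_loop (T X : topologicalType) (x0 : X) (f : T -> loop_space R x0) :
    (fun t => to_loop x0 (fun i => (f t : I -> X) i)) = f.
  apply/funext => t; apply/path_eqP => i; rewrite to_loopE//.
  - exact: cts_fun.
  - exact: (@path_zero I X x0 x0).
  - exact: (@path_one I X x0 x0).
exists F, G; split => //.
  by have := hom_to_loop lthF GFhom; rewrite (id_loop _ _ _ id).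
(* Pulling back along [G] the decomposition of [ev] gives a second decomposition of [th], besides
   the evaluations; uniqueness over [L] identifies the two, which says that [F \o G] is homotopic to
   the identity. *)
pose u : L * I -> M := fun p => ev (G p.1, p.2).
have uth : u = th by apply/funext => -[l i]; rewrite /u /ev GE.
pose a' (p : L * I) := a (G p.1, p.2); pose b' (p : L * I) := b (G p.1, p.2).
have pull (X : topologicalType) (x0 : X) (f : loop_space R m * I -> X) :
    floop [set loop_pt R m] x0 f -> floop [set l0] x0 (fun p : L * I => f (G p.1, p.2)).
  move=> [cf fe]; split; first by ct.
  move=> [l i]; rewrite /rel_ends /= => -[->|->|->]; apply: fe.
  - by constructor 1; exact: G0.
  - by constructor 2.
  - by constructor 3.
have [_ inj] := H _ [set l0].
have [] := inj a' b' ev1 ev2 (pull _ _ _ la) (pull _ _ _ lb) lev1 lev2.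
  have -> : fcat (fun p => sg (a' p)) (fun p => tau (b' p)) =
     (fun p : L * I => fcat (fun p => sg (a p)) (fun p => tau (b p)) (G p.1, p.2)) by [].
  rewrite -/th -uth; apply: hom_pull (hom_sym evab) => // l ->; exact: G0.
move=> /(hom_to_loop (pull _ _ _ la)) [K1 [cK1 K10 K11 K1A]].
move=> /(hom_to_loop (pull _ _ _ lb)) [K2 [cK2 K20 K21 K2A]].
exists (fun p => (K1 p, K2 p)); split.
- by ct.
- by move=> l; rewrite K10 K20.
- move=> l; rewrite K11 K21.
  rewrite (congr1 (@^~ l) (id_loop _ _ _ fst)) (congr1 (@^~ l) (id_loop _ _ _ snd)).
  by rewrite -surjective_pairing.
- by move=> l t l_; rewrite K1A ?K2A.
Qed.

End PathSpaces.

(** * Homotopy groups *)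

Section HomotopyGroups.
Variable R : realType.
Local Notation I := (unit_interval R).

(* Eckmann-Hilton: families of double loops can also be concatenated in the
   second variable, and the two concatenations satisfy the interchange law. *)
Section EckmannHilton.
Variables (T X : topologicalType) (A : set T) (x0 : X).
Local Notation A' := (rel_ends A : set (T * I)).
Implicit Types u w : (T * I) * I -> X.

Definition transp u (p : (T * I) * I) : X := u ((p.1.1, p.2), p.1.2).

Lemma transpK u : transp (transp u) = u.
Proof. by apply/funext => -[[]]. Qed.

Lemma rel_ends2P (t : T) (i j : I) :
  rel_ends A' ((t, i), j) <-> rel_ends A' ((t, j), i).
Proof.
suff H a b : rel_ends A' ((t, a), b) -> rel_ends A' ((t, b), a) by split; exact: H.
rewrite /rel_ends /= => -[[tA|->|->]|->|->].
- by constructor 1; constructor 1.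
- by constructor 2.
- by constructor 3.
- by constructor 1; constructor 2.
- by constructor 1; constructor 3.
Qed.

Lemma floop_transp u : floop A' x0 u -> floop A' x0 (transp u).
Proof.
move=> [cu ue]; split; first by rewrite /transp; ct.
by move=> [[t i] j] /rel_ends2P; exact: ue.
Qed.

Lemma hom_transp u w : fhom A' u w -> fhom A' (transp u) (transp w).
Proof.
move=> [H [cH H0 H1 HA]]; exists (fun p => H (((p.1.1.1, p.1.2), p.1.1.2), p.2)); split.
- by ct.
- by move=> p; rewrite H0.
- by move=> p; rewrite H1.
- by move=> [[t i] j] s /rel_ends2P; exact: HA.
Qed.

Definition fcat' u w := transp (fcat (transp u) (transp w)).

(** An equality on the nose: the two case distinctions bear on different coordinates. *)
Lemma cat_interchange (a b c d : (T * I) * I -> X) :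
  fcat (fcat' a b) (fcat' c d) = fcat' (fcat a c) (fcat b d).
Proof.
apply/funext => -[[t i] j]; rewrite /fcat' /fcat /transp /=.
by case: ifP => _; case: ifP => _.
Qed.

Let le : floop A' x0 (fun _ : (T * I) * I => x0).
Proof. exact: floop_cst. Qed.

Lemma hom_cat'r1 u : floop A' x0 u -> fhom A' (fcat' u (fun=> x0)) u.
Proof.
move=> /floop_transp ltu; rewrite -{2}(transpK u); apply: hom_transp.
exact: (hom_catr1 ltu (hom_refl _ le.1)).
Qed.

Lemma hom_cat'l1 w : floop A' x0 w -> fhom A' (fcat' (fun=> x0) w) w.
Proof.
move=> /floop_transp ltw; rewrite -{2}(transpK w); apply: hom_transp.
exact: (hom_catl1 ltw (hom_refl _ le.1)).
Qed.

(** With [e] the constant family, [.] for [fcat] and [#] for [fcat']: u . w = (u # e) . (e # w) = (u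
    . e) # (e . w) = u # w up to homotopy. *)
Lemma hom_cat_cat' u w : floop A' x0 u -> floop A' x0 w ->
  fhom A' (fcat u w) (fcat' u w).
Proof.
move=> lu lw; have [u1 w1] := (hom_cat'r1 lu, hom_cat'l1 lw).
apply: hom_trans (hom_sym (hom_cat2 (floop_homr lu u1) (floop_homr lw w1) u1 w1)) _.
rewrite cat_interchange; apply: hom_transp.
apply: (hom_cat2 (floop_transp (floop_cat lu le)) (floop_transp (floop_cat le lw))).
- by apply: hom_transp; exact: (hom_catr1 lu (hom_refl _ le.1)).
- by apply: hom_transp; exact: (hom_catl1 lw (hom_refl _ le.1)).
Qed.

(** The same interchange with the constants on the other sides: w . u = (e # w) . (u # e) = (e . u)
    # (w . e) = u # w up to homotopy. *)
Lemma hom_cat'_catC u w : floop A' x0 u -> floop A' x0 w ->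
  fhom A' (fcat' u w) (fcat w u).
Proof.
move=> lu lw; have [u1 w1] := (hom_cat'r1 lu, hom_cat'l1 lw); apply: hom_sym.
apply: hom_trans (hom_sym (hom_cat2 (floop_homr lw w1) (floop_homr lu u1) w1 u1)) _.
rewrite cat_interchange; apply: hom_transp.
apply: (hom_cat2 (floop_transp (floop_cat le lu)) (floop_transp (floop_cat lw le))).
- by apply: hom_transp; exact: (hom_catl1 lu (hom_refl _ le.1)).
- by apply: hom_transp; exact: (hom_catr1 lw (hom_refl _ le.1)).
Qed.

Lemma hom_catC2 u w : floop A' x0 u -> floop A' x0 w ->
  fhom A' (fcat u w) (fcat w u).
Proof.
move=> lu lw; apply: hom_trans (hom_cat_cat' lu lw) _; exact: hom_cat'_catC.
Qed.

End EckmannHilton.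

Section Cubes.
Variable k : nat.
Local Notation cube := (cube R).
Local Notation bd k := (@cube_boundary R k).

(** The loop parameter is put in coordinate 0 because [concat] acts on that coordinate; thus
    [concat] becomes [fcat]. *)
Definition cube_join (p : cube k * I) : cube k.+1 :=
  fun i => if unlift ord0 i is Some j then p.1 j else p.2.

Definition cube_tail (x : cube k.+1) : cube k := fun j => x (lift ord0 j).

Lemma cube_joinK p : (cube_tail (cube_join p), cube_join p ord0) = p.
Proof.
case: p => y t; rewrite /cube_tail /cube_join /= unlift_none; congr pair.
by apply/funext => j; rewrite liftK; exact: erefl.
Qed.

Lemma cube_tailK x : cube_join (cube_tail x, x ord0) = x.
Proof.
apply/funext => i; rewrite /cube_join /cube_tail /=.
by case: unliftP => [j ->|->].
Qed.

Lemma ptws_cont (X : topologicalType) n (f : X -> cube n) :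
  (forall i, continuous (fun x => f x i)) -> continuous f.
Proof.
move=> cf x; have FF := fmap_filter f (nbhs_filter x).
apply/cvg_sup => i; move=> U [? /= [[W oW <-]]] /= Wx /filterS; apply.
by apply: cf; exact: open_nbhs_nbhs.
Qed.

Lemma coord_cont n (i : 'I_n) : continuous (fun x : cube n => x i).
Proof. exact: (@proj_continuous 'I_n (fun=> I) i). Qed.

Lemma cube_join_continuous : continuous cube_join.
Proof.
apply: ptws_cont => i; rewrite /cube_join; case: (unlift ord0 i) => [j|]; last by ct.
by apply: (@comp_cont _ _ _ (fun x : cube k => x j) fst); [exact: coord_cont|ct].
Qed.

Lemma cube_tail_continuous : continuous cube_tail.
Proof. by apply: ptws_cont => i; exact: coord_cont. Qed.

Lemma cube_join_boundary p : bd k.+1 (cube_join p) <-> rel_ends (bd k) p.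
Proof.
split=> [[i]|].
  rewrite /cube_join; case: (unlift ord0 i) => [j|] ij.
    by constructor 1; exists j.
  by case: ij => ij; [constructor 2|constructor 3].
rewrite /rel_ends /= => -[[j pj]|p0|p1].
- by exists (lift ord0 j); rewrite /cube_join liftK.
- by exists ord0; rewrite /cube_join unlift_none; left.
- by exists ord0; rewrite /cube_join unlift_none; right.
Qed.

Variables (X : topologicalType) (x0 : X).

Definition family_of (f : spheroid R x0 k.+1) : cube k * I -> X :=
  fun p => set_val f (cube_join p).

Lemma family_floop f : floop (bd k) x0 (family_of f).
Proof.
have [cf f0] := set_mem (svalP f); split.
  by rewrite /family_of; apply: comp_cont => //; exact: cube_join_continuous.
by move=> p /cube_join_boundary; exact: f0.
Qed.

Lemma spheroid_ofP (w : cube k * I -> X) : floop (bd k) x0 w ->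
  (fun x => w (cube_tail x, x ord0)) \in [set f : cube k.+1 -> X |
    continuous f /\ forall x, bd k.+1 x -> f x = x0].
Proof.
move=> [cw we]; apply/mem_set; split.
  apply: comp_cont => //; apply: pair_continuous; first exact: cube_tail_continuous.
  exact: coord_cont.
by move=> x bx; apply: we; apply/cube_join_boundary; rewrite cube_tailK.
Qed.

Definition spheroid_of w (lw : floop (bd k) x0 w) : spheroid R x0 k.+1 :=
  SigSub (spheroid_ofP lw).

Lemma family_spheroid w (lw : floop (bd k) x0 w) :
  family_of (spheroid_of lw) = w.
Proof.
by apply/funext => p; rewrite /family_of /spheroid_of set_valE /= cube_joinK.
Qed.

Lemma family_concat f g :
  family_of (concat f g) = fcat (family_of f) (family_of g).
Proof.
have cE : set_val (concat f g) = concat_fun (set_val f) (set_val g) by [].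
apply/funext => -[y t]; rewrite /family_of /fcat cE /= /concat_fun.
have jt : cube_join (y, t) ord0 = t by rewrite /cube_join unlift_none.
have sc s : set_coord0 (cube_join (y, t)) s = cube_join (y, s).
  apply/funext => i; rewrite /set_coord0 /cube_join.
  case: unliftP => [j ->|->]; last by rewrite eqxx.
  by rewrite eq_sym (negbTE (neq_lift _ _)).
by rewrite jt !sc.
Qed.

Lemma family_homotopic (f g : spheroid R x0 k.+1) :
  spheroid_homotopic f g <-> fhom (bd k) (family_of f) (family_of g).
Proof.
split=> [/asboolP|] [H [cH H0 H1 HA]].
  exists (fun p => H (cube_join p.1, p.2)); split.
  - by ct; exact: cube_join_continuous.
  - by move=> p; rewrite H0.
  - by move=> p; rewrite H1.
  - by move=> p s /cube_join_boundary/HA ->.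
apply/asboolP; exists (fun p => H ((cube_tail p.1, p.1 ord0), p.2)); split.
- ct; first exact: cube_tail_continuous.
  by apply: (@comp_cont _ _ _ (fun x : cube k.+1 => x ord0) fst);
    [exact: coord_cont|ct].
- by move=> x; rewrite H0 /family_of /= cube_tailK.
- by move=> x; rewrite H1 /family_of /= cube_tailK.
- move=> x s bx; rewrite HA /family_of /= ?cube_tailK//.
  by apply/cube_join_boundary; rewrite cube_tailK.
Qed.

Lemma class_eq (f g : spheroid R x0 k.+1) :
  hgroup_class f = hgroup_class g <-> fhom (bd k) (family_of f) (family_of g).
Proof.
rewrite -family_homotopic; split=> [/eqmodP//|fg]; exact/eqmodP.
Qed.

End Cubes.

(** When the parameter cube has positive dimension, its coordinate 0 is a second loop parameter, so
    the family is one of double loops over the cube of dimension [k]. *)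
Lemma hom_catC_cube (X : topologicalType) (x0 : X) k (u w : cube R k.+1 * I -> X) :
  floop (@cube_boundary R k.+1) x0 u -> floop (@cube_boundary R k.+1) x0 w ->
  fhom (@cube_boundary R k.+1) (fcat u w) (fcat w u).
Proof.
move=> lu lw.
have pull (f : cube R k.+1 * I -> X) : floop (@cube_boundary R k.+1) x0 f ->
    floop (rel_ends (@cube_boundary R k)) x0
      (fun p : (cube R k * I) * I => f (cube_join p.1, p.2)).
  move=> [cf fe]; split; first by ct; exact: cube_join_continuous.
  move=> [p i]; rewrite {1}/rel_ends /= => -[/cube_join_boundary bp|->|->]; apply: fe.
  - by constructor 1.
  - by constructor 2.
  - by constructor 3.
have H := hom_catC2 (pull _ lu) (pull _ lw).
pose r (x : cube R k.+1) := (cube_tail x, x ord0).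
have cr : continuous r.
  by apply: pair_continuous; [exact: cube_tail_continuous|exact: coord_cont].
have rb x : cube_boundary x -> rel_ends (@cube_boundary R k) (r x).
  by move=> bx; apply/cube_join_boundary; rewrite cube_tailK.
have := hom_pull cr rb H.
have E (f g : cube R k.+1 * I -> X) : (fun p : cube R k.+1 * I => fcat
     (fun q : (cube R k * I) * I => f (cube_join q.1, q.2))
     (fun q : (cube R k * I) * I => g (cube_join q.1, q.2)) (r p.1, p.2)) = fcat f g :> (_ -> X).
  by apply/funext => -[x i]; rewrite /fcat /= cube_tailK.
by rewrite !E.
Qed.

(** The bijection comes from the splitting over a cube of dimension [k], which describes the group
    of degree [k + 1]. For it to be a homomorphism, loops from [V] and from [S] must commute in [M];
    the extra hypothesis is what settles degree 1. *)
Lemma splits_hgroup (M V S : topologicalType) (m : M) (v : V) (s : S)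
    (sg : V -> M) (tau : S -> M) :
  splits R m v s sg tau ->
  (forall b : cube R 0 * I -> S, floop (@cube_boundary R 0) s b ->
     fhom (@cube_boundary R 0) b (fun=> s)) ->
  forall k, group_iso_prod
    (@hgroup_mul R M m k) (@hgroup_mul R V v k) (@hgroup_mul R S s k).
Proof.
move=> [csg ctau sgv taus H] simply k.
have [surj inj] := H _ (@cube_boundary R k).
pose cb := @cube_boundary R k.
have lsg (a : cube R k * I -> V) : floop cb v a -> floop cb m (fun p => sg (a p)).
  by move=> la; rewrite -sgv; exact: floop_push.
have ltau (b : cube R k * I -> S) : floop cb s b -> floop cb m (fun p => tau (b p)).
  by move=> lb; rewrite -taus; exact: floop_push.
have comm (a : cube R k * I -> V) (b : cube R k * I -> S) : floop cb v a -> floop cb s b ->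
    fhom cb (fcat (fun p => sg (a p)) (fun p => tau (b p)))
            (fcat (fun p => tau (b p)) (fun p => sg (a p))).
  move=> la lb; have [la' lb'] := (lsg _ la, ltau _ lb).
  move: @cb a b la lb la' lb' {surj inj lsg ltau}.
  case: k => [|k] cb a b la lb la' lb'.
    (* Degree 1: the loop from [S] is null-homotopic, hence commutes with everything. *)
    have b1 : fhom cb (fun p => tau (b p)) (fun=> m).
      by rewrite -taus; apply: (hom_push ctau (simply _ lb)).
    apply: hom_trans (hom_catr1 la' b1) _.
    exact: (hom_sym (hom_catl1 la' b1)).
  exact: (hom_catC_cube la' lb').
pose fam (X : topologicalType) (x : X) (c : hgroup R x k.+1) :=
  family_of (repr (c : {eq_quot (spheroid_equivRel R x k.+1)})).
have famE (X : topologicalType) (x : X) (f : spheroid R x k.+1) :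
    fhom cb (fam X x (hgroup_class f)) (family_of f).
  by apply/class_eq; rewrite /hgroup_class reprK.
have famK (X : topologicalType) (x : X) (c : hgroup R x k.+1) (f : spheroid R x k.+1) :
    fhom cb (fam X x c) (family_of f) -> c = hgroup_class f.
  by move/class_eq => <-; rewrite /hgroup_class reprK.
have famL (X : topologicalType) (x : X) (c : hgroup R x k.+1) :
    floop cb x (fam X x c) by exact: family_floop.
have fam_inj (X : topologicalType) (x : X) (c d : hgroup R x k.+1) :
    fhom cb (fam X x c) (fam X x d) -> c = d.
  by move/class_eq; rewrite /hgroup_class !reprK.
have fam_mul (X : topologicalType) (x : X) (c d : hgroup R x k.+1) :
    fhom cb (fam X x (hgroup_mul c d)) (fcat (fam X x c) (fam X x d)).
  by apply: hom_trans (famE _ _ _) _; rewrite family_concat;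
    apply: hom_refl; case: (floop_cat (famL _ _ c) (famL _ _ d)).
pose prod (c : hgroup R v k.+1) (d : hgroup R s k.+1) :=
  fcat (fun p => sg (fam V v c p)) (fun p => tau (fam S s d p)).
have prodL c d : floop cb m (prod c d).
  by apply: floop_cat; [exact/lsg/famL|exact/ltau/famL].
have ex (c : hgroup R m k.+1) : exists y : hgroup R v k.+1 * hgroup R s k.+1,
    fhom cb (fam M m c) (prod y.1 y.2).
  have [a [b [la lb wab]]] := surj _ (famL _ _ c).
  exists (hgroup_class (spheroid_of la), hgroup_class (spheroid_of lb)).
  apply: hom_trans wab _; apply: hom_sym; apply: (@hom_cat2 _ _ _ _ m).
  - exact/lsg/famL.
  - exact/ltau/famL.
  - apply: (hom_push csg); apply: hom_trans (famE _ _ _) _.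
    by rewrite family_spheroid; apply: hom_refl; case: la.
  - apply: (hom_push ctau); apply: hom_trans (famE _ _ _) _.
    by rewrite family_spheroid; apply: hom_refl; case: lb.
(* The components of a class are unique by the splitting, so any choice will do; the default pair of
   trivial classes only makes the choice total. *)
pose phi c := xget (hgroup_class (spheroid_of (floop_cst _ _ v)),
                    hgroup_class (spheroid_of (floop_cst _ _ s)))
  [set y : hgroup R v k.+1 * hgroup R s k.+1 | fhom cb (fam M m c) (prod y.1 y.2)].
have phiP c : fhom cb (fam M m c) (prod (phi c).1 (phi c).2).
  by rewrite /phi; case: xgetP => [y -> //|no]; have [y /no] := ex c.
have phi_uniq c y : fhom cb (fam M m c) (prod y.1 y.2) -> phi c = y.
  move=> cy; have := hom_trans (hom_sym (phiP c)) cy.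
  move=> /(inj _ _ _ _ (famL _ _ _) (famL _ _ _) (famL _ _ _) (famL _ _ _)).
  move=> [/fam_inj e1 /fam_inj e2].
  by rewrite [LHS]surjective_pairing [RHS]surjective_pairing e1 e2.
exists phi; split.
  exists (fun y => hgroup_class (spheroid_of (prodL y.1 y.2))) => [c|y].
    apply/esym/famK; rewrite family_spheroid; exact: phiP.
  apply: phi_uniq; apply: hom_trans (famE _ _ _) _.
  by rewrite family_spheroid; apply: hom_refl; case: (prodL y.1 y.2).
move=> c d; apply: phi_uniq => /=; apply: hom_trans (fam_mul _ _ _ _) _.
have refl (w : cube R k * I -> M) : floop cb m w -> fhom cb w w.
  by move=> [cw _]; exact: hom_refl.
have [c1 c2 d1 d2] := And4 (lsg _ (famL _ _ (phi c).1)) (ltau _ (famL _ _ (phi c).2))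
  (lsg _ (famL _ _ (phi d).1)) (ltau _ (famL _ _ (phi d).2)).
apply: hom_trans (hom_cat2 (famL _ _ _) (famL _ _ _) (phiP c) (phiP d)) _.
rewrite /prod; apply: hom_trans (hom_catA c1 c2 (floop_cat d1 d2)) _.
(* From c1 (c2 (d1 d2)) to c1 (d1 (c2 d2)): the factor c2 from [S] is moved past the factor d1 from
   [V], the only use of commutation. *)
apply: (@hom_trans _ _ _ _ _ (fcat (fun p => sg (fam V v (phi c).1 p))
  (fcat (fun p => sg (fam V v (phi d).1 p))
    (fcat (fun p => tau (fam S s (phi c).2 p)) (fun p => tau (fam S s (phi d).2 p)))))).
  apply: (hom_cat2 c1 (floop_cat c2 (floop_cat d1 d2)) (refl _ c1)).
  apply: hom_trans (hom_sym (hom_catA c2 d1 d2)) _.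
  apply: hom_trans (hom_catA d1 c2 d2).
  apply: (hom_cat2 (floop_cat c2 d1) d2 _ (refl _ d2)).
  by apply: hom_sym; apply: comm; exact: famL.
apply: hom_trans (hom_sym (hom_catA c1 d1 (floop_cat c2 d2))) _.
apply: (hom_cat2 (floop_cat c1 d1) (floop_cat c2 d2)).
  rewrite -push_cat; apply: (hom_push csg); exact: hom_sym.
by rewrite -push_cat; apply: (hom_push ctau); exact: hom_sym.
Qed.

End HomotopyGroups.

(** * The page bundle and its fibre *)

Section Fibre.
Variable R : realType.
Local Notation I := (unit_interval R).
Local Notation i0 := (I0 R).
Local Notation i1 := (I1 R).
Variables (V : topologicalType) (B : set V) (v0 : V).

Definition edge : set (I * I) :=
  [set w | [\/ w.1 = i0, w.1 = i1, w.2 = i0 | w.2 = i1]].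

(* The open book with trivial monodromy, with the square in place of the disk. *)
Definition book_set : set (V * (I * I)) := [set p | B p.1 \/ edge p.2].
Definition book : topologicalType := set_type book_set.

Definition corner : I * I := (i0, i0).

Lemma edge_corner : edge corner. Proof. by constructor 1. Qed.

Lemma book_ptP v : (v, corner) \in book_set.
Proof. by apply/mem_set; right; exact: edge_corner. Qed.

Definition page (v : V) : book := SigSub (book_ptP v).

Definition to_book (v : V) (w : I * I) : book := insubd (page v) (v, w).

Lemma to_bookE v w : B v \/ edge w -> set_val (to_book v w) = (v, w).
Proof. by move=> vw; rewrite /to_book /insubd insubT//; exact/mem_set. Qed.

Lemma to_book_val (x : book) : to_book (set_val x).1 (set_val x).2 = x.
Proof.
apply: val_inj; rewrite -set_valE to_bookE; last exact: (set_mem (svalP x)).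
by rewrite -surjective_pairing.
Qed.

Lemma to_book_cont (T : topologicalType) (v : T -> V) (w : T -> I * I) :
  continuous v -> continuous w -> (forall t, B (v t) \/ edge (w t)) ->
  continuous (fun t => to_book (v t) (w t)).
Proof.
move=> cv cw vw; apply: sub_cont.
rewrite (_ : (fun x => _) = (fun t => (v t, w t))); first by ct.
by apply/funext => t; rewrite to_bookE.
Qed.

Definition book_proj (x : book) : V := (set_val x).1.
Definition book_angle (x : book) : I * I := (set_val x).2.

Lemma book_projP x : B (book_proj x) \/ edge (book_angle x).
Proof. exact: (set_mem (svalP x)). Qed.

Lemma book_proj_continuous : continuous book_proj.
Proof. by rewrite /book_proj; apply: fst_cont; apply: val_cont; exact: id_cont. Qed.

Lemma book_angle_continuous : continuous book_angle.
Proof. by rewrite /book_angle; apply: snd_cont; apply: val_cont; exact: id_cont. Qed.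

Lemma page_continuous : continuous page.
Proof. by apply: sub_cont; rewrite (_ : (fun x => _) = (fun v => (v, corner))) //; ct. Qed.

(* The homotopy fibre of [book_proj] over [v0]; the page coordinate is dropped,
   being the end point of the path. *)
Definition fibre_set : set ({compact-open, I -> V} * (I * I)) :=
  [set p | [/\ continuous (p.1 : I -> V), (p.1 : I -> V) i0 = v0 &
               B ((p.1 : I -> V) i1) \/ edge p.2]].
Definition fibre : topologicalType := set_type fibre_set.

Lemma fibre_ptP : ((cst v0, corner) : {compact-open, I -> V} * (I * I)) \in fibre_set.
Proof.
by apply/mem_set; split => //; [exact: cst_cont|right; exact: edge_corner].
Qed.

Definition fibre_pt : fibre := SigSub fibre_ptP.

Definition to_fibre (g : I -> V) (w : I * I) : fibre :=
  insubd fibre_pt ((g, w) : {compact-open, I -> V} * (I * I)).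

Definition fib_arc (x : fibre) : I -> V := (set_val x).1.
Definition angle (x : fibre) : I * I := (set_val x).2.

Lemma fibreP x :
  [/\ continuous (fib_arc x), fib_arc x i0 = v0 & B (fib_arc x i1) \/ edge (angle x)].
Proof. exact: (set_mem (svalP x)). Qed.

Lemma to_fibreE g w : continuous g -> g i0 = v0 -> B (g i1) \/ edge w ->
  fib_arc (to_fibre g w) = g /\ angle (to_fibre g w) = w.
Proof.
move=> cg g0 gw; rewrite /fib_arc /angle /to_fibre /insubd insubT//.
exact/mem_set.
Qed.

Lemma fibre_eq x y : fib_arc x = fib_arc y -> angle x = angle y -> x = y.
Proof.
move=> xy1 xy2; apply: val_inj; rewrite -set_valE.
by rewrite [LHS]surjective_pairing [RHS]surjective_pairing; congr pair.
Qed.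

Lemma to_fibreK x : to_fibre (fib_arc x) (angle x) = x.
Proof. by have [c e h] := fibreP x; have [? ?] := to_fibreE c e h; exact: fibre_eq. Qed.

Lemma to_fibre_pt : to_fibre (fun=> v0) corner = fibre_pt.
Proof. exact: (to_fibreK fibre_pt). Qed.

Lemma to_fibre_cont (T : topologicalType) (N : T * I -> V) (w : T -> I * I) :
  continuous N -> continuous w -> (forall t, N (t, i0) = v0) ->
  (forall t, B (N (t, i1)) \/ edge (w t)) ->
  continuous (fun t => to_fibre (fun i => N (t, i)) (w t)).
Proof.
move=> cN cw N0 N1; apply: sub_cont.
have -> : (fun t => set_val (to_fibre (fun i => N (t, i)) (w t))) =
    (fun t => ((fun i => N (t, i)) : {compact-open, I -> V}, w t)).
  apply/funext => t; have cNt : continuous (fun i => N (t, i)) by ct.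
  have [e1 e2] := to_fibreE cNt (N0 t) (N1 t).
  by rewrite [LHS]surjective_pairing; congr pair.
by apply: pair_continuous => //; exact: curry_cont.
Qed.

Lemma arc_cont (T : topologicalType) (u : T -> fibre) : continuous u ->
  continuous (fun p : T * I => fib_arc (u p.1) p.2).
Proof.
move=> cu; apply: (@uncurry_cont R T V (fun t => (set_val (u t)).1)).
  by apply: fst_cont; exact: val_cont.
by move=> t; have [] := fibreP (u t).
Qed.

Lemma angle_continuous : continuous angle.
Proof. by rewrite /angle; apply: snd_cont; apply: val_cont; exact: id_cont. Qed.

Definition fibre_incl (x : fibre) : book := to_book (fib_arc x i1) (angle x).

Lemma fibre_inclE x :
  book_proj (fibre_incl x) = fib_arc x i1 /\ book_angle (fibre_incl x) = angle x.
Proof.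
by have [_ _ h] := fibreP x; rewrite /book_proj /book_angle /fibre_incl to_bookE.
Qed.

Lemma fibre_incl_continuous : continuous fibre_incl.
Proof.
apply: to_book_cont => [| |x]; last by have [] := fibreP x.
  apply: (@comp_cont _ _ _ (fun p : fibre * I => fib_arc p.1 p.2) (fun x => (x, i1))); last by ct.
  by apply: (@arc_cont _ id); ct.
exact: angle_continuous.
Qed.

Lemma book_eq x y : book_proj x = book_proj y -> book_angle x = book_angle y -> x = y.
Proof.
move=> e1 e2; rewrite -(to_book_val x) -(to_book_val y).
by rewrite -/(book_proj x) e1 -/(book_angle x) e2.
Qed.

Lemma fibre_incl_pt : fibre_incl fibre_pt = page v0.
Proof. by have [e1 e2] := fibre_inclE fibre_pt; apply: book_eq; rewrite ?e1 ?e2. Qed.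

Section Families.
Variables (T : topologicalType) (A : set T).
Local Notation x0 := (page v0).

(** A lift to the homotopy fibre is a loop together with paths from [v0] to its projection, so a
    null-homotopy of the projection, started at [v0], is exactly the missing arc coordinate. *)
Lemma fibre_lift (w : T * I -> book) (N : (T * I) * I -> V) :
  floop A x0 w -> continuous N -> (forall p, N (p, i0) = v0) ->
  (forall p, N (p, i1) = book_proj (w p)) ->
  (forall p i, rel_ends A p -> N (p, i) = v0) ->
  let b p := to_fibre (fun i => N (p, i)) (book_angle (w p)) in
  floop A fibre_pt b /\ (fun p => fibre_incl (b p)) = w.
Proof.
move=> [cw we] cN N0 N1 NA b.
have bE p : fib_arc (b p) = (fun i => N (p, i)) /\ angle (b p) = book_angle (w p).
  apply: to_fibreE; first by ct.
    exact: N0.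
  by rewrite N1; exact: book_projP.
split; first split.
- apply: to_fibre_cont => //; first by ct; exact: book_angle_continuous.
  by move=> p; rewrite N1; exact: book_projP.
- move=> p pA; have [e1 e2] := bE p; apply: fibre_eq.
    by rewrite e1; apply/funext => i; rewrite NA.
  by rewrite e2 we.
- apply/funext => p; have [e1 e2] := bE p; have [f1 f2] := fibre_inclE (b p).
  by apply: book_eq; rewrite ?f1 ?f2 ?e1 ?e2.
Qed.

Lemma fibre_incl_null (b : T * I -> fibre) : floop A fibre_pt b ->
  fhom A (fun p => book_proj (fibre_incl (b p))) (fun=> v0).
Proof.
move=> [cb be]; exists (fun p => fib_arc (b p.1) (inv_I p.2)); split.
- by apply: (@comp_cont _ _ _ (fun p => fib_arc (b p.1) p.2) (fun p => (p.1, inv_I p.2)));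
    [exact: arc_cont|ct].
- by move=> p; rewrite inv_I0 (fibre_inclE (b p)).1.
- by move=> p; rewrite inv_I1; have [] := fibreP (b p).
- by move=> p s pA; rewrite be// (fibre_inclE _).1.
Qed.

End Families.

(* A null-homotopy [K] of [fibre_incl b] projects to a null-homotopy of the
   projected loop, which need not be the one contained in [b]; the two differ
   by a family of loops [D] in [V], and [page D] followed by [K] projects to
   the right class. *)
Lemma fibre_incl_kernel (T : topologicalType) (A : set T) (b : T * I -> fibre) :
  floop A fibre_pt b -> fhom A (fun p => fibre_incl (b p)) (fun=> page v0) ->
  fhom A b (fun=> fibre_pt).
Proof.
move=> lb /hom_sym[K [cK K0 K1 KA]]; have [cb be] := lb.
pose C : set (T * I) := rel_ends A.
pose N (p : (T * I) * I) := fib_arc (b p.1) p.2.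
have cN : continuous N by exact: arc_cont.
have N0 p : N (p, i0) = v0 by rewrite /N; have [] := fibreP (b p).
have N1 p : N (p, i1) = book_proj (fibre_incl (b p)) by rewrite (fibre_inclE _).1.
have NC p i : C p -> N (p, i) = v0 by move=> Cp; rewrite /N be.
pose pK p := book_proj (K p).
have cpK : continuous pK by rewrite /pK; ct; exact: book_proj_continuous.
have pK1 p : pK (p, i1) = N (p, i1) by rewrite N1 /pK K1.
have pK0 p : pK (p, i0) = v0 by rewrite /pK K0.
have pKC p i : C p -> pK (p, i) = v0 by move=> Cp; rewrite /pK KA.
pose D := fcat N (frev pK).
have lD : floop C v0 D.
  split.
    apply: cat_continuous => //; first exact: rev_continuous.
    by move=> p; rewrite /frev /= inv_I0 pK1.
  move=> [p i]; rewrite {1}/rel_ends /= => -[Cp|->|->].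
  - by rewrite /D /fcat /frev /=; case: ifP => _; rewrite ?NC ?pKC.
  - by rewrite /D cat0.
  - by rewrite /D cat1 /frev /= inv_I1.
have [cD _] := lD.
pose K' := fcat (fun p => page (D p)) K.
have cK' : continuous K'.
  apply: cat_continuous => //; first by ct; exact: page_continuous.
  by move=> p; rewrite (floop1 _ lD) K0.
have K'0 p : K' (p, i0) = page v0 by rewrite /K' cat0 (floop0 _ lD).
have K'1 p : K' (p, i1) = fibre_incl (b p) by rewrite /K' cat1 K1.
have K'C p i : C p -> K' (p, i) = page v0.
  move=> Cp; rewrite /K' /fcat /=; case: ifP => _; last by rewrite KA.
  by rewrite (floopA _ lD).
pose pK' p := book_proj (K' p).
have [J [cJ J0 J1 JA]] : fhom C N pK'.
  apply: hom_sym; rewrite /pK' /K' push_cat.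
  have -> : (fun p => book_proj (page (D p))) = D by apply/funext.
  (* The correction by [D] has the desired effect: the projection of [K'] is [N], then [pK]
     reversed, then [pK], and the last two cancel. *)
  rewrite -/pK; apply: (@hom_trans _ _ _ _ _ (fcat N (fcat (frev pK) pK))).
    apply: hom_cat_assoc => //; first exact: rev_continuous.
    - by move=> t; rewrite /frev /= inv_I0 pK1.
    - by move=> t; rewrite /frev /= inv_I1.
    - move=> a i j Ca; suff H k : fcat N (fcat (frev pK) pK) (a, k) = v0 by rewrite !H.
      rewrite /fcat /=; case: ifP => _; first by rewrite NC.
      by case: ifP => _; rewrite /frev /= pKC.
  apply: (@hom_trans _ _ _ _ _ (fcat N (fun p => N (p.1, i1)))).
    apply: hom_cat; first by move=> t; rewrite cat0 /frev /= inv_I0 pK1.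
      exact: hom_refl.
    rewrite (_ : (fun p => _) = (fun p => pK (p.1, i1))); last first.
      by apply/funext => p; rewrite pK1.
    by apply: hom_rev_cat => // a i j Ca; rewrite !pKC.
  by apply: hom_cat_cst => // a i j Ca; rewrite !NC.
have cpK' : continuous pK' by rewrite /pK'; ct; exact: book_proj_continuous.
(* First the arcs alone are deformed, from [N] to [pK']. Their end points do not move, so the
   condition relating end point and angle persists. *)
apply: (@hom_trans _ _ _ _ _ (fun p => to_fibre (fun i => pK' (p, i)) (angle (b p)))).
  exists (fun p => to_fibre (fun i => J ((p.1, i), p.2)) (angle (b p.1))).
  have H1 p s : J ((p, i1), s) = fib_arc (b p) i1 by rewrite JA //; constructor 3.
  have H0 p s : J ((p, i0), s) = v0 by rewrite JA; [exact: N0|constructor 2].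
  split.
  - apply: (@to_fibre_cont _ (fun p => J ((p.1.1, p.2), p.1.2))).
    + by ct.
    + by ct; exact: angle_continuous.
    + by move=> t; exact: H0.
    + by move=> t /=; rewrite H1; have [] := fibreP (b t.1).
  - move=> p; rewrite -[RHS]to_fibreK; congr to_fibre.
    by apply/funext => i; rewrite J0.
  - by move=> p; congr to_fibre; apply/funext => i; rewrite J1.
  - move=> p s Cp; rewrite -[RHS]to_fibreK; congr to_fibre.
    by apply/funext => i; rewrite JA//; constructor 1.
apply: hom_sym.
(* Then [K'] itself is lifted: at time s the arc is the initial part of the projected path up to s,
   since [lerp i i0 s] is the product i s, and it ends at the projection of [K'] at time s. *)
exists (fun p => to_fibre (fun i => pK' (p.1, lerp i i0 p.2)) (book_angle (K' p))).
split.
- apply: (@to_fibre_cont _ (fun p => pK' (p.1.1, lerp p.2 i0 p.1.2))).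
  + by ct.
  + by ct; exact: book_angle_continuous.
  + by move=> t; rewrite lerp0 /pK' K'0.
  + by move=> [t s]; rewrite lerp1; exact: book_projP.
- move=> p; rewrite K'0 -to_fibre_pt; congr to_fibre.
  by apply/funext => i; rewrite lerp_id /pK' K'0.
- move=> p; rewrite K'1 (fibre_inclE _).2; congr to_fibre.
  apply/funext => i; congr (pK' (_, _)); apply: ival_inj.
  by rewrite lerpE ival0 ival1; lra.
- move=> p s Cp; rewrite K'C// -to_fibre_pt; congr to_fibre.
  by apply/funext => i; rewrite /pK' K'C.
Qed.

(** The section [page] splits the sequence of the fibration: the projection recovers the first
    factor, since the second projects to a null-homotopic family, and [fibre_incl_kernel] gives
    uniqueness of the second. *)
Lemma book_splits : splits R (page v0) v0 fibre_pt page fibre_incl.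
Proof.
split; [exact: page_continuous|exact: fibre_incl_continuous|by []|
  exact: fibre_incl_pt|].
have cq := fibre_incl_continuous; have cs := page_continuous.
have cp := book_proj_continuous.
move=> T A; split.
  move=> w lw; pose a p := book_proj (w p).
  have la : floop A v0 a by exact: (floop_push cp lw).
  have lsa : floop A (page v0) (fun p => page (a p)) by exact: (floop_push cs la).
  (* Removing the page part of [w] leaves a family whose projection is null-homotopic, hence one
     that lifts to the fibre. *)
  pose w' := fcat (frev (fun p => page (a p))) w.
  have lw' : floop A (page v0) w' by apply: floop_cat => //; exact: floop_rev.
  have [N [cN N0 N1 NA]] : fhom A (fun=> v0) (fun p => book_proj (w' p)).
    rewrite /w' push_cat; apply: hom_sym; exact: (hom_revcat la).
  have [lb bE] := fibre_lift lw' cN N0 N1 (fun p i pA => NA p i pA).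
  set b := (fun p => to_fibre _ _) in lb bE.
  exists a, b; split => //; rewrite bE; apply: hom_sym; exact: (hom_catKr lsa lw).
have ls (a : T * I -> V) : floop A v0 a -> floop A (page v0) (fun p => page (a p)).
  exact: (floop_push cs).
have lq (b : T * I -> fibre) : floop A fibre_pt b ->
    floop A (page v0) (fun p => fibre_incl (b p)).
  by rewrite -fibre_incl_pt; exact: (floop_push cq).
have proj (a : T * I -> V) (b : T * I -> fibre) : floop A v0 a -> floop A fibre_pt b ->
    fhom A (fun p => book_proj (fcat (fun p => page (a p)) (fun p => fibre_incl (b p)) p)) a.
  by move=> la lb; rewrite push_cat; exact: (hom_catr1 la (fibre_incl_null lb)).
move=> a b a' b' la lb la' lb' E.
have aa' : fhom A a a'.
  apply: hom_trans (hom_sym (proj _ _ la lb)) _.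
  exact: hom_trans (hom_push cp E) (proj _ _ la' lb').
split => //.
have qbb' : fhom A (fun p => fibre_incl (b p)) (fun p => fibre_incl (b' p)).
  apply: (hom_cat_cancel (ls _ la) (lq _ lb) (lq _ lb')).
  apply: hom_trans E _.
  apply: (hom_cat2 (ls _ la') (lq _ lb')); first exact: (hom_push cs (hom_sym aa')).
  by apply: hom_refl; case: (lq _ lb').
have lr := floop_rev lb'.
(* The kernel lemma concerns null-homotopic families, so [b] and [b'] are compared through the
   difference of the two. *)
have null : fhom A (fcat (frev b') b) (fun=> fibre_pt).
  apply: fibre_incl_kernel; first exact: floop_cat.
  rewrite push_cat; apply: hom_trans (hom_revcat (lq _ lb')).
  apply: (hom_cat2 (lq _ lr) (lq _ lb)) => //.
  by apply: hom_refl; case: (lq _ lr).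
apply: hom_trans (hom_sym (hom_catKr lb' lb)) _.
exact: (hom_catr1 lb' null).
Qed.

End Fibre.

(** * Quotients and gluing *)

Lemma hausdorff_prod (X Y : topologicalType) :
  hausdorff_space X -> hausdorff_space Y -> hausdorff_space (X * Y)%type.
Proof.
move=> hX hY [x y] [x' y'] xy; congr pair.
- apply: hX => U W Ux Wx'.
  have [[a b] [/= Ua Wa]] : [set p : X * Y | U p.1] `&` [set p | W p.1] !=set0.
    apply: xy; [exact: (@cvg_fst _ _ (nbhs x) (nbhs y) _ U)|
                exact: (@cvg_fst _ _ (nbhs x') (nbhs y') _ W)].
  by exists a.
- apply: hY => U W Uy Wy'.
  have [[a b] [/= Ub Wb]] : [set p : X * Y | U p.2] `&` [set p | W p.2] !=set0.
    apply: xy; [exact: (@cvg_snd _ _ (nbhs x) (nbhs y) _ U)|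
                exact: (@cvg_snd _ _ (nbhs x') (nbhs y') _ W)].
  by exists b.
Qed.

Lemma closed_preimage (X Y : topologicalType) (f : X -> Y) (D : set Y) :
  continuous f -> closed D -> closed (f @^-1` D).
Proof. by move=> cf; apply: preimage_closed => x _; exact: cf. Qed.

Lemma glue_cont (X Y : topologicalType) (A B : set X) (f : X -> Y) :
  closed A -> closed B -> (forall x, A x \/ B x) ->
  continuous (fun x : A => f (set_val x)) ->
  continuous (fun x : B => f (set_val x)) -> continuous f.
Proof.
move=> cA cB AB fA fB; apply/continuous_subspace_setT.
have -> : [set: X] = A `|` B by apply/seteqP; split => // x _; exact: AB.
by apply: withinU_continuous => //; apply/subspace_sigL_continuousP.
Qed.

Section Quotient.
Variables (T : topologicalType) (r : T -> T -> Prop).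

Lemma qproj_continuous : continuous (qproj r).
Proof. exact: (@pi_continuous T {eq_quot (gen_equivRel r)}). Qed.

Lemma qproj_surj (x : qspace r) : exists t, x = qproj r t.
Proof.
exists (repr (x : {eq_quot (gen_equivRel r)})).
by rewrite /qproj (@reprK _ {eq_quot (gen_equivRel r)}).
Qed.

Lemma qproj_eq a b : r a b -> qproj r a = qproj r b.
Proof. by move=> ab; apply/eqmodP/asboolP; exact: rst_step. Qed.

Definition qlift (Z : Type) (f : T -> Z) (x : qspace r) : Z :=
  f (repr (x : {eq_quot (gen_equivRel r)})).

Lemma qliftE (Z : Type) (f : T -> Z) :
  (forall a b, r a b -> f a = f b) -> forall a, qlift f (qproj r a) = f a.
Proof.
move=> rf a; rewrite /qlift.
have inv b c : clos_refl_sym_trans T r b c -> f b = f c.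
  by elim=> // x y z _ -> _ ->.
apply: inv; suff : clos_refl_sym_trans T r (repr (qproj r a : {eq_quot (gen_equivRel r)})) a.
  by [].
by apply/asboolP; apply/(@eqmodP _ (gen_equivRel r)); rewrite reprK.
Qed.

Lemma qlift_continuous (Z : topologicalType) (f : T -> Z) : continuous f ->
  (forall a b, r a b -> f a = f b) -> continuous (qlift f).
Proof.
move=> cf rf; apply/(@quotient_continuous T {eq_quot (gen_equivRel r)}).
rewrite (_ : _ \o _ = f) //; apply/funext => a; exact: qliftE.
Qed.

(* A quotient map stays one after taking the product with a compact Hausdorff
   space. *)
Lemma qlift_param_continuous (K Z : topologicalType) (f : T * K -> Z) :
  compact [set: K] -> hausdorff_space K -> continuous f ->
  (forall a b k, r a b -> f (a, k) = f (b, k)) ->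
  continuous (fun p : qspace r * K => qlift (fun t => f (t, p.2)) p.1).
Proof.
move=> cptK hK cf rf.
pose g : T -> {compact-open, K -> Z} := fun t k => f (t, k).
have cg : continuous g by exact: continuous_curry_fun.
have rg a b : r a b -> g a = g b by move=> ab; apply/funext => k; exact: rf.
apply: (@uncurry_compact_cont _ _ _ (qlift g)) => //.
  exact: qlift_continuous.
by move=> y k; rewrite /qlift /g; apply: (@comp_cont _ _ _ f (fun k => (_, k))); ct.
Qed.

End Quotient.

(** * Maps and homotopies out of reduced suspensions *)

Section Suspension.
Variable R : realType.
Local Notation I := (unit_interval R).
Local Notation i0 := (I0 R).
Local Notation i1 := (I1 R).
Variables (X : topologicalType) (x0 : X).

Definition susp_proj (p : X * I) : reduced_susp R x0 := qproj (@reduced_susp_rel R X x0) p.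

Lemma susp_proj_continuous : continuous susp_proj.
Proof. exact: qproj_continuous. Qed.

Lemma susp_proj_pt p : [\/ p.2 = i0, p.2 = i1 | p.1 = x0] ->
  susp_proj p = reduced_susp_pt R x0.
Proof. by move=> h; apply: qproj_eq; split => //; constructor 1. Qed.

Lemma susp_lift_continuous (K Z : topologicalType) (f : (X * I) * K -> Z)
    (z0 : K -> Z) :
  compact [set: K] -> hausdorff_space K -> continuous f ->
  (forall p k, [\/ p.2 = i0, p.2 = i1 | p.1 = x0] -> f (p, k) = z0 k) ->
  exists g : reduced_susp R x0 * K -> Z, continuous g /\
    forall p k, g (susp_proj p, k) = f (p, k).
Proof.
move=> cptK hK cf f0.
have rf a b k : reduced_susp_rel x0 a b -> f (a, k) = f (b, k).
  by move=> [ha hb]; rewrite !f0.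
exists (fun p => qlift (fun t => f (t, p.2)) p.1); split.
  exact: qlift_param_continuous.
by move=> p k; rewrite /= qliftE // => a b; exact: rf.
Qed.

Lemma susp_proj_surj x : exists p, x = susp_proj p.
Proof. exact: qproj_surj. Qed.

End Suspension.

Section DoubleSuspension.
Variable R : realType.
Local Notation I := (unit_interval R).
Variables (X : topologicalType) (x0 : X).
Local Notation S2 := (reduced_susp R (reduced_susp_pt R x0)).
Local Notation s0 := (reduced_susp_pt R (reduced_susp_pt R x0)).

Definition susp2_proj (p : X * (I * I)) : S2 :=
  susp_proj (reduced_susp_pt R x0) (susp_proj x0 (p.1, p.2.1), p.2.2).

Lemma susp2_proj_continuous : continuous susp2_proj.
Proof. by rewrite /susp2_proj; ct; exact: susp_proj_continuous. Qed.

Lemma susp2_proj_pt p : edge p.2 \/ p.1 = x0 -> susp2_proj p = s0.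
Proof.
by move=> [[h|h|h|h]|h]; apply: susp_proj_pt => /=;
  [constructor 3; apply: susp_proj_pt; constructor 1|
   constructor 3; apply: susp_proj_pt; constructor 2|
   constructor 1|constructor 2|
   constructor 3; apply: susp_proj_pt; constructor 3].
Qed.

Lemma susp2_proj_surj x : exists p, x = susp2_proj p.
Proof.
have [[y t] ->] := susp_proj_surj x; have [[z s] ->] := susp_proj_surj y.
by exists (z, (s, t)).
Qed.

(** The two suspensions are removed one after the other. For the inner one the compact parameter is
    the outer suspension coordinate together with time, for the outer one it is time alone. *)
Lemma susp2_lift_continuous (Z : topologicalType) (f : (X * (I * I)) * I -> Z)
    (z0 : I -> Z) :
  continuous f -> (forall p k, edge p.2 \/ p.1 = x0 -> f (p, k) = z0 k) ->
  exists g : S2 * I -> Z, continuous g /\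
    forall p k, g (susp2_proj p, k) = f (p, k).
Proof.
move=> cf f0.
have cII : compact [set: I * I] by rewrite -setXTT; apply: compact_setX; exact: I_compact.
have hII : hausdorff_space (I * I)%type by apply: hausdorff_prod; exact: I_hausdorff.
have [g1 [cg1 g1E]] := @susp_lift_continuous R X x0 (I * I)%type Z
  (fun p => f ((p.1.1, (p.1.2, p.2.1)), p.2.2)) (fun k => z0 k.2) cII hII
  ltac:(by ct) (fun p k h => f0 (p.1, (p.2, k.1)) k.2
    match h with Or31 h => or_introl (Or41 _ _ _ h)
               | Or32 h => or_introl (Or42 _ _ _ h)
               | Or33 h => or_intror h end).
have g1pt t k : g1 (reduced_susp_pt R x0, (t, k)) = z0 k.
  by rewrite /reduced_susp_pt (g1E (x0, I0 R)) /= f0//; right.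
have g1e y t k : t = I0 R \/ t = I1 R -> g1 (y, (t, k)) = z0 k.
  move=> ht; have [p ->] := susp_proj_surj y; rewrite g1E /= f0//; left.
  by case: ht => ->; [constructor 3|constructor 4].
have [g [cg gE]] := @susp_lift_continuous R _ (reduced_susp_pt R x0) I Z
  (fun p => g1 (p.1.1, (p.1.2, p.2))) z0 (@I_compact R) (@I_hausdorff R)
  ltac:(by ct) (fun p k h => match h with Or31 h => g1e _ _ _ (or_introl h)
               | Or32 h => g1e _ _ _ (or_intror h)
               | Or33 h => etrans (congr1 (fun y => g1 (y, (p.2, k))) h) (g1pt _ _) end).
by exists g; split => // -[x [s t]] k; rewrite /susp2_proj /= gE /= g1E.
Qed.

End DoubleSuspension.

(** * Collapsing the fibre onto the double suspension *)

Section Square.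
Variable R : realType.
Local Notation I := (unit_interval R).
Local Notation i0 := (I0 R).
Local Notation i1 := (I1 R).

(** A polynomial equation of the boundary of the square, from which closedness of preimages
    follows. *)
Lemma edgeP (w : I * I) :
  edge w <-> ival w.1 * (1 - ival w.1) * (ival w.2 * (1 - ival w.2)) = 0.
Proof.
split=> [[] ->|/eqP]; rewrite ?ival0 ?ival1 ?subrr ?(mul0r, mulr0)//.
have ends (i : I) : ival i * (1 - ival i) == 0 -> i = i0 \/ i = i1.
  rewrite mulf_eq0 subr_eq0 => /orP[/eqP h|/eqP h]; [left|right];
    by apply: ival_inj; rewrite ?ival0 ?ival1.
by rewrite mulf_eq0 => /orP[/ends[]|/ends[]] h;
  [constructor 1|constructor 2|constructor 3|constructor 4].
Qed.

Lemma closed_edge (T : topologicalType) (u : T -> I * I) : continuous u ->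
  closed [set t | edge (u t)].
Proof.
move=> cu; pose e t := ival (u t).1 * (1 - ival (u t).1) *
  (ival (u t).2 * (1 - ival (u t).2)).
have -> : [set t | edge (u t)] = e @^-1` [set 0].
  by apply/seteqP; split => t /= /edgeP.
apply: closed_preimage; last exact: closed_eq.
by rewrite /e; ct.
Qed.

(** Dilation by 1 + s about the midpoint 1/2, cut back to the interval. *)
Definition expand (s i : I) : I := clamp ((1 + ival s) * (ival i - 2^-1) + 2^-1).

(* The amount by which the expanded point of the square is cut off. *)
Definition overshoot (s : I) (w : I * I) : I :=
  clamp ((1 + ival s) * Num.max `|2 * ival w.1 - 1| `|2 * ival w.2 - 1| - 1).

Lemma expand0 i : expand i0 i = i.
Proof. by rewrite /expand ival0 addr0 mul1r subrK ivalK. Qed.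

Lemma expand_i0 s : expand s i0 = i0.
Proof. by apply: clamp_le0; rewrite ival0; have := ival_ge0 s; lra. Qed.

Lemma expand_i1 s : expand s i1 = i1.
Proof. by apply: clamp_ge1; rewrite ival1; have := ival_ge0 s; lra. Qed.

Lemma edge_expand s w : edge w -> edge (expand s w.1, expand s w.2).
Proof.
by move=> [] h; [constructor 1|constructor 2|constructor 3|constructor 4];
  rewrite /= h ?expand_i0 ?expand_i1.
Qed.

Lemma abs_mid (i : I) : `|2 * ival i - 1| <= 1.
Proof. by rewrite ler_norml; have := ival_itv i; lra. Qed.

Lemma overshoot0 w : overshoot i0 w = i0.
Proof.
apply: clamp_le0; rewrite ival0 addr0 mul1r subr_le0 ge_max.
by rewrite !abs_mid.
Qed.

(** A positive overshoot means that the coordinate farther from 1/2 is dilated beyond the interval,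
    so that [clamp] sends it to an end. *)
Lemma overshoot_edge s w : overshoot s w <> i0 -> edge (expand s w.1, expand s w.2).
Proof.
move=> ne; have [s0 s1] := (ival_ge0 s, ival_le1 s).
have : 0 < (1 + ival s) * Num.max `|2 * ival w.1 - 1| `|2 * ival w.2 - 1| - 1.
  by rewrite ltNge; apply/negP => /clamp_le0.
have far (i : I) : 0 < (1 + ival s) * `|2 * ival i - 1| - 1 ->
    expand s i = i0 \/ expand s i = i1.
  case: (ger0P (2 * ival i - 1)) => _ h; [right|left].
    by apply: clamp_ge1; nra.
  by apply: clamp_le0; nra.
by case: (leP `|2 * ival w.1 - 1| `|2 * ival w.2 - 1|) => _ /far[] h;
  [constructor 3|constructor 4|constructor 1|constructor 2].
Qed.

Lemma overshoot1 w : edge w -> overshoot i1 w = i1.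
Proof.
move=> ew; apply: clamp_ge1; rewrite ival1.
suff -> : Num.max `|2 * ival w.1 - 1| `|2 * ival w.2 - 1| = 1 by lra.
apply/le_anti; rewrite ge_max !abs_mid /= le_max.
have e0 : 1 <= `|2 * ival i0 - 1| :> R by rewrite ival0 mulr0 sub0r normrN1.
have e1 : 1 <= `|2 * ival i1 - 1| :> R by rewrite ival1 mulr1 ger0_norm; lra.
by case: ew => ->; rewrite ?e0 ?e1 ?orbT.
Qed.

Lemma expand_cont (T : topologicalType) (u v : T -> I) :
  continuous u -> continuous v -> continuous (fun t => expand (u t) (v t)).
Proof. by move=> cu cv; rewrite /expand; ct. Qed.

Lemma overshoot_cont (T : topologicalType) (u : T -> I) (v : T -> I * I) :
  continuous u -> continuous v -> continuous (fun t => overshoot (u t) (v t)).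
Proof. by move=> cu cv; rewrite /overshoot; ct. Qed.

End Square.

Section Collapse.
Variable R : realType.
Local Notation I := (unit_interval R).
Local Notation i0 := (I0 R).
Local Notation i1 := (I1 R).
Variables (V : topologicalType) (B : set V) (b0 : B).
Hypothesis closedB : closed B.

(* [d] is a homotopy of the pair [(V, B)] contracting a neighbourhood of the
   base point, and [eta] is a cutoff function supported in that neighbourhood. *)
Variables (d : V * I -> V) (eta : V -> I).
Hypotheses (d_continuous : continuous d) (d0 : forall v, d (v, i0) = v).
Hypotheses (eta_continuous : continuous eta).

Local Notation incl := (fun b : B => set_val b : V).
Local Notation v0 := (incl b0).
Local Notation F := (hofiber R incl v0).
Local Notation f0 := (hofiber_pt R incl b0).
Local Notation S2F := (reduced_susp R (reduced_susp_pt R f0)).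
Local Notation s0 := (reduced_susp_pt R (reduced_susp_pt R f0)).
Local Notation E := (fibre R B v0).
Local Notation e0 := (fibre_pt R B v0).

Hypotheses (d_pt : forall s, d (v0, s) = v0)
  (d_B : forall v s, B v -> B (d (v, s)))
  (eta_pt : eta v0 = i1) (d_eta : forall v, eta v <> i0 -> d (v, i1) = v0).

Lemma B_v0 : B v0. Proof. exact: (set_mem (svalP b0)). Qed.

Definition outer (x : E) := edge (angle x) \/ fib_arc x = (fun=> v0).

Definition spread (p : E * I) : E :=
  to_fibre B v0 (fun i => fib_arc p.1 (lerp (overshoot p.2 (angle p.1)) i i0))
    (expand p.2 (angle p.1).1, expand p.2 (angle p.1).2).

Definition shrink (p : E * I) : E :=
  to_fibre B v0 (fun i => d (fib_arc p.1 i, p.2)) (angle p.1).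

(** The inner [lerp] from 0 to the value of [eta] is the product of the time with the cutoff at the
    end of the arc; this is how far the square coordinate is drawn towards the corner. *)
Definition slide (p : E * I) : E :=
  let k := lerp (lerp p.2 i0 (eta (fib_arc p.1 i1))) in
  to_fibre B v0 (fun i => d (fib_arc p.1 i, i1)) (k (angle p.1).1 i0, k (angle p.1).2 i0).

Lemma arc_cont2 (T : topologicalType) (u : T -> E) (v : T -> I) :
  continuous u -> continuous v -> continuous (fun t => fib_arc (u t) (v t)).
Proof.
move=> cu cv; apply: (@comp_cont _ _ _ (fun p => fib_arc (u p.1) p.2) (fun t => (t, v t))).
  exact: arc_cont.
by ct.
Qed.

(** The arc is shortened only where the overshoot is nonzero, and there the new square coordinate is
    on the edge, where the end of the arc is unrestricted. *)
Lemma spreadP (p : E * I) :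
  B (fib_arc p.1 (lerp (overshoot p.2 (angle p.1)) i1 i0)) \/
  edge (expand p.2 (angle p.1).1, expand p.2 (angle p.1).2).
Proof.
have [h|h] := pselect (overshoot p.2 (angle p.1) = i0).
  rewrite h lerp0; have [_ _ [?|/edge_expand ?]] := fibreP p.1; [by left|right].
  by [].
by right; exact: overshoot_edge.
Qed.

Lemma arc_start (x : E) : fib_arc x i0 = v0. Proof. by have [] := fibreP x. Qed.

Lemma arc_continuous (x : E) : continuous (fib_arc x). Proof. by have [] := fibreP x. Qed.

Lemma spread_continuous : continuous spread.
Proof.
apply: (@to_fibre_cont _ _ _ _ _ (fun q : (E * I) * I =>
  fib_arc q.1.1 (lerp (overshoot q.1.2 (angle q.1.1)) q.2 i0))).
- apply: arc_cont2; first by ct.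
  apply: lerp_cont; [apply: overshoot_cont; ct|by ct..]; exact: angle_continuous.
- apply: pair_continuous; apply: expand_cont; ct; exact: angle_continuous.
- by move=> p; rewrite lerp_id arc_start.
- exact: spreadP.
Qed.

Lemma spreadE (p : E * I) :
  fib_arc (spread p) = (fun i => fib_arc p.1 (lerp (overshoot p.2 (angle p.1)) i i0)) /\
  angle (spread p) = (expand p.2 (angle p.1).1, expand p.2 (angle p.1).2).
Proof.
apply: to_fibreE; [|by rewrite lerp_id arc_start|exact: spreadP].
by apply: arc_cont2; ct.
Qed.

Lemma shrinkP (p : E * I) : B (d (fib_arc p.1 i1, p.2)) \/ edge (angle p.1).
Proof. by have [_ _ [/d_B h|h]] := fibreP p.1; [left|right]. Qed.

Lemma shrink_continuous : continuous shrink.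
Proof.
apply: (@to_fibre_cont _ _ _ _ _ (fun q : (E * I) * I => d (fib_arc q.1.1 q.2, q.1.2))).
- by apply: comp_cont => //; apply: pair_continuous; [apply: arc_cont2; ct|ct].
- by ct; exact: angle_continuous.
- by move=> p; rewrite arc_start d_pt.
- exact: shrinkP.
Qed.

Lemma shrinkE (p : E * I) :
  fib_arc (shrink p) = (fun i => d (fib_arc p.1 i, p.2)) /\ angle (shrink p) = angle p.1.
Proof.
apply: to_fibreE; [|by rewrite arc_start d_pt|exact: shrinkP].
by ct; exact: arc_continuous.
Qed.

(** Where the cutoff vanishes the square coordinate stays put; elsewhere [d] has brought the end of
    the arc to the base point, which lies in [B], so every square coordinate is allowed. *)
Lemma slideP (p : E * I) : let k := lerp (lerp p.2 i0 (eta (fib_arc p.1 i1))) in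
  B (d (fib_arc p.1 i1, i1)) \/ edge (k (angle p.1).1 i0, k (angle p.1).2 i0).
Proof.
move=> k; have [h|h] := pselect (eta (fib_arc p.1 i1) = i0).
  rewrite /k h lerp_id !lerp0 -surjective_pairing.
  by have [_ _ [/d_B ?|?]] := fibreP p.1; [left|right].
by left; rewrite d_eta//; exact: B_v0.
Qed.

Lemma slide_continuous : continuous slide.
Proof.
apply: (@to_fibre_cont _ _ _ _ _ (fun q : (E * I) * I => d (fib_arc q.1.1 q.2, i1))).
- by apply: comp_cont => //; apply: pair_continuous; [apply: arc_cont2; ct|ct].
- have ca : continuous (fun p : E * I => eta (fib_arc p.1 i1)).
    by apply: comp_cont => //; apply: arc_cont2; ct.
  by apply: pair_continuous; apply: lerp_cont; ct; exact: angle_continuous.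
- by move=> p; rewrite arc_start d_pt.
- exact: slideP.
Qed.

Lemma slideE (p : E * I) : let k := lerp (lerp p.2 i0 (eta (fib_arc p.1 i1))) in
  fib_arc (slide p) = (fun i => d (fib_arc p.1 i, i1)) /\
  angle (slide p) = (k (angle p.1).1 i0, k (angle p.1).2 i0).
Proof.
apply: to_fibreE; [|by rewrite arc_start d_pt|exact: slideP].
by ct; exact: arc_continuous.
Qed.

(* [outer] is the subspace to be collapsed. Its contraction extends to the fibre:
   arcs are shrunk as the square is expanded past its boundary, which leaves the
   arcs over [outer] constant; then the square is slid to its corner wherever the
   arc ends close to the base point. *)
Lemma contract_outer : exists K : E * I -> E,
  [/\ continuous K, forall x, K (x, i0) = x,
      forall x s, outer x -> outer (K (x, s)),
      forall x, outer x -> K (x, i1) = e0 &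
      forall s, K (e0, s) = e0].
Proof.
pose spread1 x := spread (x, i1); pose shrink1 x := shrink (spread1 x, i1).
pose K2 (p : E * I) := shrink (spread1 p.1, p.2).
pose K3 (p : E * I) := slide (spread1 p.1, p.2).
have cs : continuous spread1 by rewrite /spread1; ct; exact: spread_continuous.
have c2 : continuous K2 by rewrite /K2; ct; exact: shrink_continuous.
have c3 : continuous K3 by rewrite /K3; ct; exact: slide_continuous.
have flat_spread x : outer x -> fib_arc (spread1 x) = (fun=> v0).
  rewrite /spread1 (spreadE _).1 /= => -[h|->//].
  by apply/funext => i; rewrite overshoot1// lerp1 arc_start.
have flat_shrink x s : outer x -> fib_arc (K2 (x, s)) = (fun=> v0).
  by move=> /flat_spread h; rewrite /K2 (shrinkE _).1 /= h; apply/funext => i; rewrite d_pt.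
have flat_slide x s : outer x -> fib_arc (K3 (x, s)) = (fun=> v0).
  by move=> /flat_spread h; rewrite /K3 (slideE _).1 /= h; apply/funext => i; rewrite d_pt.
have spread_pt s : spread (e0, s) = e0.
  have [e1 e2] := spreadE (e0, s); apply: fibre_eq; first by rewrite e1.
  by rewrite e2 /= !expand_i0.
have oe0 : outer e0 by right.
exists (fcat spread (fcat K2 K3)); split.
- apply: cat_continuous; first exact: spread_continuous.
    apply: cat_continuous => // x.
    apply: fibre_eq; rewrite ?(shrinkE _).1 ?(slideE _).1 ?(shrinkE _).2 ?(slideE _).2 //=.
    by rewrite !lerp0 -surjective_pairing.
  move=> x; rewrite cat0 /K2 /=; apply: fibre_eq; last by rewrite (shrinkE _).2.
  by rewrite (shrinkE _).1; apply/funext => i; rewrite d0.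
- move=> x; rewrite cat0; have [e1 e2] := spreadE (x, i0); apply: fibre_eq.
    by rewrite e1; apply/funext => i; rewrite overshoot0 lerp0.
  by rewrite e2 /= !expand0 -surjective_pairing.
- move=> x s ox; rewrite /fcat /=; case: ifP => _.
    have [e1 e2] := spreadE (x, lo s); case: ox => [h|h].
      by left; rewrite e2; exact: edge_expand.
    by right; rewrite e1 /= h.
  by case: ifP => _; right; [exact: flat_shrink|exact: flat_slide].
(* Over [outer] the arc has become constant by the time of the slide, so its end is the base point,
   the cutoff is 1 and the slide reaches the corner. *)
- move=> x ox; rewrite !cat1; apply: fibre_eq; first by rewrite flat_slide.
  rewrite /K3 (slideE _).2 /= flat_spread// eta_pt lerp1 !lerp1.
  by [].
- move=> s; rewrite /fcat /=; case: ifP => _; first exact: spread_pt.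
  case: ifP => _; apply: fibre_eq; rewrite ?flat_shrink ?flat_slide //.
    by rewrite /K2 (shrinkE _).2 /= /spread1 spread_pt.
  by rewrite /K3 (slideE _).2 /= /spread1 spread_pt /= !lerp_id.
Qed.

Definition to_hofib (g : I -> V) : F :=
  insubd f0 ((insubd b0 (g i1), g) : B * {compact-open, I -> V}).

Lemma to_hofibE g : continuous g -> g i0 = v0 -> B (g i1) ->
  set_val (to_hofib g) = (insubd b0 (g i1), g) :> (B * {compact-open, I -> V}).
Proof.
move=> cg g0 g1; rewrite /to_hofib [LHS]/= set_valE /insubd insubT //.
apply/mem_set; split => //=.
by rewrite set_valE -/(insubd b0 (g i1)) insubdK //; exact/mem_set.
Qed.

Lemma to_hofib_cont (T : topologicalType) (N : T * I -> V) : continuous N ->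
  (forall t, N (t, i0) = v0) -> (forall t, B (N (t, i1))) ->
  continuous (fun t => to_hofib (fun i => N (t, i))).
Proof.
move=> cN N0 N1; apply: sub_cont.
have -> : (fun t => set_val (to_hofib (fun i => N (t, i)))) =
   (fun t => (insubd b0 (N (t, i1)), (fun i => N (t, i)) : {compact-open, I -> V})).
  by apply/funext => t; rewrite to_hofibE//; ct.
apply: pair_continuous; last exact: curry_cont.
apply: sub_cont; rewrite (_ : (fun t => _) = (fun t => N (t, i1))); first by ct.
by apply/funext => t; rewrite set_valE insubdK//; exact/mem_set.
Qed.

Definition track (f : F) : I -> V := (set_val f).2.

Lemma trackP f : [/\ continuous (track f), track f i0 = v0 & B (track f i1)].
Proof.
have [c e0' e1] := set_mem (svalP f); split => //.
by rewrite -[track f i1]/((sval f).2 i1) e1; exact: (set_mem (svalP (sval f).1)).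
Qed.

Lemma to_hofibK f : to_hofib (track f) = f.
Proof.
have [c e1 e2] := trackP f; apply: val_inj; rewrite -set_valE to_hofibE//.
rewrite [RHS]surjective_pairing; congr pair; apply: val_inj.
rewrite insubdK; last exact/mem_set.
have [_ _ e] := set_mem (svalP f).
exact: e.
Qed.

Lemma track_cont : continuous (fun p : F * I => track p.1 p.2).
Proof.
apply: (@uncurry_cont R F V (fun f => (set_val f).2)).
  by apply: snd_cont; apply: val_cont; exact: id_cont.
by move=> f; have [] := trackP f.
Qed.

Definition collapse (x : E) : S2F :=
  if `[< B (fib_arc x i1) >] then susp2_proj f0 (to_hofib (fib_arc x), angle x) else s0.

Lemma collapse_outer x : outer x -> collapse x = s0.
Proof.
rewrite /collapse; case: asboolP => // Bx ox; apply: susp2_proj_pt.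
case: ox => [|->]; [by left|right].
by rewrite -[RHS]to_hofibK.
Qed.

(** An arc that does not end in [B] has its square coordinate on the edge. The fibre is thus the
    union of two closed sets, and on the second one the map is constantly [s0], also where the first
    formula applies. *)
Lemma collapse_continuous : continuous collapse.
Proof.
apply: (@glue_cont _ _ [set x | B (fib_arc x i1)] [set x | edge (angle x)]).
- apply: (@closed_preimage _ _ (fun x : E => fib_arc x i1)) => //.
  by apply: arc_cont2; ct.
- by apply: closed_edge; exact: angle_continuous.
- by move=> x; have [] := fibreP x.
- set C := [set x | B _].
  have cv : continuous (fun x : C => set_val x) by apply: val_cont; exact: id_cont.
  rewrite (_ : (fun x => _) = (fun x : C =>
     susp2_proj f0 (to_hofib (fib_arc (set_val x)), angle (set_val x)))); last first.
    apply/funext => x; rewrite /collapse asboolT//; exact: (set_mem (svalP x)).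
  apply: comp_cont; first exact: susp2_proj_continuous.
  apply: pair_continuous; last by apply: comp_cont => //; exact: angle_continuous.
  apply: (@to_hofib_cont _ (fun p : C * I => fib_arc (set_val p.1) p.2)).
  + by apply: arc_cont2; ct.
  + by move=> x; exact: arc_start.
  + by move=> x; exact: (set_mem (svalP x)).
- rewrite (_ : (fun x => _) = (fun=> s0)); first exact: cst_cont.
  apply/funext => x; apply: collapse_outer; left; exact: (set_mem (svalP x)).
Qed.

(** The end of the contraction [K] is constant on [outer], so it factors through [collapse] and
    gives the inverse [g]; [K] is then a homotopy from the identity to [g \o collapse], and its
    composite with [collapse] descends to the other homotopy because [K] preserves [outer]. *)
Lemma fibre_susp2 : pointed_homotopy_equivalent R e0 s0.
Proof.
have [K [cK K0 Kout K1 Kpt]] := contract_outer.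
pose inc (p : F * (I * I)) : E := to_fibre B v0 (track p.1) p.2.
have incE p : fib_arc (inc p) = track p.1 /\ angle (inc p) = p.2.
  by have [? ? ?] := trackP p.1; apply: to_fibreE => //; left.
have cinc : continuous inc.
  apply: (@to_fibre_cont _ _ _ _ _ (fun q : (F * (I * I)) * I => track q.1.1 q.2)).
  - apply: (@comp_cont _ _ _ (fun p : F * I => track p.1 p.2)
      (fun q : (F * (I * I)) * I => (q.1.1, q.2))); last by ct.
    exact: track_cont.
  - by ct.
  - by move=> p; have [] := trackP p.1.
  - by move=> p; left; have [] := trackP p.1.
have inc_out p : edge p.2 \/ p.1 = f0 -> outer (inc p).
  move=> [h|h]; [left|right]; rewrite ?(incE p).2// (incE p).1 h.
  by [].
have incK x : B (fib_arc x i1) -> inc (to_hofib (fib_arc x), angle x) = x.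
  move=> Bx; apply: fibre_eq; last by rewrite (incE _).2.
  rewrite (incE _).1 /track to_hofibE//; first exact: arc_continuous.
  exact: arc_start.
have collapse_inc p : collapse (inc p) = susp2_proj f0 p.
  have [e1 e2] := incE p; have [_ _ Bp] := trackP p.1.
  by rewrite /collapse e1 asboolT// e2 to_hofibK -surjective_pairing.
(* The suspension is a quotient of [F * (I * I)], embedded in the fibre by [inc]; the time parameter
   of the lifting lemma is a dummy here and is set to 0 below. *)
have [G [cG GE]] := @susp2_lift_continuous R F f0 E (fun q => K (inc q.1, i1))
  (fun=> e0) ltac:(by ct) (fun p _ h => K1 _ (inc_out _ h)).
have [g [cg gE]] : exists g : S2F -> E, continuous g /\
    forall p, g (susp2_proj f0 p) = K (inc p, i1).
  by exists (fun y => G (y, i0)); split; [ct|move=> p; rewrite GE].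
have s0E : s0 = susp2_proj f0 (f0, corner R) by rewrite susp2_proj_pt//; right.
have g_pt : g s0 = e0 by rewrite s0E gE K1//; apply: inc_out; right.
have gc x : g (collapse x) = K (x, i1).
  have [Bx|nBx] := pselect (B (fib_arc x i1)).
    by rewrite -{1}(incK _ Bx) collapse_inc gE incK.
  have ox : outer x by left; have [_ _ []] := fibreP x.
  by rewrite collapse_outer// K1.
have [H [cH HE]] := @susp2_lift_continuous R F f0 S2F
  (fun q => collapse (K (inc q.1, q.2))) (fun=> s0)
  ltac:(ct; exact: collapse_continuous)
  (fun p s h => collapse_outer (Kout _ _ (inc_out _ h))).
exists collapse, g; split.
- exact: collapse_continuous.
- exact: cg.
- by split => //; rewrite collapse_outer//; right.
- apply: homotopic_sym; exists K; split => //.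
  + by move=> x; rewrite /= gc.
  + by move=> _ s ->; exact: Kpt.
- apply: homotopic_sym; exists H; split => //.
  + by move=> y; have [p ->] := susp2_proj_surj y; rewrite HE K0 collapse_inc.
  + move=> y; have [p ->] := susp2_proj_surj y.
    by rewrite HE -[RHS]/(collapse (g (susp2_proj f0 p))) gE.
  + move=> _ s ->; rewrite s0E HE collapse_outer -?s0E//; apply: Kout.
    by apply: inc_out; right.
Qed.

End Collapse.

(** * Simple connectivity of the fibre *)

Section AvoidOrigin.
Variable R : realType.
Implicit Types x y : R -> R.

Lemma unif_cont01 x (e : R) : continuous x -> 0 < e -> exists2 dl : R, 0 < dl &
  forall s t, 0 <= s <= 1 -> `|s - t| < dl -> `|x s - x t| < e.
Proof.
move=> cx e0.
pose P (dl s : R) := forall t, `|s - t| < dl -> `|x s - x t| < e.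
have near0 : \forall dl \near 0^'+, `[0, 1] `<=` P dl.
  apply: (compact_near_coveringP _).1; first exact: segment_compact.
  move=> s _; have e2 : 0 < e / 2 by rewrite divr_gt0.
  have /cvgrPdist_lt/(_ _ e2) := cx s.
  move=> /nbhs_ballP[r /= r0 sr]; have r2 : 0 < r / 2 by rewrite divr_gt0.
  exists (ball s (r / 2), [set dl | 0 < dl < r / 2]).
    split; first exact: nbhsx_ballx.
    by near=> dl; apply/andP; split; near: dl;
      [exact: nbhs_right_gt|exact: nbhs_right_lt].
  move=> [s' dl] /= [ss' /andP[dl0 dlr]] t s't.
  have h1 : `|x s - x s'| < e / 2.
    by apply: sr; rewrite /ball /=; apply: lt_le_trans ss' _; lra.
  have h2 : `|x s - x t| < e / 2.
    apply: sr; rewrite /ball /=; have -> : s - t = (s - s') + (s' - t) by ring.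
    by apply: le_lt_trans (ler_normD _ _) _; move: ss'; rewrite /ball /=; lra.
  have -> : x s' - x t = (x s - x t) - (x s - x s') by ring.
  by apply: le_lt_trans (ler_normB _ _) _; lra.
have [dl dl0 dlP] : exists2 dl : R, 0 < dl & `[0, 1] `<=` P dl.
  have : \forall dl \near 0^'+, 0 < dl /\ `[0, 1] `<=` P dl.
    by near=> dl; split; near: dl; [exact: nbhs_right_gt|exact: near0].
  by move=> /(@filter_ex _ _ _)[dl []]; exists dl.
by exists dl => // s t s01; apply: dlP; rewrite /= in_itv.
Unshelve. all: by end_near. Qed.

(** Each end [p], [q] of the segment is within e/2 of [v], being within e/4 of a sample that is
    itself within e/4 of [v]; balls in the line are convex. *)
Lemma affine_near (l p q w z e v : R) : 0 <= l -> l <= 1 ->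
  `|p - w| < e / 4 -> `|q - z| < e / 4 -> `|w - v| < e / 4 -> `|v - z| < e / 4 ->
  `|p + l * (q - p) - v| < e.
Proof.
move=> l0 l1; rewrite !ltr_norml => /andP[? ?] /andP[? ?] /andP[? ?] /andP[? ?].
have P1 : 0 <= (1 - l) * (e / 2 - (p - v)) by apply: mulr_ge0; lra.
have P2 : 0 <= (1 - l) * (e / 2 + (p - v)) by apply: mulr_ge0; lra.
have Q1 : 0 <= l * (e / 2 - (q - v)) by apply: mulr_ge0; lra.
have Q2 : 0 <= l * (e / 2 + (q - v)) by apply: mulr_ge0; lra.
by apply/andP; split; lra.
Qed.

(* Piecewise linear approximation; each node is chosen off the line through the
   origin and the previous node. *)
Lemma avoid_origin x y (e : R) : continuous x -> continuous y -> 0 < e ->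
  exists X Y : R -> R, [/\ continuous X, continuous Y &
    forall t, 0 <= t <= 1 ->
      [/\ `|X t - x t| < e, `|Y t - y t| < e & (X t != 0) || (Y t != 0)]].
Proof.
move=> cx cy e0; have e4 : 0 < e / 4 by rewrite divr_gt0.
have [d1 d10 d1P] := unif_cont01 cx e4.
have [d2 d20 d2P] := unif_cont01 cy e4.
have [N N0 Nd] : exists2 N : nat, (0 < N)%N & N%:R^-1 < Num.min d1 d2.
  have m0 : 0 < Num.min d1 d2 by rewrite lt_min d10.
  exists (Num.truncn (Num.min d1 d2)^-1).+1 => //.
  by rewrite invf_plt ?posrE// truncnS_gt.
pose h : R := N%:R^-1.
have h0 : 0 < h by rewrite invr_gt0 ltr0n.
have [hd1 hd2] : h < d1 /\ h < d2 by move: Nd; rewrite lt_min => /andP.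
have close n t : (n < N)%N -> n%:R * h <= t -> t <= n.+1%:R * h ->
    [/\ `|x (n%:R * h) - x t| < e / 4, `|y (n%:R * h) - y t| < e / 4,
        `|x t - x (n.+1%:R * h)| < e / 4 & `|y t - y (n.+1%:R * h)| < e / 4].
  move=> nN nt tn; have S : n.+1%:R * h = n%:R * h + h by rewrite -natr1; ring.
  have n01 : 0 <= n%:R * h <= 1.
    apply/andP; split; first by rewrite mulr_ge0 ?ler0n// ltW.
    by rewrite /h ler_pdivrMr ?ltr0n// mul1r ler_nat ltnW.
  have Sn01 : n.+1%:R * h <= 1 by rewrite /h ler_pdivrMr ?ltr0n// mul1r ler_nat.
  have t01 : 0 <= t <= 1 by lra.
  have a1 : `|n%:R * h - t| <= h by rewrite ler_norml; lra.
  have a2 : `|t - n.+1%:R * h| <= h by rewrite ler_norml; lra.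
  split; [apply: d1P|apply: d2P|apply: d1P|apply: d2P] => //; lra.
(* Induction on the nodes [n * h]. The last node is only required to be within e/4 of the path, the
   margin [affine_near] needs for the next segment. *)
suff main n : (n <= N)%N -> exists X Y : R -> R, [/\ continuous X, continuous Y,
    forall t, 0 <= t <= n%:R * h ->
      [/\ `|X t - x t| < e, `|Y t - y t| < e & (X t != 0) || (Y t != 0)],
    `|X (n%:R * h) - x (n%:R * h)| < e / 4 & `|Y (n%:R * h) - y (n%:R * h)| < e / 4].
  have [X [Y [cX cY XY _ _]]] := main N (leqnn N).
  exists X, Y; split => // t t01; apply: XY.
  by rewrite /h divff // pnatr_eq0 -lt0n.
elim: n => [_|n IH nN].
  (* The first node has nonzero first coordinate; e/8 is within the tolerance e/4. *)
  pose p := if x 0 == 0 then e / 8 else x 0.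
  have pe : `|p - x 0| < e / 4.
    rewrite /p; case: eqP => [->|_]; last by rewrite subrr normr0.
    by rewrite subr0 gtr0_norm; lra.
  exists (fun=> p), (fun=> y 0); split.
  - exact: cst_cont.
  - exact: cst_cont.
  - move=> t; rewrite mul0r => /le_anti <-; rewrite subrr normr0; split => //; first lra.
    by rewrite /p; case: (eqVneq (x 0) 0) => [_|->//]; rewrite gt_eqF//; lra.
  - by rewrite mul0r.
  - by rewrite mul0r subrr normr0.
have [X [Y [cX cY XY Xn Yn]]] := IH (ltnW nN).
set a := n%:R * h in XY Xn Yn; set b := n.+1%:R * h.
have ab : b = a + h by rewrite /b -natr1 /a; ring.
pose p1 := X a; pose p2 := Y a.
have pn0 : (p1 != 0) || (p2 != 0).
  by have [] // := XY a; rewrite lexx mulr_ge0 // ltW.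
have pp : 0 < p1 ^+ 2 + p2 ^+ 2.
  by case/orP: pn0 => h'; rewrite -sqrf_eq0 in h';
     have := sqr_ge0 p1; have := sqr_ge0 p2; move: h'; rewrite lt0r ; lra.
(* [M] bounds both coordinates of the last node and k0 M = e/16, so a shift by at most 2 k0 times
   that node moves the next one by at most e/8. *)
pose M := `|p1| + `|p2| + 1.
have M0 : 0 < M by rewrite /M; have := normr_ge0 p1; have := normr_ge0 p2; lra.
pose k0 := e / (16 * M).
have k00 : 0 < k0 by rewrite divr_gt0// mulr_gt0.
have k0M : k0 * M = e / 16 by rewrite /k0; field; rewrite gt_eqF.
(* The determinant of the last node p and the next sample shifted by k times p turned through a
   right angle. It is affine in k with slope |p|^2 > 0, so it cannot vanish at both k0 and 2 k0. *)
pose det k := p1 * (y b + k * p1) - p2 * (x b - k * p2).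
have [k [kk0 kk dk]] : exists k, [/\ 0 < k, k <= 2 * k0 & det k != 0].
  have [dk0|dk0] := eqVneq (det k0) 0; last by exists k0; split => //; lra.
  exists (2 * k0); split => //; [lra..|].
  have -> : det (2 * k0) = det k0 + k0 * (p1 ^+ 2 + p2 ^+ 2) by rewrite /det; ring.
  by rewrite dk0 add0r mulf_neq0// gt_eqF.
pose q1 := x b - k * p2; pose q2 := y b + k * p1.
have kp (p : R) : `|p| <= M -> `|k * p| < e / 4.
  move=> pM; rewrite normrM gtr0_norm//.
  have : k * `|p| <= (2 * k0) * M by apply: ler_pM => //; exact: ltW.
  by rewrite -mulrA k0M; lra.
have q1e : `|q1 - x b| < e / 4.
  rewrite /q1 addrAC subrr add0r normrN; apply: kp.
  by rewrite /M; have := normr_ge0 p1; lra.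
have q2e : `|q2 - y b| < e / 4.
  rewrite /q2 addrAC subrr add0r; apply: kp.
  by rewrite /M; have := normr_ge0 p2; lra.
pose ext (Z : R -> R) (p q : R) t := if t <= a then Z t else p + (t - a) * N%:R * (q - p).
have cext Z q : continuous Z -> continuous (ext Z (Z a) q).
  move=> cZ; apply: (@paste_continuous R R R id); [by ct|done|by ct|].
  by move=> t ->; rewrite subrr !mul0r addr0.
exists (ext X p1 q1), (ext Y p2 q2); split; [exact: cext|exact: cext|..].
- move=> t /andP[t0 tb]; rewrite /ext; case: (leP t a) => ta.
    by apply: XY; rewrite t0.
  pose l := (t - a) * N%:R.
  have [l0 l1] : 0 <= l /\ l <= 1.
    split; first by rewrite mulr_ge0// ?ler0n// subr_ge0 ltW.
    have : (t - a) * N%:R <= h * N%:R by apply: ler_wpM2r; [exact: ler0n|lra].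
    by rewrite /h mulVf// pnatr_eq0 -lt0n.
  rewrite -/l; have [c1 c2 c3 c4] := close _ _ nN (ltW ta) tb.
  split; [exact: (affine_near l0 l1 Xn q1e)|exact: (affine_near l0 l1 Yn q2e)|].
  apply: contraTT isT; rewrite negb_or !negbK => /andP[/eqP z1 /eqP z2].
  (* If the segment met the origin at parameter l, its determinant with p would give l det k = 0, so
     l = 0 and the origin would be the node p itself. *)
  have dl : l * det k = 0.
    have -> : l * det k = p1 * (p2 + l * (q2 - p2)) - p2 * (p1 + l * (q1 - p1)).
      by rewrite /det /q1 /q2; ring.
    by rewrite z1 z2 !mulr0 subrr.
  move/eqP: dl; rewrite mulf_eq0 (negbTE dk) orbF => /eqP l_0.
  by move: z1 z2 pn0; rewrite l_0 !mul0r !addr0 => -> ->; rewrite eqxx.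
- have E q p : ext X p q b = q.
    rewrite /ext ifF; last by apply/negbTE; rewrite -ltNge; lra.
    by rewrite ab addrAC subrr add0r /h mulVf ?mul1r ?pnatr_eq0 -?lt0n//; ring.
  by rewrite E.
- have E q p : ext Y p q b = q.
    rewrite /ext ifF; last by apply/negbTE; rewrite -ltNge; lra.
    by rewrite ab addrAC subrr add0r /h mulVf ?mul1r ?pnatr_eq0 -?lt0n//; ring.
  by rewrite E.
Qed.

End AvoidOrigin.

(** * Loops in the fibre are null-homotopic *)

Section FibreLoops.
Variable R : realType.
Local Notation I := (unit_interval R).
Local Notation i0 := (I0 R).
Local Notation i1 := (I1 R).
Variables (V : topologicalType) (B : set V) (v0 : V).
Hypothesis Bv0 : B v0.
Local Notation E := (fibre R B v0).
Local Notation e0 := (fibre_pt R B v0).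

Definition of_centre (x : R) : I := clamp (x + 2^-1).

Lemma ival_of_centre x : - 2^-1 <= x <= 2^-1 -> ival (of_centre x) = x + 2^-1.
Proof. by move=> hx; rewrite /of_centre clampK//; lra. Qed.

Lemma of_centreK (i : I) : of_centre (ival i - 2^-1) = i.
Proof. by rewrite /of_centre subrK ivalK. Qed.

(** The sup norm: its sphere of radius 1/2 about the centre is the boundary of the square. *)
Definition radius (x y : R) := Num.max `|x| `|y|.

Lemma edge_radius (w : I * I) :
  edge w <-> radius (ival w.1 - 2^-1) (ival w.2 - 2^-1) = 2^-1.
Proof.
have half (i : I) : `|ival i - 2^-1| <= 2^-1.
  by rewrite ler_norml; have := ival_itv i; lra.
have ends (i : I) : `|ival i - 2^-1| = 2^-1 <-> i = i0 \/ i = i1.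
  split=> [|[]->]; rewrite ?ival0 ?ival1.
  - case: (ger0P (ival i - 2^-1)) => _ h; [right|left]; apply: ival_inj;
      by rewrite ?ival0 ?ival1; lra.
  - by rewrite sub0r normrN gtr0_norm.
  - by rewrite gtr0_norm; lra.
rewrite /radius; split=> [ew|].
  apply/le_anti; rewrite ge_max !half /= le_max.
  case: ew => h.
  - by rewrite ((ends _).2 (or_introl h)) lexx.
  - by rewrite ((ends _).2 (or_intror h)) lexx.
  - by rewrite ((ends _).2 (or_introl h)) lexx orbT.
  - by rewrite ((ends _).2 (or_intror h)) lexx orbT.
case: (leP `|_| `|_|) => _ /ends[] h;
  [constructor 3|constructor 4|constructor 1|constructor 2] => //.
Qed.

Variables (T : topologicalType) (t0 : T).
(** The parameter space is a point, so the family is a single loop: pushing a path off the origin of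
    a plane is possible for one path, not for arbitrary families. *)
Hypothesis T_trivial : forall t : T, t = t0.

Definition lerp2 (s : I) (w w' : I * I) : I * I := (lerp s w.1 w'.1, lerp s w.2 w'.2).

Lemma lerp2_0 w w' : lerp2 i0 w w' = w.
Proof. by rewrite /lerp2 !lerp0 -surjective_pairing. Qed.

Lemma lerp2_1 w w' : lerp2 i1 w w' = w'.
Proof. by rewrite /lerp2 !lerp1 -surjective_pairing. Qed.

Lemma lerp2_id s w : lerp2 s w w = w.
Proof. by rewrite /lerp2 !lerp_id -surjective_pairing. Qed.

Lemma lerp2_cont (S : topologicalType) (u : S -> I) (v w : S -> I * I) :
  continuous u -> continuous v -> continuous w ->
  continuous (fun s => lerp2 (u s) (v s) (w s)).
Proof. by move=> cu cv cw; rewrite /lerp2; ct. Qed.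

(* A loop in the fibre is pushed off the line over the centre of the square,
   then radially to the boundary, where the arcs can be contracted. *)
Lemma fibre_loops_null (A : set T) (b : T * I -> E) :
  floop A e0 b -> fhom A b (fun=> e0).
Proof.
move=> [cb be].
pose x p : R := ival (angle (b p)).1 - 2^-1.
pose y p : R := ival (angle (b p)).2 - 2^-1.
have cx : continuous x by rewrite /x; ct; exact: angle_continuous.
have cy : continuous y by rewrite /y; ct; exact: angle_continuous.
have [X0 [Y0 [cX0 cY0 XY0]]] := @avoid_origin R (fun r => x (t0, clamp r))
  (fun r => y (t0, clamp r)) (8^-1) ltac:(by ct) ltac:(by ct) ltac:(by lra).
(* Equal to 1 up to radius 1/8 and to 0 from radius 1/4 on: the approximation replaces the path near
   the centre and leaves it unchanged near the edge. *)
pose l p : R := ival (clamp (2 - 8 * radius (x p) (y p))).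
pose X p := x p + l p * (X0 (ival p.2) - x p).
pose Y p := y p + l p * (Y0 (ival p.2) - y p).
have cl : continuous l by rewrite /l /radius; ct.
have cX : continuous X by rewrite /X; ct.
have cY : continuous Y by rewrite /Y; ct.
have far p : 4^-1 <= radius (x p) (y p) -> X p = x p /\ Y p = y p.
  move=> h; have l0 : l p = 0 by rewrite /l clamp_le0 ?ival0//; lra.
  by rewrite /X /Y l0 !mul0r !addr0.
have XY p : [/\ `|X p| <= 2^-1, `|Y p| <= 2^-1 & 0 < radius (X p) (Y p)].
  have [r4|r4] := lerP 4^-1 (radius (x p) (y p)).
    have [-> ->] := far _ r4; split; last by apply: lt_le_trans r4; lra.
      by rewrite ler_norml /x; have := ival_itv (angle (b p)).1; lra.
    by rewrite ler_norml /y; have := ival_itv (angle (b p)).2; lra.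
  case: p r4 => t i; rewrite (T_trivial t) => r4.
  have [] := XY0 (ival i) (ival_itv i); rewrite ivalK.
  set x1 := x (t0, i); set y1 := y (t0, i) => hX hY hn.
  have [l0 l1] : 0 <= l (t0, i) /\ l (t0, i) <= 1.
    by split; [exact: ival_ge0|exact: ival_le1].
  have bd (z w : R) : `|z - w| < 8^-1 -> `|l (t0, i) * (z - w)| < 8^-1.
    move=> zw; rewrite normrM ger0_norm//; apply: le_lt_trans zw.
    by rewrite ler_piMl.
  have [hX' hY'] := (bd _ _ hX, bd _ _ hY).
  have [x4 y4] : `|x1| < 4^-1 /\ `|y1| < 4^-1.
    by apply/andP; move: r4; rewrite /radius gt_max.
  rewrite /X /Y /= -/x1 -/y1; split.
  - by apply: le_trans (ler_normD _ _) _; lra.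
  - by apply: le_trans (ler_normD _ _) _; lra.
  - rewrite /radius lt_max !normr_gt0.
    (* Up to radius 1/8 the point is the approximation, which avoids the origin; beyond it some
       coordinate exceeds 1/8 while the perturbation is smaller than 1/8. *)
    have [r8|r8] := leP (radius x1 y1) 8^-1.
      have -> : l (t0, i) = 1 by rewrite /l clamp_ge1 ?ival1//; rewrite -/x1 -/y1; lra.
      by rewrite !mul1r [x1 + _]addrC [y1 + _]addrC !subrK.
    move: r8; rewrite /radius lt_max => /orP[r8|r8]; apply/orP; [left|right].
      apply/eqP => h; move: hX'; have -> : l (t0, i) * (X0 (ival i) - x1) = - x1 by lra.
      by rewrite normrN; lra.
    apply/eqP => h; move: hY'; have -> : l (t0, i) * (Y0 (ival i) - y1) = - y1 by lra.
    by rewrite normrN; lra.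
pose w1 p : I * I := (of_centre (X p), of_centre (Y p)).
(* The factor of radial projection onto the sup-norm sphere of radius 1/2. *)
pose r p := (2 * radius (X p) (Y p))^-1.
pose w2 p : I * I := (of_centre (X p * r p), of_centre (Y p * r p)).
have cr : continuous r.
  have crr : continuous (fun p => 2 * radius (X p) (Y p)) by rewrite /radius; ct.
  move=> p; apply: (@continuousV _ _ (fun p => 2 * radius (X p) (Y p))); last exact: crr.
  by have [_ _ r0] := XY p; rewrite mulf_neq0// gt_eqF.
have cw1 : continuous w1 by rewrite /w1 /of_centre; ct.
have cw2 : continuous w2 by rewrite /w2 /of_centre; ct.
have w1_edge p : edge (angle (b p)) -> w1 p = angle (b p).
  move=> /edge_radius h; have [|XE YE] := far p; first by rewrite /x /y h; lra.
  by rewrite /w1 XE YE !of_centreK -surjective_pairing.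
have w1E p : ival (w1 p).1 - 2^-1 = X p /\ ival (w1 p).2 - 2^-1 = Y p.
  have [hX hY _] := XY p; rewrite !ival_of_centre ?addrK//; by rewrite -ler_norml.
have w2_w1 p : edge (w1 p) -> w2 p = w1 p.
  move=> /edge_radius; have [-> ->] := w1E p => h.
  by rewrite /w2 /r h mulfV// invr1 !mulr1.
have w2_edge p : edge (w2 p).
  have [hX hY r0] := XY p; apply/edge_radius.
  have rX (z : R) : `|z| <= radius (X p) (Y p) -> `|z * r p| <= 2^-1.
    move=> zr; rewrite normrM /r [`|_^-1|]gtr0_norm ?invr_gt0 ?mulr_gt0//.
    by rewrite ler_pdivrMr ?mulr_gt0// mulrA mulVf// mul1r.
  have [aX aY] : `|X p * r p| <= 2^-1 /\ `|Y p * r p| <= 2^-1.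
    by split; apply: rX; rewrite /radius le_max lexx ?orbT.
  rewrite !ival_of_centre -?ler_norml// !addrK.
  have rp : 0 < r p by rewrite invr_gt0 mulr_gt0.
  rewrite /radius !normrM [`|r p|]gtr0_norm// -maxr_pMl ?ltW//.
  by rewrite -/(radius (X p) (Y p)) /r; field; rewrite gt_eqF.
have arc0 p : fib_arc (b p) i0 = v0 by have [] := fibreP (b p).
have carc (S : topologicalType) (u : S -> T * I) (v : S -> I) :
    continuous u -> continuous v -> continuous (fun s => fib_arc (b (u s)) (v s)).
  move=> cu cv; apply: (@comp_cont _ _ _ (fun p => fib_arc (b p.1) p.2) (fun s => (u s, v s))).
    exact: arc_cont.
  by ct.
have cang : continuous (fun p => angle (b p)) by ct; exact: angle_continuous.
have ends p : rel_ends A p ->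
    [/\ fib_arc (b p) = (fun=> v0), angle (b p) = corner R, w1 p = corner R & w2 p = corner R].
  move=> /be bp; have w1p : w1 p = corner R.
    by rewrite w1_edge bp//; exact: edge_corner.
  by split; rewrite ?bp// w2_w1 w1p//; exact: edge_corner.
have fst1 (U W : topologicalType) (u : T * I -> U) : continuous u ->
    continuous (fun p : (T * I) * W => u p.1).
  by move=> cu; exact: comp_cont cu (@fst_cont _ _ _ _ (@id_cont _)).
pose stage (g : (T * I) * I -> V) (w : T * I -> I * I) p :=
  to_fibre B v0 (fun i => g (p, i)) (w p).
apply: (@hom_trans _ _ _ _ _ (stage (fun q => fib_arc (b q.1) q.2) w1)).
  exists (fun p => to_fibre B v0 (fib_arc (b p.1))
    (lerp2 p.2 (angle (b p.1)) (w1 p.1))).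
  split.
  - apply: (@to_fibre_cont _ _ _ _ _ (fun q : ((T * I) * I) * I => fib_arc (b q.1.1) q.2)).
    + by apply: carc; ct.
    + apply: lerp2_cont; [by ct|exact: (fst1 _ _ _ cang)|exact: (fst1 _ _ _ cw1)].
    + by move=> p; exact: arc0.
    (* The square coordinate may move freely while the arc ends in [B]; otherwise it is on the edge,
       where [w1] does not move it. *)
    + move=> [p s] /=; have [_ _ [h|h]] := fibreP (b p); [by left|right].
      by rewrite w1_edge// lerp2_id.
  - by move=> p; rewrite /= lerp2_0 to_fibreK.
  - by move=> p; rewrite /= lerp2_1.
  - move=> p s /ends[e1 e2 e3 _] /=; rewrite e2 e3 lerp2_id.
    by rewrite -[RHS]to_fibreK e2.
apply: (@hom_trans _ _ _ _ _ (stage (fun q => fib_arc (b q.1) q.2) w2)).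
  exists (fun p => to_fibre B v0 (fib_arc (b p.1))
    (lerp2 p.2 (w1 p.1) (w2 p.1))).
  split.
  - apply: (@to_fibre_cont _ _ _ _ _ (fun q : ((T * I) * I) * I => fib_arc (b q.1.1) q.2)).
    + by apply: carc; ct.
    + apply: lerp2_cont; [by ct|exact: (fst1 _ _ _ cw1)|exact: (fst1 _ _ _ cw2)].
    + by move=> p; exact: arc0.
    + move=> [p s] /=; have [_ _ [h|h]] := fibreP (b p); [by left|right].
      have e1 : edge (w1 p) by rewrite w1_edge.
      by rewrite w2_w1// lerp2_id.
  - by move=> p; rewrite /= lerp2_0.
  - by move=> p; rewrite /= lerp2_1.
  - by move=> p s /ends[e1 e2 e3 e4] /=; rewrite /stage e3 e4 lerp2_id.
(* All square coordinates are now on the edge, so the arcs can be retracted to their starting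
   point. *)
apply: (@hom_trans _ _ _ _ _ (stage (fun=> v0) w2)).
  exists (fun p => to_fibre B v0 (fun i => fib_arc (b p.1) (lerp p.2 i i0)) (w2 p.1)).
  split.
  - apply: (@to_fibre_cont _ _ _ _ _
      (fun q : ((T * I) * I) * I => fib_arc (b q.1.1) (lerp q.1.2 q.2 i0))).
    + by apply: carc; ct.
    + by ct.
    + by move=> p; rewrite lerp_id.
    + by move=> p; right.
  - by move=> p; congr to_fibre; apply/funext => i; rewrite lerp0.
  - by move=> p; congr to_fibre; apply/funext => i; rewrite lerp1.
  - by move=> p s /ends[e1 e2 e3 e4]; congr to_fibre; apply/funext => i; rewrite /= e1.
(* Constant arcs end at [v0] in [B], which frees the square coordinate to move straight to the
   corner, across the interior. *)
exists (fun p => to_fibre B v0 (fun=> v0) (lerp2 p.2 (w2 p.1) (corner R))).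
split.
- apply: (@to_fibre_cont _ _ _ _ _ (fun=> v0)); [by ct| |by []|].
    by apply: lerp2_cont; [by ct|exact: (fst1 _ _ _ cw2)|by ct].
  by move=> p; left.
- by move=> p; rewrite /= lerp2_0.
- by move=> p; rewrite /= lerp2_1 to_fibre_pt.
- by move=> p s /ends[e1 e2 e3 e4]; rewrite /stage /= e4 lerp2_id.
Qed.

End FibreLoops.

(** * Charts of a manifold with boundary *)

Section BoundaryInvariance.
Variable R : realType.

(** Limit of nonnegative difference quotients from the right. Used for [v] and [- v], it makes the
    derivative of the coordinate vanish. *)
Lemma derive_coord_ge0 m (f : 'rV[R]_m -> 'rV[R]_m) x v i :
  differentiable f x -> (\forall y \near x, f x 0 i <= f y 0 i) ->
  0 <= ('D_v f x) 0 i.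
Proof.
move=> df fmin; have dv : derivable f x v by exact: diff_derivable.
pose q h := h^-1 *: (f (h *: v + x) - f x).
have cq : q h @[h --> 0^'] --> 'D_v f x by exact: dv.
have cqi : (q h) 0 i @[h --> 0^'+] --> ('D_v f x) 0 i.
  apply: (@cvg_comp _ _ _ q (fun w : 'rV[R]_m => w 0 i) _ (nbhs ('D_v f x))).
    move=> U /cq [e /= e0 eU]; exists e => // h he h0; apply: eU => //.
    exact: lt0r_neq0.
  exact: coord_continuous.
apply: (cvgr_to_ge cqi); near=> h; rewrite !mxE; apply: mulr_ge0.
  by rewrite invr_ge0 ltW//; near: h; exact: nbhs_right_gt.
rewrite subr_ge0; near: h; apply: cvg_within.
have cl : h *: v + x @[h --> (0 : R)] --> x.
  rewrite -[X in _ --> X]add0r -[X in _ --> X + _](scale0r v).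
  by apply: cvgD; [apply: cvgZr_tmp; exact: cvg_id|exact: cvg_cst].
exact: cl fmin.
Unshelve. all: by end_near. Qed.

(* A local left inverse makes the differential of [f] bijective, whereas at a
   minimum of the i-th coordinate its image lies in a hyperplane. *)
Lemma no_coord_min_local_inverse m (f g : 'rV[R]_m -> 'rV[R]_m) x i :
  differentiable f x -> differentiable g (f x) ->
  (\forall y \near x, g (f y) = y) -> ~ (\forall y \near x, f x 0 i <= f y 0 i).
Proof.
move=> df dg gf fmin.
have D0 v : ('d f x v) 0 i = 0.
  apply/le_anti/andP; split; last by rewrite -deriveE//; exact: derive_coord_ge0.
  rewrite -oppr_ge0.
  have -> : - (('d f x v) 0 i) = ('d f x (- v)) 0 i by rewrite linearN mxE.
  by rewrite -deriveE//; exact: derive_coord_ge0.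
have DK v : 'd g (f x) ('d f x v) = v.
  have dgf : differentiable (g \o f) x by exact: differentiable_comp.
  have E := congr1 (fun L : 'rV[R]_m -> 'rV[R]_m => L v) (diff_comp df dg).
  rewrite -[LHS]E -deriveE// (@near_eq_derive _ _ _ (g \o f) id)//.
  exact: derive_id.
have J1 : lin1_mx ('d f x) *m lin1_mx ('d g (f x)) = 1%:M.
  by apply/row_matrixP => j; rewrite row_mul mul_rV_lin1 !rowE mul_rV_lin1 DK mulmx1.
have := mulmx1C J1 => J2.
have := D0 (row i (lin1_mx ('d g (f x)))).
rewrite -mul_rV_lin1 -row_mul J2 row1 mxE !eqxx /= => /eqP.
by rewrite oner_eq0.
Qed.

End BoundaryInvariance.

(** * Pointed homotopy equivalence is an equivalence relation *)

Section PointedEquivalence.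
Variable R : realType.

Lemma phe_refl (X : topologicalType) (x : X) : pointed_homotopy_equivalent R x x.
Proof.
by exists id, id; split=> //; [exact: id_cont|exact: id_cont|
  apply: homotopic_refl; exact: id_cont|apply: homotopic_refl; exact: id_cont].
Qed.

Lemma phe_sym (X Y : topologicalType) (x : X) (y : Y) :
  pointed_homotopy_equivalent R x y -> pointed_homotopy_equivalent R y x.
Proof. by move=> [f [g [cf cg [fx gy] gf fg]]]; exists g, f. Qed.

Lemma homotopic_comp (X Y : topologicalType) (x : X) (y : Y) (f : X -> Y)
    (g : Y -> X) (k : Y -> Y) : continuous f -> continuous g -> f x = y -> g y = x ->
  homotopic_rel R [set y] k id -> homotopic_rel R [set x] (g \o f) id ->
  homotopic_rel R [set x] (g \o (k \o f)) id.
Proof.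
move=> cf cg fx gy [K [cK K0 K1 KA]]; apply: homotopic_trans.
exists (fun p => g (K (f p.1, p.2))); split.
- by ct.
- by move=> z; rewrite K0.
- by move=> z; rewrite K1.
- by move=> _ t ->; rewrite /= fx !KA // -(KA _ (I0 R) erefl) K0.
Qed.

Lemma phe_trans (X Y Z : topologicalType) (x : X) (y : Y) (z : Z) :
  pointed_homotopy_equivalent R x y -> pointed_homotopy_equivalent R y z ->
  pointed_homotopy_equivalent R x z.
Proof.
move=> [f [g [cf cg [fx gy] gf fg]]] [f' [g' [cf' cg' [fy gz] gf' fg']]].
exists (f' \o f), (g \o g'); split.
- exact: (comp_cont cf' cf).
- exact: (comp_cont cg cg').
- by rewrite /= fx fy gz gy.
- exact: (homotopic_comp cf cg fx gy gf' gf).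
- exact: (homotopic_comp cg' cf' gz fy fg fg').
Qed.

End PointedEquivalence.

(** * Invariance of the boundary, chart balls and change of base point *)

Section Manifold.
Variables (R : realType) (m : nat) (X : topologicalType) (A : atlas R X m).
Hypothesis mfdA : smooth_manifold A.
Local Notation H := (half_space (R := R) (m := m)).

Lemma chart_open a : A a -> open (cdom a).
Proof. by case: mfdA => _ _ _ ch _ /ch[]. Qed.

Lemma chart_cont a x : A a -> cdom a x -> {for x, continuous (cmap a)}.
Proof. by case: mfdA => _ _ _ ch _ /ch[_ + _ _]; apply. Qed.

Lemma chart_half a x : A a -> cdom a x -> H (cmap a x).
Proof.
case: mfdA => _ _ _ ch _ Aa ax; have [oa _ _ /(_ _ oa (@subset_refl _ _))[W oW E]] := ch _ Aa.
by have [] : (W `&` H) (cmap a x) by rewrite -E; exists x.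
Qed.

(** Were the coordinate positive in the chart [a] and zero in [b], the transition map from [a] to
    [b] would have a local minimum of that coordinate at a point with a full neighbourhood in the
    image of [a], although it has a smooth local inverse. *)
Lemma boundary_invariant a x (i : 'I_m) : A a -> cdom a x -> boundary A x ->
  val i = 0%N -> cmap a x 0 i = 0.
Proof.
move=> Aa ax [b [Ab bx [j j0 bj]]] i0; have ij : j = i by apply: val_inj; rewrite j0 i0.
subst j; apply: contrapT => /eqP ai0.
have ai : 0 < cmap a x 0 i by rewrite lt0r ai0; exact: (chart_half Aa ax).
have [_ _ _ ch [_ sm]] := mfdA.
have [W1 [g1 [oW1 W1x sm1 g1E]]] := sm a b x Aa Ab I ax bx.
have [W2 [g2 [oW2 W2x sm2 g2E]]] := sm b a x Ab Aa I bx ax.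
pose U := [set y | [/\ cdom a y, cdom b y, W1 (cmap a y) & W2 (cmap b y)]]°.
have Ux : U x.
  have n1 : \forall y \near x, W1 (cmap a y).
    by apply: (chart_cont Aa ax); exact: open_nbhs_nbhs.
  have n2 : \forall y \near x, W2 (cmap b y).
    by apply: (chart_cont Ab bx); exact: open_nbhs_nbhs.
  have n3 : \forall y \near x, cdom a y := open_nbhs_nbhs (conj (chart_open Aa) ax).
  have n4 : \forall y \near x, cdom b y := open_nbhs_nbhs (conj (chart_open Ab) bx).
  by rewrite /U /interior /=; near=> y; split; near: y.
have US y : U y -> [/\ cdom a y, cdom b y, W1 (cmap a y) & W2 (cmap b y)].
  exact: interior_subset.
have [_ _ _ chU] := ch _ Aa.
have [N oN NE] := chU U (@open_interior _ _) (fun y Uy => let: And4 h _ _ _ := US y Uy in h).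
have Nx : N (cmap a x) by have [] : (N `&` H) (cmap a x) by rewrite -NE; exists x.
(* Near a point with positive coordinate the half-space imposes no condition, so the chart covers a
   full neighbourhood in the coordinate space. *)
have near_U : \forall z \near cmap a x, exists2 y, U y & cmap a y = z.
  have n1 : \forall z \near cmap a x, N z by exact: open_nbhs_nbhs.
  have n2 : nbhs (cmap a x) [set z : 'rV[R]_m | 0 < z 0 i].
    exact: (@coord_continuous R 1 m 0 i (cmap a x) _ (lt_nbhsr ai)).
  apply: filterS2 n1 n2 => z Nz zi; have : (N `&` H) z.
    split => // k k0; have -> : k = i by apply: val_inj; rewrite k0 i0.
    exact: ltW.
  by rewrite -NE.
apply: (@no_coord_min_local_inverse R m g1 g2 (cmap a x) i).
- by have [d1 _] := sm1 1%N; apply: d1.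
- have [d2 _] := sm2 1%N; rewrite -g1E//; exact: d2.
- apply: filterS near_U => _ [y Uy <-]; have [ay bY w1 w2] := US _ Uy.
  by rewrite -g1E// -g2E.
- apply: filterS near_U => _ [y Uy <-]; have [ay bY w1 w2] := US _ Uy.
  by rewrite -!g1E// bj; exact: (chart_half Ab bY).
Unshelve. all: by end_near. Qed.

Lemma closed_boundary : closed (boundary A).
Proof.
rewrite -openC openE => x nbx; have [_ _ cov _ _] := mfdA; have [a Aa ax] := cov x.
have n1 : \forall y \near x, cdom a y by apply: open_nbhs_nbhs; split => //; exact: chart_open.
(* In dimension 0 there is no coordinate of index 0 and the boundary is empty. *)
have [[i i0]|noi] := pselect (exists i : 'I_m, val i = 0%N); last first.
  by apply: filterS n1 => y _ [b [_ _ [i i0 _]]]; apply: noi; exists i.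
have ai : 0 < cmap a x 0 i.
  rewrite lt0r; apply/andP; split; last exact: (chart_half Aa ax).
  by apply/eqP => ai0; apply: nbx; exists a; split => //; exists i.
have n2 : \forall y \near x, 0 < cmap a y 0 i.
  have c1 : {for x, continuous (fun y => cmap a y 0 i)}.
    apply: (@continuous_comp _ _ _ (cmap a) (fun w : 'rV[R]_m => w 0 i)).
      exact: chart_cont.
    exact: coord_continuous.
  exact: (c1 _ (lt_nbhsr ai)).
apply: filterS2 n1 n2 => y ay ai' by_.
by move: ai'; rewrite (boundary_invariant Aa ay by_ i0) ltxx.
Qed.

(* A chart ball [D] around [x0]: [phi] identifies it with the part of the open
   ball of radius [r] lying in the half-space. *)
Record chart_ball (x0 : X) (phi : X -> 'rV[R]_m) (psi : 'rV[R]_m -> X)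
    (D : set X) (r : R) : Prop := ChartBall {
  cb_r : 0 < r;
  cb_open : open D;
  cb_x0 : D x0;
  cb_cont : forall x, D x -> {for x, continuous phi};
  cb_phi : forall x, D x -> [/\ H (phi x), `|phi x - phi x0| < r & psi (phi x) = x];
  cb_psi : forall y, `|y - phi x0| < r -> H y -> D (psi y) /\ phi (psi y) = y;
  cb_psi_cont : forall y U, `|y - phi x0| < r -> H y -> nbhs (psi y) U ->
    exists2 W, open W & W y /\ forall z, W z -> `|z - phi x0| < r -> H z -> U (psi z);
  cb_boundary : forall x (i : 'I_m), val i = 0%N -> D x ->
    (boundary A x <-> phi x 0 i = 0) }.

Lemma chart_ballP (x0 : X) : exists phi psi D r, chart_ball x0 phi psi D r.
Proof.
have [_ _ cov ch _] := mfdA; have [a Aa ax0] := cov x0.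
have [oa ca inj chU] := ch _ Aa.
have [W oW WE] := chU _ oa (@subset_refl _ _).
have Wx0 : W (cmap a x0) by have [] : (W `&` H) (cmap a x0) by rewrite -WE; exists x0.
have /nbhs_ballP[r /= r0 rW] : nbhs (cmap a x0) W by exact: open_nbhs_nbhs.
pose phi := cmap a; pose psi y := xget x0 [set x | cdom a x /\ phi x = y].
have psiK x : cdom a x -> psi (phi x) = x.
  move=> ax; rewrite /psi; case: xgetP => [y -> [ay /inj E]|/(_ x)[]//].
  by apply: E; exact: mem_set.
have ballE y : `|y - phi x0| < r -> ball (phi x0) r y.
  by rewrite -ball_normE /= distrC.
have phiK y : `|y - phi x0| < r -> H y -> cdom a (psi y) /\ phi (psi y) = y.
  move=> yr Hy; have [x ax <-] : (cmap a @` cdom a) y.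
    by rewrite WE; split => //; exact/rW/ballE.
  by rewrite psiK.
pose D := [set x | cdom a x /\ `|phi x - phi x0| < r].
exists phi, psi, D, r; split => //.
- rewrite openE => x [ax xr]; apply: filterI; first exact: open_nbhs_nbhs.
  have cn : {for x, continuous (fun x => `|phi x - phi x0|)}.
    apply: continuous_comp; last exact: norm_continuous.
    by apply: continuousB; [exact: ca|exact: cst_continuous].
  exact: (cn _ (lt_nbhsl xr)).
- by split => //; rewrite subrr normr0.
- by move=> x [ax _]; exact: ca.
- by move=> x [ax xr]; split => //; [exact: (chart_half Aa ax)|exact: psiK].
- by move=> y yr Hy; have [a1 a2] := phiK _ yr Hy; split => //; split => //; rewrite a2.
- move=> y U yr Hy Uy; have [ay yE] := phiK _ yr Hy.
  pose U' := U° `&` cdom a.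
  have oU' : open U' by apply: openI => //; exact: open_interior.
  have [W' oW' W'E] := chU U' oU' (@subIsetr _ _ _).
  exists W' => //; split.
    have [] : (W' `&` H) y by rewrite -W'E; exists (psi y).
    by [].
  move=> z W'z zr Hz; have [x [Ux ax] <-] : (cmap a @` U') z by rewrite W'E.
  by rewrite psiK//; exact: interior_subset.
- move=> x i i0 [ax xr]; split; first by move=> bx; exact: (boundary_invariant Aa ax bx i0).
  by move=> xi; exists a; split => //; exists i.
Qed.

(** * Self-maps supported in a chart ball *)

Section InBall.
Variables (x0 : X) (phi : X -> 'rV[R]_m) (psi : 'rV[R]_m -> X) (D : set X) (r : R).
Hypothesis cb : chart_ball x0 phi psi D r.
Local Notation c := (phi x0).

Lemma half_convex (s : R) (y z : 'rV[R]_m) : 0 <= s <= 1 -> H y -> H z ->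
  H ((1 - s) *: y + s *: z).
Proof.
move=> s01 Hy Hz i i0; rewrite !mxE; have := Hy _ i0; have := Hz _ i0 => *.
by apply: addr_ge0; apply: mulr_ge0 => //; lra.
Qed.

Lemma ball_convex (s e : R) (y z w : 'rV[R]_m) : 0 <= s <= 1 ->
  `|y - w| < e -> `|z - w| < e -> `|(1 - s) *: y + s *: z - w| < e.
Proof.
move=> s01 ye ze.
have -> : (1 - s) *: y + s *: z - w = (1 - s) *: (y - w) + s *: (z - w).
  by rewrite !scalerBr addrACA -opprD -scalerDl subrK scale1r.
apply: le_lt_trans (ler_normD _ _) _; rewrite !normrZ !ger0_norm; [|lra|lra].
have [->|s0] := eqVneq s 0; first by rewrite subr0 mul1r mul0r addr0.
have s0' : 0 < s by rewrite lt0r s0; lra.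
have h1 : (1 - s) * `|y - w| <= (1 - s) * e by apply: ler_wpM2l; [lra|exact: ltW].
have h2 : s * `|z - w| < s * e by rewrite ltr_pM2l.
by lra.
Qed.

Lemma closed_half : closed H.
Proof.
have -> : H = \bigcap_(i in [set i : 'I_m | val i = 0%N]) [set y : 'rV[R]_m | 0 <= y 0 i].
  by apply/seteqP; split => y h i i0; exact: h.
apply: closed_bigI => i _.
exact: (@closed_preimage _ _ (fun y : 'rV[R]_m => y 0 i) [set t | 0 <= t]
  (@coord_continuous R 1 m 0 i) (@closed_ge R 0)).
Qed.

(** The image under [psi] of a compact half-ball, hence closed in the whole Hausdorff space and not
    merely in [D]. *)
Lemma closed_core : closed [set x | D x /\ `|phi x - c| <= r / 2].
Proof.
have [hX _ _ _ _] := mfdA; have r0 := cb_r cb.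
have -> : [set x | D x /\ `|phi x - c| <= r / 2] =
    psi @` ([set y | `|y - c| <= r / 2] `&` H).
  apply/seteqP; split=> [x [Dx xr]|_ [y [/= yr Hy] <-]].
    by have [Hx _ xK] := cb_phi cb Dx; exists (phi x).
  have yr' : `|y - c| < r by apply: le_lt_trans yr _; lra.
  by have [Dy ->] := cb_psi cb yr' Hy.
apply: compact_closed => //; apply: continuous_compact.
  apply/subspace_continuousP => y [/= yr Hy] U Uy.
  have lt_r z : `|z - c| <= r / 2 -> `|z - c| < r by move=> zr; apply: le_lt_trans zr _; lra.
  have [W oW [Wy WU]] := cb_psi_cont cb (lt_r _ yr) Hy Uy.
  have Wn : nbhs y W by exact: open_nbhs_nbhs.
  by apply: filterS Wn => z Wz [/= zr Hz]; exact: (WU _ Wz (lt_r _ zr) Hz).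
apply: bounded_closed_compact.
  exists (`|c| + r / 2); split; first exact: num_real.
  move=> M hM y [/= yr _]; apply: le_trans (ltW hM).
  by rewrite -[y](subrK c) addrC; apply: le_trans (ler_normD _ _) _; rewrite lerD2l.
apply: closedI; last exact: closed_half.
have cn : continuous (fun y : 'rV[R]_m => `|y - c|).
  move=> y; apply: continuous_comp; last exact: norm_continuous.
  by apply: continuousB; [exact: cvg_id|exact: cst_continuous].
exact: (@closed_preimage _ _ _ [set t | t <= r / 2] cn (@closed_le R (r / 2))).
Qed.

(** The open sets [D] and the complement of the closed core cover the space, and the two formulas
    agree on the overlap. *)
Lemma chart_glue (S Z : topologicalType) (G1 G2 : X * S -> Z) :
  (forall x s, D x -> {for (x, s), continuous G1}) -> continuous G2 ->
  (forall x s, D x -> r / 2 < `|phi x - c| -> G1 (x, s) = G2 (x, s)) ->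
  continuous (fun p => if `[< D p.1 >] then G1 p else G2 p).
Proof.
move=> c1 c2 E [x s]; have [Dx|nDx] := pselect (D x).
  have nD : \forall p \near (x, s), D p.1.
    by apply: (@cvg_fst _ _ (nbhs x) (nbhs s) _ D); apply: open_nbhs_nbhs; split => //;
      exact: cb_open cb.
  move=> U; rewrite /= asboolT// => /(c1 _ s Dx) nU.
  by apply: filterS2 nD nU => p Dp; rewrite /= asboolT.
have nK : nbhs x (~` [set x | D x /\ `|phi x - c| <= r / 2]).
  by apply: open_nbhs_nbhs; split; [rewrite openC; exact: closed_core|move=> []].
have nK' : \forall p \near (x, s), (~` [set x | D x /\ `|phi x - c| <= r / 2]) p.1.
  exact: (@cvg_fst _ _ (nbhs x) (nbhs s) _ _ nK).
move=> U; rewrite /= asboolF// => /(c2 (x, s)) nU.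
apply: filterS2 nK' nU => -[y t] Ky; rewrite /=; case: asboolP => // Dy.
by rewrite -E// ltNge; apply/negP => yr; exact: Ky.
Qed.

Definition chart_map (S : Type) (k : 'rV[R]_m * S -> 'rV[R]_m) (p : X * S) : X :=
  if `[< D p.1 >] then psi (k (phi p.1, p.2)) else p.1.

Section ChartMap.
Variables (S : topologicalType) (k : 'rV[R]_m * S -> 'rV[R]_m).
Hypotheses (ck : continuous k)
  (kball : forall y s, `|y - c| < r -> H y -> `|k (y, s) - c| < r /\ H (k (y, s)))
  (kid : forall y s, r / 2 < `|y - c| -> k (y, s) = y).

Lemma chart_mapE x s : D x ->
  D (chart_map k (x, s)) /\ phi (chart_map k (x, s)) = k (phi x, s).
Proof.
move=> Dx; rewrite /chart_map asboolT//=; have [Hx xr _] := cb_phi cb Dx.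
by have [kr kH] := kball s xr Hx; exact: (cb_psi cb kr kH).
Qed.

Lemma chart_map_out x s : ~ D x -> chart_map k (x, s) = x.
Proof. by move=> nDx; rewrite /chart_map asboolF. Qed.

Lemma chart_map_continuous : continuous (chart_map k).
Proof.
apply: (@chart_glue S X (fun p => psi (k (phi p.1, p.2))) fst); last 1 first.
- move=> x s Dx xr; rewrite /= kid//; by have [_ _ ->] := cb_phi cb Dx.
- move=> x s Dx U /= nU; have [Hx xr _] := cb_phi cb Dx.
  have [kr kH] := kball s xr Hx.
  have [W oW [Wk WU]] := cb_psi_cont cb kr kH nU.
  have cp : {for (x, s), continuous (fun p : X * S => k (phi p.1, p.2))}.
    apply: (@continuous_comp _ _ _ (fun p : X * S => (phi p.1, p.2)) k); last exact: ck.
    move=> Y [[P Q] /= [nP nQ] PQ].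
    exists (phi @^-1` P, Q); first by split => //; exact: (cb_cont cb Dx nP).
    by move=> [y t] [/= Py Qt]; exact: (PQ (phi y, t) (conj Py Qt)).
  have nW : \forall p \near (x, s), W (k (phi p.1, p.2)).
    exact: (cp _ (open_nbhs_nbhs (conj oW Wk))).
  have nD : \forall p \near (x, s), D p.1.
    by apply: (@cvg_fst _ _ (nbhs x) (nbhs s) _ D); apply: open_nbhs_nbhs; split => //;
      exact: cb_open cb.
  apply: filterS2 nW nD => -[y t] /= Wy Dy; have [Hy yr _] := cb_phi cb Dy.
  by have [k1 k2] := kball t yr Hy; exact: WU.
- by move=> p; exact: cvg_fst.
Qed.

End ChartMap.

Definition cutoff (e : R) (w y : 'rV[R]_m) : R := ival (clamp (2 - `|y - w| / e)).

Lemma cutoff_cont e w : continuous (cutoff e w).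
Proof.
have cn : continuous (fun y : 'rV[R]_m => `|y - w|).
  move=> y; apply: continuous_comp; last exact: norm_continuous.
  by apply: continuousB; [exact: cvg_id|exact: cst_continuous].
by rewrite /cutoff; ct.
Qed.

Lemma cutoff_itv e w y : 0 <= cutoff e w y <= 1. Proof. exact: ival_itv. Qed.

Lemma cutoff1 e w y : 0 < e -> `|y - w| <= e -> cutoff e w y = 1.
Proof.
move=> e0 ye; rewrite /cutoff clamp_ge1 ?ival1//.
suff : `|y - w| / e <= 1 by lra.
by rewrite ler_pdivrMr// mul1r.
Qed.

Lemma cutoff0 e w y : 0 < e -> 2 * e <= `|y - w| -> cutoff e w y = 0.
Proof.
move=> e0 ye; rewrite /cutoff clamp_le0 ?ival0//.
suff : 2 <= `|y - w| / e by lra.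
by rewrite ler_pdivlMr.
Qed.

Lemma lincomb_cont (T : topologicalType) (s : T -> R) (y z : T -> 'rV[R]_m) :
  continuous s -> continuous y -> continuous z ->
  continuous (fun t => (1 - s t) *: y t + s t *: z t).
Proof.
move=> cs cy cz t; have c1 : continuous (fun t => 1 - s t) by ct.
apply: (@continuousD R 'rV[R]_m T (fun t => (1 - s t) *: y t) (fun t => s t *: z t) t).
  by apply: cvgZ; [exact: c1|exact: cy].
by apply: cvgZ; [exact: cs|exact: cz].
Qed.

Lemma ball_center : `|c - c| < r. Proof. by rewrite subrr normr0 (cb_r cb). Qed.

Lemma half_center : H c. Proof. by have [] := cb_phi cb (cb_x0 cb). Qed.

Definition ball_map (k : 'rV[R]_m -> 'rV[R]_m) :=
  [/\ continuous k,
      forall y, `|y - c| < r -> H y -> `|k y - c| < r /\ H (k y) &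
      forall y, r / 2 < `|y - c| -> k y = y].

(** A single map as a family over the interval that does not depend on the parameter, so that the
    results on [chart_map] apply. *)
Definition chart_self (k : 'rV[R]_m -> 'rV[R]_m) (x : X) : X :=
  chart_map (fun q : 'rV[R]_m * unit_interval R => k q.1) (x, I0 R).

Lemma chart_self_continuous k : ball_map k -> continuous (chart_self k).
Proof.
move=> [ck kb kid]; rewrite /chart_self.
apply: (@comp_cont _ _ _ (chart_map (fun q : 'rV[R]_m * unit_interval R => k q.1))
  (fun x => (x, I0 R))); last by ct.
by apply: chart_map_continuous => [|y s|y s]; [ct|exact: kb|exact: kid].
Qed.

Lemma chart_selfE k x : ball_map k -> D x ->
  D (chart_self k x) /\ phi (chart_self k x) = k (phi x).
Proof.
by move=> [ck kb kid] Dx; apply: (@chart_mapE _ (fun q : 'rV[R]_m * unit_interval R => k q.1)) =>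
  // y s; exact: kb.
Qed.

Lemma phi_inj x y : D x -> D y -> phi x = phi y -> x = y.
Proof.
move=> Dx Dy E; have [_ _ <-] := cb_phi cb Dx.
by have [_ _ <-] := cb_phi cb Dy; rewrite E.
Qed.

(** The straight-line homotopy in the chart: it stays in the half-ball by convexity, is trivial near
    the rim of the ball, and is stationary at [x] because [k' \o k] fixes the image of [x]. *)
Lemma chart_self_homotopic k k' x : ball_map k -> ball_map k' -> D x ->
  k' (k (phi x)) = phi x ->
  homotopic_rel R [set x] (chart_self k' \o chart_self k) id.
Proof.
move=> bk bk' Dx kx; have [[ck kb kid] [ck' kb' kid']] := (bk, bk').
pose l (q : 'rV[R]_m * unit_interval R) :=
  (1 - ival q.2) *: k' (k q.1) + ival q.2 *: q.1.
have lb y s : `|y - c| < r -> H y -> `|l (y, s) - c| < r /\ H (l (y, s)).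
  move=> yr Hy; have [k1 k2] := kb _ yr Hy; have [k3 k4] := kb' _ k1 k2.
  have s01 := ival_itv s.
  by split; [exact: (ball_convex s01 k3 yr)|exact: (half_convex s01 k4 Hy)].
have lid y s : r / 2 < `|y - c| -> l (y, s) = y.
  by move=> yr; rewrite /l kid//= kid'// -scalerDl subrK scale1r.
exists (chart_map l); split.
- by apply: chart_map_continuous => //; apply: lincomb_cont; ct.
- move=> z; have [Dz|nDz] := pselect (D z); last first.
    by rewrite /= /chart_self !chart_map_out.
  have [D1 E1] := chart_mapE lb (I0 R) Dz.
  have [D2 E2] := chart_selfE bk Dz; have [D3 E3] := chart_selfE bk' D2.
  by apply: phi_inj => //; rewrite E1 E3 E2 /l /= ival0 subr0 scale1r scale0r addr0.
- move=> z; have [Dz|nDz] := pselect (D z); last by rewrite chart_map_out.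
  have [D1 E1] := chart_mapE lb (I1 R) Dz.
  by apply: phi_inj => //; rewrite E1 /l /= ival1 subrr scale0r add0r scale1r.
- move=> _ s ->; have [D1 E1] := chart_mapE lb s Dx.
  have [D2 E2] := chart_selfE bk Dx; have [D3 E3] := chart_selfE bk' D2.
  by apply: phi_inj => //; rewrite E1 E3 E2 /l /= kx -scalerDl subrK scale1r.
Qed.

(** Sends [w] to [z] and is supported within r/4 of [w], hence within r/2 of the centre when [w] is
    within r/4 of it. *)
Definition push_to (w z y : 'rV[R]_m) : 'rV[R]_m :=
  (1 - cutoff (r / 8) w y) *: y + cutoff (r / 8) w y *: z.

Lemma push_to_ball_map w z : `|w - c| < r / 4 -> `|z - c| < r / 4 -> H z ->
  ball_map (push_to w z).
Proof.
move=> wr zr Hz; have r0 := cb_r cb; split.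
- by apply: lincomb_cont; [exact: cutoff_cont|exact: id_cont|exact: cst_cont].
- move=> y yr Hy; have b01 := cutoff_itv (r / 8) w y.
  split; last exact: half_convex.
  by apply: ball_convex => //; apply: lt_trans zr _; lra.
- move=> y yr; rewrite /push_to cutoff0; [|lra|].
    by rewrite subr0 scale1r scale0r addr0.
  have := ler_normD (y - w) (w - c); rewrite addrA subrK => h; lra.
Qed.

Lemma push_toE w z : push_to w z w = z.
Proof.
rewrite /push_to cutoff1; first by rewrite subrr scale0r add0r scale1r.
  by have := cb_r cb => ?; lra.
by rewrite subrr normr0; have := cb_r cb => ?; lra.
Qed.

(** The pushes in the two directions need not be inverse maps, but each composite fixes its base
    point and is homotopic to the identity relative to it. *)
Lemma local_base_move y : D y -> `|phi y - c| < r / 4 ->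
  pointed_homotopy_equivalent R x0 y.
Proof.
move=> Dy yr; have r0 := cb_r cb; have Dx0 := cb_x0 cb.
have cr : `|c - c| < r / 4 by rewrite subrr normr0; lra.
have [Hy _ _] := cb_phi cb Dy.
have b1 := push_to_ball_map cr yr Hy; have b2 := push_to_ball_map yr cr half_center.
exists (chart_self (push_to c (phi y))), (chart_self (push_to (phi y) c)); split.
- exact: chart_self_continuous.
- exact: chart_self_continuous.
- have [D1 E1] := chart_selfE b1 Dx0; have [D2 E2] := chart_selfE b2 Dy.
  by split; apply: phi_inj; rewrite ?E1 ?E2 ?push_toE.
- by apply: chart_self_homotopic => //; rewrite !push_toE.
- by apply: chart_self_homotopic => //; rewrite !push_toE.
Qed.

(** In the chart the boundary is a hyperplane through the centre, so moving along segments towards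
    the centre preserves it. *)
Lemma boundary_contraction : boundary A x0 ->
  exists (d : X * unit_interval R -> X) (eta : X -> unit_interval R),
  [/\ continuous d, (forall v, d (v, I0 R) = v), continuous eta,
      (forall s, d (x0, s) = x0) &
      [/\ forall v s, boundary A v -> boundary A (d (v, s)), eta x0 = I1 R &
          forall v, eta v <> I0 R -> d (v, I1 R) = x0]].
Proof.
move=> bx0; have [a [_ _ [i i_0 _]]] := bx0.
have r0 := cb_r cb; have Dx0 := cb_x0 cb.
(* This cutoff is 1 up to radius r/4 and 0 from r/2; the one in [eta], with r/8, vanishes from r/4
   on, so [d] contracts completely wherever [eta] is nonzero. *)
pose l (q : 'rV[R]_m * unit_interval R) := ival q.2 * cutoff (r / 4) c q.1.
pose k (q : 'rV[R]_m * unit_interval R) := (1 - l q) *: q.1 + l q *: c.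
have l01 q : 0 <= l q <= 1.
  have := ival_itv q.2; have := cutoff_itv (r / 4) c q.1 => /andP[? ?] /andP[? ?].
  by apply/andP; split; [exact: mulr_ge0|exact: mulr_ile1].
have cl : continuous l.
  rewrite /l; apply: mul_cont; [by ct|].
  by apply: (@comp_cont _ _ _ (cutoff (r / 4) c) fst); [exact: cutoff_cont|by ct].
have ck : continuous k by apply: lincomb_cont => //; ct.
have kb y s : `|y - c| < r -> H y -> `|k (y, s) - c| < r /\ H (k (y, s)).
  move=> yr Hy; split; first exact: (ball_convex (l01 _) yr ball_center).
  exact: (half_convex (l01 _) Hy half_center).
have kid y s : r / 2 < `|y - c| -> k (y, s) = y.
  move=> yr; rewrite /k /l /= cutoff0; [|lra|lra].
  by rewrite mulr0 subr0 scale1r scale0r addr0.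
pose eta x := if `[< D x >] then clamp (cutoff (r / 8) c (phi x)) else I0 R.
have ceta : continuous eta.
  pose G1 (p : X * unit_interval R) := clamp (cutoff (r / 8) c (phi p.1)).
  have cG : continuous (fun p : X * unit_interval R => if `[< D p.1 >] then G1 p else I0 R).
    apply: (@chart_glue _ _ G1 (fun=> I0 R)); last 1 first.
    - move=> x s Dx xr; rewrite /G1 /= cutoff0 ?clamp_le0//; lra.
    - move=> x s Dx; rewrite /G1.
      apply: (@continuous_comp _ _ _ (fun p : X * unit_interval R => phi p.1)
        (fun w => clamp (cutoff (r / 8) c w))); last by apply: clamp_cont; exact: cutoff_cont.
      apply: (@continuous_comp _ _ _ fst phi); first exact: cvg_fst.
      exact: (cb_cont cb).
    - exact: cst_cont.
  by apply: (@comp_cont _ _ _ _ (fun x => (x, I0 R)) cG); ct.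
exists (chart_map k), eta; split => //.
- exact: chart_map_continuous.
- move=> v; have [Dv|nDv] := pselect (D v); last by rewrite chart_map_out.
  have [D1 E1] := chart_mapE kb (I0 R) Dv; apply: phi_inj => //.
  by rewrite E1 /k /l /= ival0 mul0r subr0 scale1r scale0r addr0.
- move=> s; have [D1 E1] := chart_mapE kb s Dx0; apply: phi_inj => //.
  by rewrite E1 /k /= -scalerDl subrK scale1r.
split.
- move=> v s bv; have [Dv|nDv] := pselect (D v); last by rewrite chart_map_out.
  have [D1 E1] := chart_mapE kb s Dv; apply/(cb_boundary cb i_0 D1).
  have /(cb_boundary cb i_0 Dv) v0 := bv; have /(cb_boundary cb i_0 Dx0) c0 := bx0.
  by rewrite E1 /k !mxE v0 c0 !mulr0 addr0.
- rewrite /eta asboolT// cutoff1 ?clamp_ge1//; [lra|].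
  by rewrite subrr normr0; lra.
- move=> v; rewrite /eta; case: asboolP => // Dv ne.
  have vr : `|phi v - c| < r / 4.
    by rewrite ltNge; apply/negP => vr; apply: ne; rewrite cutoff0 ?clamp_le0//; lra.
  have [D1 E1] := chart_mapE kb (I1 R) Dv; apply: phi_inj => //.
  rewrite E1 /k /l /= ival1 cutoff1 ?mul1r; [|lra|exact: ltW].
  by rewrite subrr scale0r add0r scale1r.
Qed.

End InBall.

Lemma near_base_move (x : X) : \forall y \near x, pointed_homotopy_equivalent R x y.
Proof.
have [phi [psi [D [r cb]]]] := chart_ballP x.
have n1 : \forall y \near x, D y.
  by apply: open_nbhs_nbhs; split; [exact: cb_open cb|exact: cb_x0 cb].
have cn : {for x, continuous (fun y => `|phi y - phi x|)}.
  apply: continuous_comp; last exact: norm_continuous.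
  by apply: continuousB; [exact: (cb_cont cb (cb_x0 cb))|exact: cst_continuous].
have r4 : `|phi x - phi x| < r / 4 by rewrite subrr normr0; have := cb_r cb => ?; lra.
have n2 : \forall y \near x, `|phi y - phi x| < r / 4 := cn _ (lt_nbhsl r4).
apply: filterS2 n1 n2 => y Dy yr; exact: (local_base_move cb Dy yr).
Qed.

(** Along a path, being equivalent to [x] is an open and closed condition by [near_base_move], and
    the interval is connected. *)
Lemma base_move (x y : X) : path_connected_space R X ->
  pointed_homotopy_equivalent R x y.
Proof.
move=> /(_ x y)[p]; pose g (t : R) : X := p (clamp t).
have cg : continuous g.
  by apply: comp_cont; [exact: cts_fun|exact: clamp_continuous].
pose C := [set t : R | pointed_homotopy_equivalent R x (g t)].
have near_g t : \forall s \near t, pointed_homotopy_equivalent R (g t) (g s).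
  exact: (cg t _ (near_base_move (g t))).
have oC : open C.
  rewrite openE => t Ct; apply: filterS (near_g t) => s; exact: phe_trans Ct.
have cC : closed C.
  rewrite -openC openE => t nCt; apply: filterS (near_g t) => s ts Cs; apply: nCt.
  exact: phe_trans Cs (phe_sym ts).
have g0 : g 0 = x by exact: path_zero.
have g1 : g 1 = y by exact: path_one.
have E : `[0 : R, 1]%classic `&` C = `[0 : R, 1]%classic.
  apply: (@segment_connected R 0 1); [|by exists C|by exists C].
  by exists 0; split; rewrite /= ?in_itv/= ?lexx ?ler01// /C /= g0; exact: phe_refl.
have [] : (`[0 : R, 1]%classic `&` C) 1 by rewrite E /= in_itv /= lexx ler01.
by rewrite /C /= g1.
Qed.

End Manifold.

(** * The disk and the square *)

Section DiskSquare.
Variable R : realType.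
Local Notation I := (unit_interval R).
Local Notation i0 := (I0 R).
Local Notation i1 := (I1 R).

Lemma circle_ex (x y : R) : x ^+ 2 + y ^+ 2 = 1 ->
  exists t : I, cos (2 * pi * ival t) = x /\ sin (2 * pi * ival t) = y.
Proof.
move=> xy; have p0 : 0 < pi :> R := pi_gt0 R.
have x1 : -1 <= x <= 1.
  have x2 : x ^+ 2 <= 1 by have := sqr_ge0 y; lra.
  by apply/andP; split; nra.
have ac0 := acos_ge0 x1; have acp := acos_lepi x1.
have ca : cos (acos x) = x by apply: acosK; rewrite in_itv.
have sa : sin (acos x) = `|y|.
  by rewrite sin_acos// (_ : 1 - x ^+ 2 = y ^+ 2) ?sqrtr_sqr//; lra.
pose q := acos x / (2 * pi).
have q01 : 0 <= q <= 1.
  apply/andP; split; first by rewrite divr_ge0// mulr_ge0// ltW.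
  by rewrite /q ler_pdivrMr ?mulr_gt0// mul1r; lra.
have qE : 2 * pi * q = acos x by rewrite /q mulrC divfK// gt_eqF// mulr_gt0.
case: (ger0P y) => y0.
  by exists (clamp q); rewrite clampK// qE ca sa ger0_norm.
exists (clamp (1 - q)); rewrite clampK; last by lra.
have -> : 2 * pi * (1 - q) = - acos x + pi *+ 2.
  by rewrite mulrBr qE mulr1 mulr2n; ring.
by rewrite cosD2pi sinD2pi cosN sinN ca sa ltr0_norm ?opprK.
Qed.

(** The addition formula gives cos (2 pi (s - t)) = 1. With u = |s - t|, either u or 1 - u is at
    most 1/2, where injectivity of the cosine on [0, pi] makes it 0. *)
Lemma circle_inj (s t : I) :
  cos (2 * pi * ival s) = cos (2 * pi * ival t) ->
  sin (2 * pi * ival s) = sin (2 * pi * ival t) ->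
  [\/ s = t, s = i0 /\ t = i1 | s = i1 /\ t = i0].
Proof.
move=> cst sst; have p0 : 0 < pi :> R := pi_gt0 R.
have C : cos (2 * pi * (ival s - ival t)) = 1.
  by rewrite mulrBr cosB cst sst -!expr2 cos2Dsin2.
have [[s0 s1] [t0 t1]] := ((ival_ge0 s, ival_le1 s), (ival_ge0 t, ival_le1 t)).
pose u := `|ival s - ival t|.
have u1 : 0 <= u <= 1 by rewrite normr_ge0 /= ler_norml; lra.
have Cu : cos (2 * pi * u) = 1.
  by rewrite /u; case: (ger0P (ival s - ival t)) => _; rewrite ?mulrN ?cosN.
have inj0 (v : R) : 0 <= v <= 2^-1 -> cos (2 * pi * v) = 1 -> v = 0.
  move=> v01 cv; have [v0 v2] := andP v01.
  have b : 2 * pi * v \in `[0, pi] by rewrite in_itv /=; apply/andP; split; nra.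
  have z : (0 : R) \in `[0, pi] by rewrite in_itv /= lexx ltW.
  have := cos_inj b z (etrans cv (esym (cos0 R))).
  by move/eqP; rewrite mulf_eq0 gt_eqF ?mulr_gt0//= => /eqP.
have [u0|u0] : u = 0 \/ u = 1.
  have [u2|u2] := leP u 2^-1; first by left; apply: inj0 => //; lra.
  right; have : 1 - u = 0.
    apply: inj0; first by lra.
    have -> : 2 * pi * (1 - u) = - (2 * pi * u) + pi *+ 2 by rewrite mulr2n; ring.
    by rewrite cosD2pi cosN.
  by lra.
- by constructor 1; apply: ival_inj; move/eqP: u0; rewrite normr_eq0 subr_eq0 => /eqP.
- move: u0; rewrite /u; case: (ger0P (ival s - ival t)) => _ h.
    by constructor 3; split; apply: ival_inj; rewrite ?ival0 ?ival1; lra.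
  by constructor 2; split; apply: ival_inj; rewrite ?ival0 ?ival1; lra.
Qed.

(* Where [q] vanishes the quotient is 0 by convention, and this is the right
   limit because [u] is bounded by [q] and [p] vanishes too. *)
Lemma scale_quot_cont (T : topologicalType) (u p q : T -> R) :
  continuous u -> continuous p -> continuous q ->
  (forall t, `|u t| <= q t) -> (forall t, q t = 0 -> p t = 0) ->
  continuous (fun t => u t * (p t / q t)).
Proof.
move=> cu cp cq uq qp t; have [q0|q0] := eqVneq (q t) 0; last first.
  apply: cvgM; first exact: cu.
  by apply: cvgM; [exact: cp|apply: cvgV; [exact: q0|exact: cq]].
rewrite /continuous_at q0 invr0 !mulr0.
apply/cvgr0Pnorm_le => e e0.
have : \forall s \near t, `|p s| < e.
  have cn := norm_cont cp; have := cn t; rewrite /continuous_at (qp _ q0) normr0.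
  by move=> /(_ _ (lt_nbhsl e0)).
apply: filterS => s ps; rewrite normrM normrM.
have qs : 0 <= q s by apply: le_trans (uq s).
have [qs0|qs0] := eqVneq (q s) 0; first by rewrite qs0 invr0 normr0 !mulr0 ltW.
apply: le_trans (ltW ps).
rewrite mulrCA -[leRHS]mulr1; apply: ler_wpM2l => //.
by rewrite normfV (ger0_norm qs) ler_pdivrMr ?mul1r// lt0r qs0.
Qed.

Definition norm2 (x y : R) : R := Num.sqrt (x ^+ 2 + y ^+ 2).

Lemma radius_ge0 (x y : R) : 0 <= radius x y.
Proof. by rewrite /radius le_max normr_ge0. Qed.

Lemma norm2_ge0 (x y : R) : 0 <= norm2 x y. Proof. exact: sqrtr_ge0. Qed.

Lemma norm2_eq0 (x y : R) : norm2 x y = 0 -> x = 0 /\ y = 0.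
Proof.
move=> /eqP; rewrite sqrtr_eq0 => h.
have x0 : x ^+ 2 = 0 by apply/le_anti; rewrite sqr_ge0 andbT; have := sqr_ge0 y; lra.
have y0 : y ^+ 2 = 0 by apply/le_anti; rewrite sqr_ge0 andbT; have := sqr_ge0 x; lra.
by move/eqP: x0; move/eqP: y0; rewrite !sqrf_eq0 => /eqP -> /eqP ->.
Qed.

Lemma radius_eq0 (x y : R) : radius x y = 0 -> x = 0 /\ y = 0.
Proof.
rewrite /radius => h; have hx : `|x| <= 0 by rewrite -h le_max lexx.
have hy : `|y| <= 0 by rewrite -h le_max lexx orbT.
by move: hx hy; rewrite !normr_le0 => /eqP -> /eqP ->.
Qed.

Lemma radiusM (k x y : R) : 0 <= k -> radius (x * k) (y * k) = radius x y * k.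
Proof. by move=> k0; rewrite /radius !normrM (ger0_norm k0) maxr_pMl. Qed.

Lemma norm2M (k x y : R) : 0 <= k -> norm2 (x * k) (y * k) = norm2 x y * k.
Proof.
move=> k0; rewrite /norm2 !exprMn -mulrDl sqrtrM ?addr_ge0 ?sqr_ge0//.
by rewrite sqrtr_sqr ger0_norm.
Qed.

Lemma norm2_cont (T : topologicalType) (x y : T -> R) : continuous x -> continuous y ->
  continuous (fun t => norm2 (x t) (y t)).
Proof.
move=> cx cy; apply: (@comp_cont _ _ _ (@Num.sqrt R)); first exact: sqrt_continuous.
by rewrite (_ : (fun t => _) = (fun t => x t * x t + y t * y t)); [ct|].
Qed.

(* Rescaling along rays so that the Euclidean norm becomes the sup norm. *)
Definition square_of (x y : R) : I * I :=
  (of_centre (x * (norm2 x y / radius x y) / 2),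
   of_centre (y * (norm2 x y / radius x y) / 2)).

Lemma square_of_cont (T : topologicalType) (x y : T -> R) : continuous x -> continuous y ->
  continuous (fun t => square_of (x t) (y t)).
Proof.
move=> cx cy; have cn := norm2_cont cx cy.
have cr : continuous (fun t => radius (x t) (y t)) by rewrite /radius; ct.
have r0 t : radius (x t) (y t) = 0 -> norm2 (x t) (y t) = 0.
  by move=> /radius_eq0[-> ->]; rewrite /norm2 !expr0n /= addr0 sqrtr0.
rewrite /square_of /of_centre; apply: pair_continuous; apply: clamp_cont;
  apply: add_cont; [|exact: cst_cont| |exact: cst_cont];
  apply: mul_cont; [|exact: cst_cont| |exact: cst_cont];
  apply: scale_quot_cont => // t; rewrite /radius le_max lexx ?orbT//.
Qed.

Lemma square_ofE (x y : R) : norm2 x y <= 1 ->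
  [/\ 2 * (ival (square_of x y).1 - 2^-1) = x * (norm2 x y / radius x y),
      2 * (ival (square_of x y).2 - 2^-1) = y * (norm2 x y / radius x y) &
      radius (ival (square_of x y).1 - 2^-1) (ival (square_of x y).2 - 2^-1) =
        norm2 x y / 2].
Proof.
move=> n1; set k := norm2 x y / radius x y.
have k0 : 0 <= k by rewrite divr_ge0 ?norm2_ge0 ?radius_ge0.
have rk : radius x y * k = norm2 x y.
  have [r0|r0] := eqVneq (radius x y) 0; last by rewrite /k mulrCA divff// mulr1.
  have [-> ->] := radius_eq0 r0.
  by rewrite /norm2 !expr0n /= addr0 sqrtr0 /radius normr0 maxxx mul0r.
have bd (z : R) : `|z| <= radius x y -> - 2^-1 <= z * k / 2 <= 2^-1.
  move=> zr; rewrite -ler_norml normrM normrM (ger0_norm k0) (@ger0_norm _ 2^-1)//.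
  have : `|z| * k <= radius x y * k by apply: ler_wpM2r.
  by rewrite rk; lra.
have bx := bd x ltac:(by rewrite /radius le_max lexx).
have by_ := bd y ltac:(by rewrite /radius le_max lexx orbT).
rewrite /square_of /= -/k !ival_of_centre// !addrK; split; [by field|by field|].
by rewrite radiusM// radiusM// rk.
Qed.

Lemma square_of_inj (x y x' y' : R) : norm2 x y <= 1 -> norm2 x' y' <= 1 ->
  square_of x y = square_of x' y' -> x = x' /\ y = y'.
Proof.
move=> n n' E; have [e1 e2 e3] := square_ofE n; have [f1 f2 f3] := square_ofE n'.
move: e1 e2 e3 f1 f2 f3; rewrite E => -> -> -> e1 e2 e3.
have nn : norm2 x' y' = norm2 x y by lra.
have [n0|n0] := eqVneq (norm2 x y) 0.
  by have [-> ->] := norm2_eq0 n0; move: nn; rewrite n0 => /norm2_eq0[-> ->].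
have pos (u v : R) : norm2 u v != 0 -> 0 < norm2 u v / radius u v.
  move=> uv; apply: divr_gt0; rewrite lt0r ?uv ?norm2_ge0 ?radius_ge0 ?andbT//.
  apply/eqP => /radius_eq0[u0 v0]; move/eqP: uv; apply.
  by rewrite u0 v0 /norm2 !expr0n /= addr0 sqrtr0.
have := pos x y n0; have := pos x' y' ltac:(by rewrite nn).
set k' := norm2 x' y' / _ in e1 e2 *; set k := norm2 x y / _ in e1 e2 * => k'0 k0.
have kk : k = k'.
  have : norm2 (x * k) (y * k) = norm2 (x' * k') (y' * k') by rewrite e1 e2.
  rewrite !norm2M ?ltW// nn => /mulfI; apply; exact: n0.
have kn0 : k != 0 by rewrite gt_eqF.
by split; apply: (mulIf kn0); rewrite ?e1 ?e2 -?kk // kk.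
Qed.

Lemma square_of_edge (x y : R) : norm2 x y <= 1 ->
  (edge (square_of x y) <-> x ^+ 2 + y ^+ 2 = 1).
Proof.
move=> n1; have [_ _ e3] := square_ofE n1; rewrite edge_radius e3.
have nn : norm2 x y ^+ 2 = x ^+ 2 + y ^+ 2 by rewrite sqr_sqrtr// addr_ge0 ?sqr_ge0.
split=> [h|h]; first by rewrite -nn (_ : norm2 x y = 1) ?expr1n//; lra.
by rewrite /norm2 h sqrtr1 mul1r.
Qed.

(** The preimage is on the same ray, rescaled by the inverse ratio [radius / norm2]; the centre,
    where the ratio is undefined, is treated apart. *)
Lemma square_of_surj (w : I * I) : exists x y, norm2 x y <= 1 /\ square_of x y = w.
Proof.
pose u := 2 * (ival w.1 - 2^-1); pose v := 2 * (ival w.2 - 2^-1).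
have ru : radius u v <= 1.
  rewrite /radius ge_max !ler_norml /u /v; have := ival_itv w.1; have := ival_itv w.2.
  by move=> /andP[? ?] /andP[? ?]; apply/andP; split; lra.
pose k := radius u v / norm2 u v.
have k0 : 0 <= k by rewrite divr_ge0 ?norm2_ge0 ?radius_ge0.
have [n0|n0] := eqVneq (norm2 u v) 0.
  have [u0 v0] := norm2_eq0 n0; exists 0, 0; split.
    by rewrite /norm2 !expr0n /= addr0 sqrtr0.
  rewrite /square_of !mul0r /of_centre add0r [RHS]surjective_pairing; congr pair;
    apply: ival_inj; rewrite clampK; move: u0 v0; rewrite /u /v; lra.
have r0 : radius u v != 0.
  apply/eqP => /radius_eq0[u0 v0]; move/eqP: n0; apply.
  by rewrite u0 v0 /norm2 !expr0n /= addr0 sqrtr0.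
have nk : norm2 (u * k) (v * k) = radius u v.
  by rewrite norm2M// /k mulrCA divff// mulr1.
have n1 : norm2 (u * k) (v * k) <= 1 by rewrite nk.
exists (u * k), (v * k); split => //.
have [e1 e2 _] := square_ofE n1.
have cancel : k * (norm2 (u * k) (v * k) / radius (u * k) (v * k)) = 1.
  rewrite nk radiusM// mulrA [k * _]mulrC divff//.
  by rewrite mulf_neq0// /k mulf_neq0// invr_eq0.
rewrite -mulrA cancel mulr1 in e1; rewrite -mulrA cancel mulr1 in e2.
rewrite [LHS]surjective_pairing [RHS]surjective_pairing; congr pair; apply: ival_inj;
  move: e1 e2; rewrite /u /v; lra.
Qed.

End DiskSquare.

(** * The open book and the page bundle *)

Lemma compact_set_type (X : topologicalType) (A : set X) :
  compact A -> compact [set: A].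
Proof.
move=> cA F FF _; pose G : set_system X := (fun x : A => set_val x) @ F.
have FG : ProperFilter G by exact: fmap_proper_filter.
have GA : G A.
  have E : (fun x : A => set_val x) @^-1` A = setT.
    by apply/seteqP; split=> // x _; exact: (set_mem (svalP x)).
  by rewrite /G /fmap /= E; exact: filterT.
have [p [Ap pG]] := cA G FG GA; exists (exist (fun x => x \in A) p (mem_set Ap)).
split=> // U W FU nW; have [N [oN Np NW]] : exists N : set X,
    [/\ open N, N p & (fun x : A => set_val x) @^-1` N `<=` W].
  by case: nW => W' [[N oN <-] Np] sub; exists N.
have GU : G ((fun x : A => set_val x) @` U).
  by apply: (@filterS _ F _ U _ _ FU) => x Ux; exists x.
have [_ [[x Ux <-] Nx]] := pG _ N GU (open_nbhs_nbhs (conj oN Np)).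
by exists x; split => //; exact: NW.
Qed.

(* A Hausdorff space covered by the images of two compact spaces carries the
   quotient topology. *)
Lemma compact_cover_cont (K1 K2 Y Z : topologicalType) (q1 : K1 -> Y) (q2 : K2 -> Y)
    (G : Y -> Z) :
  compact [set: K1] -> compact [set: K2] -> hausdorff_space Y ->
  continuous q1 -> continuous q2 ->
  (forall y, (exists k, q1 k = y) \/ (exists k, q2 k = y)) ->
  continuous (fun k => G (q1 k)) -> continuous (fun k => G (q2 k)) -> continuous G.
Proof.
move=> k1 k2 hY c1 c2 cover g1 g2; apply/continuous_closedP => C cC.
have -> : G @^-1` C = q1 @` ((fun k => G (q1 k)) @^-1` C) `|`
                      q2 @` ((fun k => G (q2 k)) @^-1` C).
  apply/seteqP; split=> [y Cy|y [] [k Ck <-]//].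
  by have [[k ky]|[k ky]] := cover y; [left|right]; exists k => //; rewrite /= ky.
have cl (K : topologicalType) (q : K -> Y) : compact [set: K] -> continuous q ->
    continuous (fun k => G (q k)) -> closed (q @` ((fun k => G (q k)) @^-1` C)).
  move=> cK cq cg; apply: compact_closed => //; apply: continuous_compact.
    exact: continuous_subspaceT.
  apply: (@subclosed_compact _ _ setT) => //; exact: closed_preimage.
by apply: closedU; exact: cl.
Qed.

(** * The disk as a square and the circle as its edge *)

Section Disk.
Variable R : realType.
Local Notation I := (unit_interval R).
Implicit Types z : disk R.

Definition disk_square z : I * I := square_of (set_val z 0 0) (set_val z 0 1).

Definition rim (t : I) : I * I :=
  square_of (cos (2 * pi * ival t)) (sin (2 * pi * ival t)).

Lemma norm2_le1 (x y : R) : (norm2 x y <= 1) = (x ^+ 2 + y ^+ 2 <= 1).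
Proof.
have h : 0 <= x ^+ 2 + y ^+ 2 by rewrite addr_ge0 ?sqr_ge0.
by rewrite /norm2 -{1}sqrtr1 ler_sqrt.
Qed.

Lemma disk_norm2 z : norm2 (set_val z 0 0) (set_val z 0 1) <= 1.
Proof. by rewrite norm2_le1; exact: (set_mem (svalP z)). Qed.

Lemma circle_coord (t : R) :
  circle t 0 0 = cos (2 * pi * t) /\ circle t 0 1 = sin (2 * pi * t).
Proof. by rewrite !mxE. Qed.

Lemma rim_norm2 (t : I) : norm2 (cos (2 * pi * ival t)) (sin (2 * pi * ival t)) <= 1.
Proof. by rewrite norm2_le1 cos2Dsin2. Qed.

Lemma disk_square_rim z t : set_val z = circle (ival t) -> disk_square z = rim t.
Proof. by move=> zt; rewrite /disk_square zt; have [-> ->] := circle_coord (ival t). Qed.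

Lemma row2_eq (u v : 'rV[R]_2) : u 0 0 = v 0 0 -> u 0 1 = v 0 1 -> u = v.
Proof.
move=> e0 e1; apply/rowP => -[[|[|//]] jlt].
- by rewrite (_ : Ordinal jlt = 0)//; exact: val_inj.
- by rewrite (_ : Ordinal jlt = 1)//; exact: val_inj.
Qed.

Lemma disk_square_inj z z' : disk_square z = disk_square z' -> z = z'.
Proof.
move=> /(square_of_inj (disk_norm2 z) (disk_norm2 z'))[e0 e1].
by apply: val_inj; apply: row2_eq.
Qed.

Lemma disk_square_rim_inv z t : disk_square z = rim t -> set_val z = circle (ival t).
Proof.
move=> /(square_of_inj (disk_norm2 z) (rim_norm2 t))[e0 e1].
by have [f0 f1] := circle_coord (ival t); apply: row2_eq; rewrite ?f0 ?f1.
Qed.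

Lemma disk_square_surj w : exists z, disk_square z = w.
Proof.
have [x [y [n1 <-]]] := square_of_surj w.
pose u : 'rV[R]_2 := \row_j if j == 0 then x else y.
have u0 : u 0 0 = x by rewrite mxE.
have u1 : u 0 1 = y by rewrite mxE.
have uP : u \in [set z : 'rV[R]_2 | z 0 0 ^+ 2 + z 0 1 ^+ 2 <= 1].
  by apply/mem_set; rewrite /= u0 u1 -norm2_le1.
exists (exist (fun v : 'rV[R]_2 => v \in _) u uP).
by rewrite /disk_square set_valE /= u0 u1.
Qed.

Lemma rim_edge t : edge (rim t).
Proof. by apply/(square_of_edge (rim_norm2 t)); exact: cos2Dsin2. Qed.

Lemma rim_surj w : edge w -> exists t, rim t = w.
Proof.
have [x [y [n1 <-]]] := square_of_surj w => /(square_of_edge n1)/circle_ex[t [e1 e2]].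
by exists t; rewrite /rim e1 e2.
Qed.

Lemma rim_inj s t : rim s = rim t ->
  [\/ s = t, s = I0 R /\ t = I1 R | s = I1 R /\ t = I0 R].
Proof.
by move=> /(square_of_inj (rim_norm2 s) (rim_norm2 t))[]; exact: circle_inj.
Qed.

Lemma rim01 : rim (I0 R) = rim (I1 R).
Proof.
rewrite /rim ival0 ival1 mulr0 mulr1 cos0 sin0 mulrC mulr_natr.
by rewrite cos2pi sin2pi.
Qed.

Lemma rim_continuous : continuous rim.
Proof.
apply: square_of_cont; apply: comp_cont; [exact: continuous_cos|by ct|
  exact: continuous_sin|by ct].
Qed.

Lemma disk_coord_cont (j : 'I_2) : continuous (fun z => set_val z 0 j).
Proof.
apply: (@comp_cont _ _ _ (fun u : 'rV[R]_2 => u 0 j)); first exact: coord_continuous.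
by apply: val_cont; exact: id_cont.
Qed.

Lemma disk_square_continuous : continuous disk_square.
Proof. by apply: square_of_cont; exact: disk_coord_cont. Qed.

Lemma disk_compact : compact [set: disk R].
Proof.
apply: compact_set_type; apply: bounded_closed_compact.
  exists 1; split; first exact: num_real.
  move=> M hM u; rewrite /= -norm2_le1 => n1; apply: le_trans (ltW hM).
  have sq (a b : R) : `|a| <= norm2 a b by rewrite -sqrtr_sqr ler_wsqrtr// lerDl sqr_ge0.
  rewrite -[`|u|]/(mx_norm u).
  have [->|/mx_norm_neq0[[i j] ->]] := eqVneq (mx_norm u) 0; first exact: ler01.
  rewrite (ord1 i) /=; apply: le_trans n1.
  have [-> |->] : j = 0 \/ j = 1.
    by case: j => [[|[|//]] jlt]; [left|right]; exact: val_inj.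
  - exact: sq.
  - by rewrite /norm2 addrC; exact: sq.
have cf : continuous (fun u : 'rV[R]_2 => u 0 0 * u 0 0 + u 0 1 * u 0 1).
  by apply: add_cont; apply: mul_cont; exact: coord_continuous.
have -> : [set z : 'rV[R]_2 | z 0 0 ^+ 2 + z 0 1 ^+ 2 <= 1] =
    (fun u : 'rV[R]_2 => u 0 0 * u 0 0 + u 0 1 * u 0 1) @^-1` [set t | t <= 1] by [].
exact: (closed_preimage cf (@closed_le R 1)).
Qed.

End Disk.

Lemma compactT_prod (X Y : topologicalType) :
  compact [set: X] -> compact [set: Y] -> compact [set: X * Y].
Proof. by move=> cX cY; rewrite -setXTT; exact: compact_setX. Qed.

Section CoverHomotopy.
Variable R : realType.
Local Notation I := (unit_interval R).
Variables (K1 K2 Y Z : topologicalType) (q1 : K1 -> Y) (q2 : K2 -> Y).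
Hypotheses (K1_compact : compact [set: K1]) (K2_compact : compact [set: K2])
  (Y_hausdorff : hausdorff_space Y) (q1_cont : continuous q1)
  (q2_cont : continuous q2)
  (cover : forall y, (exists k, q1 k = y) \/ (exists k, q2 k = y)).

(** Only set-theoretic descent is asked for at each time. Joint continuity is automatic, because
    [Y * I] is Hausdorff and covered by the compact spaces [K1 * I] and [K2 * I]. *)
Lemma cover_homotopic (A : set Y) (phi1 : K1 * I -> Z) (phi2 : K2 * I -> Z) (f g : Y -> Z) :
  continuous phi1 -> continuous phi2 ->
  (forall s, exists F : Y -> Z, (forall k, F (q1 k) = phi1 (k, s)) /\
                                (forall k, F (q2 k) = phi2 (k, s))) ->
  (forall k, f (q1 k) = phi1 (k, I0 R)) -> (forall k, f (q2 k) = phi2 (k, I0 R)) ->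
  (forall k, g (q1 k) = phi1 (k, I1 R)) -> (forall k, g (q2 k) = phi2 (k, I1 R)) ->
  (forall y, A y -> exists2 k, q1 k = y & forall s, phi1 (k, s) = phi1 (k, I0 R)) ->
  homotopic_rel R A f g.
Proof.
move=> c1 c2 /choice[F FE] f1 f2 g1 g2 hA.
have cF : continuous (fun p : Y * I => F p.2 p.1).
  apply: (@compact_cover_cont (K1 * I)%type (K2 * I)%type (Y * I)%type Z
    (fun p => (q1 p.1, p.2)) (fun p => (q2 p.1, p.2))).
  - by apply: compactT_prod => //; exact: I_compact.
  - by apply: compactT_prod => //; exact: I_compact.
  - by apply: hausdorff_prod => //; exact: I_hausdorff.
  - by ct.
  - by ct.
  - by move=> [y s]; have [[k <-]|[k <-]] := cover y; [left|right]; exists (k, s).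
  - by rewrite (_ : (fun k => _) = phi1)//; apply/funext => -[k s]; exact: (FE s).1.
  - by rewrite (_ : (fun k => _) = phi2)//; apply/funext => -[k s]; exact: (FE s).2.
exists (fun p => F p.2 p.1); split => //.
- move=> y; have [[k <-]|[k <-]] := cover y; rewrite /=.
    by rewrite (FE _).1 f1.
  by rewrite (FE _).2 f2.
- move=> y; have [[k <-]|[k <-]] := cover y; rewrite /=.
    by rewrite (FE _).1 g1.
  by rewrite (FE _).2 g2.
- by move=> y s /hA[k <- ks]; rewrite /= (FE _).1 f1.
Qed.

End CoverHomotopy.

(** * Untwisting the monodromy *)

Section OpenBookEquivalence.
Variables (R : realType) (m : nat) (V : topologicalType) (A : atlas R V m).
Variables (h h' : V -> V) (Hm : V * unit_interval R -> V).
Local Notation I := (unit_interval R).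
Local Notation i0 := (I0 R).
Local Notation i1 := (I1 R).
Local Notation B := (boundary A).
Local Notation page_book := (book R B).
Hypotheses (V_compact : compact [set: V]) (V_hausdorff : hausdorff_space V)
  (closedB : closed B) (OB_hausdorff : hausdorff_space (open_book A h)).
Hypotheses (ch' : continuous h') (hK : cancel h h')
  (h'K : cancel h' h) (hB : forall v, B v -> h v = v).
Hypotheses (cH : continuous Hm) (H0 : forall v, Hm (v, i0) = h v)
  (H1 : forall v, Hm (v, i1) = v) (HB : forall v t, B v -> Hm (v, t) = v).

Definition binding (p : bdry A * disk R) : open_book A h := book_binding h p.
Definition paging (p : V * I) : open_book A h := book_page A (torus_proj h p.1 p.2).

Lemma binding_continuous : continuous binding.
Proof.
apply: (@comp_cont _ _ _ (qproj (@book_rel R m V A h))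
  (fun p => existT (@book_piece R m V A h) true p)); first exact: qproj_continuous.
exact: existT_continuous.
Qed.

Lemma paging_continuous : continuous paging.
Proof.
apply: (@comp_cont _ _ _ (fun x : mapping_torus R h => book_page A x)
  (fun p : V * I => torus_proj h p.1 p.2)).
  apply: (@comp_cont _ _ _ (qproj (@book_rel R m V A h))
    (fun p => existT (@book_piece R m V A h) false p)); first exact: qproj_continuous.
  exact: existT_continuous.
rewrite (_ : (fun p => _) = qproj (torus_rel h)); first exact: qproj_continuous.
by apply/funext => -[].
Qed.

Lemma open_book_cover (x : open_book A h) :
  (exists k, binding k = x) \/ (exists k, paging k = x).
Proof.
have [[[] y] ->] := qproj_surj x; first by left; exists y.
by right; have [[v t] ->] := qproj_surj y; exists (v, t).
Qed.

Lemma paging_seam v : paging (v, i0) = paging (h v, i1).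
Proof. by congr book_page; apply: qproj_eq; exists v. Qed.

Lemma binding_paging (b : bdry A) (z : disk R) (t : I) :
  set_val z = circle (ival t) -> binding (b, z) = paging (set_val b, t).
Proof. by move=> zt; apply: qproj_eq; exists b, z, t. Qed.

Lemma open_book_lift (Z : Type) (phi1 : bdry A * disk R -> Z) (phi2 : V * I -> Z) :
  (forall v, phi2 (v, i0) = phi2 (h v, i1)) ->
  (forall b z t, set_val z = circle (ival t) -> phi1 (b, z) = phi2 (set_val b, t)) ->
  exists F : open_book A h -> Z,
    (forall k, F (binding k) = phi1 k) /\ (forall k, F (paging k) = phi2 k).
Proof.
move=> seam bind.
have r2 p q : torus_rel h p q -> phi2 p = phi2 q by move=> [v [-> ->]].
pose phi (s : {b : bool & book_piece A h b}) : Z :=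
  let: existT b x := s in
  (if b return book_piece A h b -> Z then phi1 else qlift phi2) x.
have r1 p q : book_rel p q -> phi p = phi q.
  move=> [b [z [t [zt -> ->]]]]; rewrite /phi (qliftE r2); exact: bind.
exists (qlift phi); split => [k|[v t]].
  exact: (qliftE r1).
rewrite [LHS](qliftE r1); exact: (qliftE r2).
Qed.

Definition bind_book (p : bdry A * disk R) : page_book :=
  to_book B (set_val p.1) (disk_square p.2).
Definition page_at (p : V * I) : page_book := to_book B p.1 (rim p.2).

Lemma bdryP (b : bdry A) : B (set_val b). Proof. exact: (set_mem (svalP b)). Qed.

Lemma bind_bookE p : set_val (bind_book p) = (set_val p.1, disk_square p.2).
Proof. by rewrite to_bookE//; left; exact: bdryP. Qed.

Lemma page_atE p : set_val (page_at p) = (p.1, rim p.2).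
Proof. by rewrite to_bookE//; right; exact: rim_edge. Qed.

Lemma bind_book_continuous : continuous bind_book.
Proof.
apply: to_book_cont; last by move=> p; left; exact: bdryP.
  by apply: (@val_cont _ _ B fst); ct.
by ct; exact: disk_square_continuous.
Qed.

Lemma page_at_continuous : continuous page_at.
Proof.
apply: to_book_cont; [by ct|by ct; exact: rim_continuous|].
by move=> p; right; exact: rim_edge.
Qed.

Lemma page_book_cover (x : page_book) :
  (exists k, bind_book k = x) \/ (exists k, page_at k = x).
Proof.
have [Bx|ex] := book_projP x; last first.
  have [t tw] := rim_surj ex; right; exists (book_proj x, t).
  by rewrite /page_at /= tw to_book_val.
have [z zw] := disk_square_surj (book_angle x).
left; exists (exist (fun v => v \in B) (book_proj x) (mem_set Bx), z).
by rewrite /bind_book /= zw set_valE /= to_book_val.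
Qed.

Lemma page_book_hausdorff : hausdorff_space page_book.
Proof.
move=> x y xy; apply: val_inj; have hh : hausdorff_space (V * (I * I))%type.
  by do 2 apply: hausdorff_prod => //; exact: I_hausdorff.
apply: hh => U W Ux Wy.
have cv : continuous (fun x : page_book => set_val x) by apply: val_cont; exact: id_cont.
have [z [Uz Wz]] := xy _ _ (cv x _ Ux) (cv y _ Wy).
by exists (set_val z).
Qed.

(** The book is a subspace rather than a quotient, so descent is proved by checking when two points
    of the pieces coincide: never within the binding, only at the two ends of the interval for the
    pages, and along the circle between the two. *)
Lemma page_book_lift (Z : Type) (phi1 : bdry A * disk R -> Z) (phi2 : V * I -> Z) :
  (forall v, phi2 (v, i0) = phi2 (v, i1)) ->
  (forall b z t, set_val z = circle (ival t) -> phi1 (b, z) = phi2 (set_val b, t)) ->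
  exists F : page_book -> Z,
    (forall k, F (bind_book k) = phi1 k) /\ (forall k, F (page_at k) = phi2 k).
Proof.
move=> seam bind.
pose S x := [set y | (exists2 k, bind_book k = x & y = phi1 k) \/
                     (exists2 k, page_at k = x & y = phi2 k)].
have uniq x y y' : S x y -> S x y' -> y = y'.
  have e11 k k' : bind_book k = bind_book k' -> k = k'.
    move=> /(congr1 set_val); rewrite !bind_bookE => E.
    have e1 := val_inj (congr1 fst E); have e2 := disk_square_inj (congr1 snd E).
    by rewrite [LHS]surjective_pairing [RHS]surjective_pairing e1 e2.
  have e12 k k' : bind_book k = page_at k' -> phi1 k = phi2 k'.
    case: k k' => b z [v t] /(congr1 set_val); rewrite bind_bookE page_atE => E.
    have <- : set_val b = v := congr1 fst E.
    by apply: bind; apply: disk_square_rim_inv; exact: (congr1 snd E).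
  have e22 k k' : page_at k = page_at k' -> phi2 k = phi2 k'.
    case: k k' => v s [v' t] /(congr1 set_val); rewrite !page_atE => E.
    have <- : v = v' := congr1 fst E.
    have /rim_inj : rim s = rim t := congr1 snd E.
    by move=> [->|[-> ->]|[-> ->]].
  move=> [[k kx ->]|[k kx ->]] [[k' k'x ->]|[k' k'x ->]].
  - by rewrite (e11 k k')// kx.
  - by apply: e12; rewrite kx.
  - by apply/esym/e12; rewrite kx.
  - by apply: e22; rewrite kx.
have ex x : exists y, S x y.
  have [[k kx]|[k kx]] := page_book_cover x; first by exists (phi1 k); left; exists k.
  by exists (phi2 k); right; exists k.
have [F FS] := choice ex; exists F; split => k.
  by apply: (uniq _ _ _ (FS _)); left; exists k.
by apply: (uniq _ _ _ (FS _)); right; exists k.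
Qed.

Lemma h'B v : B v -> h' v = v.
Proof. by move=> Bv; rewrite -{1}(hB Bv) hK. Qed.

Lemma bdry_compact : compact [set: bdry A].
Proof.
apply: compact_set_type; exact: (subclosed_compact closedB V_compact (@subsetT _ _)).
Qed.

Let K1c : compact [set: bdry A * disk R].
Proof. by apply: compactT_prod; [exact: bdry_compact|exact: disk_compact]. Qed.

Let K2c : compact [set: V * I].
Proof. by apply: compactT_prod; [exact: V_compact|exact: I_compact]. Qed.

(* The maps [v, t] |-> (H_t v, t) and (v, t) |-> [h^-1 H_{1-t} v, t] are
   homotopy inverse relative to the binding: on the page over t the composites
   are H_t h^-1 H_{1-t} and h^-1 H_{1-t} H_t, and the diagonal path in the square
   of parameters is deformed to two of its edges, along which the composite
   runs back and forth along one path. *)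
Lemma open_book_equiv (b : bdry A) : exists x0,
  pointed_homotopy_equivalent R (x0 : open_book A h) (page R B (set_val b)).
Proof.
(* The seam is respected because the homotopy is [h] at time 0 and the identity at time 1: both
   representatives go to [h v] on the page where the rim closes up. *)
have [f [fb fp]] := @open_book_lift page_book bind_book (fun p => page_at (Hm p, p.2))
  (fun v => ltac:(by rewrite /page_at /= H0 H1 rim01))
  (fun b z t zt => ltac:(by rewrite /page_at /bind_book /= (disk_square_rim zt) HB//;
    exact: bdryP)).
have [g [gb gp]] := @page_book_lift (open_book A h) binding
  (fun p => paging (h' (Hm (p.1, inv_I p.2)), p.2))
  (fun v => ltac:(by rewrite /= inv_I0 inv_I1 H0 H1 hK paging_seam h'K))
  (fun b z t zt => ltac:(by rewrite /= HB ?h'B ?(binding_paging _ zt)//; exact: bdryP)).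
have cf : continuous f.
  apply: (@compact_cover_cont _ _ _ _ binding paging) => //.
  - exact: binding_continuous.
  - exact: paging_continuous.
  - exact: open_book_cover.
  - by rewrite (_ : (fun k => _) = bind_book); [exact: bind_book_continuous|exact/funext].
  - rewrite (_ : (fun k => _) = (fun p => page_at (Hm p, p.2))); last exact/funext.
    by ct; exact: page_at_continuous.
have cg : continuous g.
  apply: (@compact_cover_cont _ _ _ _ bind_book page_at) => //.
  - exact: page_book_hausdorff.
  - exact: bind_book_continuous.
  - exact: page_at_continuous.
  - exact: page_book_cover.
  - by rewrite (_ : (fun k => _) = binding); [exact: binding_continuous|exact/funext].
  - rewrite (_ : (fun k => _) = (fun p => paging (h' (Hm (p.1, inv_I p.2)), p.2)));
      last exact/funext.
    apply: (@comp_cont _ _ _ paging); first exact: paging_continuous.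
    by ct.
have [z zE] := disk_square_surj (corner R).
have pageE : bind_book (b, z) = page R B (set_val b).
  by rewrite /bind_book /= zE; apply: val_inj; rewrite -!set_valE to_bookE//; left; exact: bdryP.
exists (binding (b, z)), f, g; split => //.
- by rewrite fb -pageE gb.
(* On the first half of the two edges the outer factor is H_1 = id and H_{2t} remains, on the second
   half the inner one is and H_{2-2t} remains; so the composite is h^-1 H_{tent t}, and retracting
   the tent to 0 turns it into h^-1 H_0 = id. *)
- pose tent t : I := clamp (Num.min (2 * ival t) (2 - 2 * ival t)).
  have tent0 : tent i0 = i0 by rewrite /tent ival0 clamp_le0// ge_min mulr0 lexx.
  have tent1 : tent i1 = i0 by rewrite /tent ival1 clamp_le0// ge_min; lra.
  have bdA (Z : topologicalType) (k : bdry A * disk R -> Z) : forall y : open_book A h,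
      [set binding (b, z)] y -> exists2 k', binding k' = y &
      forall s : I, k k' = k k' by move=> _ ->; exists (b, z).
  have ctent : continuous tent by rewrite /tent; ct.
  pose N1 (p : (V * I) * I) := h' (Hm (Hm (p.1.1, lerp p.2 p.1.2 (lo p.1.2)),
                                       inv_I (lerp p.2 p.1.2 (hi p.1.2)))).
  pose N2 (p : (V * I) * I) := h' (Hm (p.1.1, lerp p.2 (tent p.1.2) i0)).
  have deform (N : (V * I) * I -> V) : continuous N ->
      (forall v s, N ((v, i0), s) = v) -> (forall v s, N ((v, i1), s) = v) ->
      (forall v t s, B v -> N ((v, t), s) = v) -> forall f g : open_book A h -> open_book A h,
      (forall k, f (binding k) = binding k) -> (forall k, g (binding k) = binding k) ->
      (forall k, f (paging k) = paging (N (k, i0), k.2)) ->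
      (forall k, g (paging k) = paging (N (k, i1), k.2)) ->
      homotopic_rel R [set binding (b, z)] f g.
    move=> cN N0 N1' NB f' g' f'b g'b f'p g'p.
    apply: (@cover_homotopic _ _ _ _ _ binding paging K1c K2c OB_hausdorff
      binding_continuous paging_continuous open_book_cover _
      (fun p => binding p.1) (fun p => paging (N p, p.1.2))) => //.
    + by ct; exact: binding_continuous.
    + by ct; exact: paging_continuous.
    + move=> s; apply: (@open_book_lift _ binding (fun k => paging (N (k, s), k.2))).
        by move=> v; rewrite N0 N1' paging_seam.
      by move=> c z' t zt; rewrite NB; [exact: binding_paging|exact: bdryP].
    + by move=> _ ->; exists (b, z).
  have mid : forall k, N1 (k, i1) = N2 (k, i0).
    move=> [v t]; rewrite /N1 /N2 /= !lerp1 lerp0; congr h'.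
    have [th|th] := leP (ival t) 2^-1.
      rewrite hi_lo// inv_I0 H1; congr (Hm (_, _)); apply: ival_inj.
      by rewrite ival_lo// /tent clampK; have := ival_itv t => /andP[? ?]; mm.
    rewrite lo_hi ?ltW// H1; congr (Hm (_, _)); apply: ival_inj.
    by rewrite ival_inv ival_hi ?ltW// /tent clampK; have := ival_itv t => /andP[? ?]; mm.
  (* The self-map of the open book at the junction of the two deformations [N1] and [N2]. *)
  have [k2 [k2b k2p]] := @open_book_lift (open_book A h) binding
    (fun k => paging (N1 (k, i1), k.2))
    (fun v => ltac:(by rewrite /N1 /= !lerp1 lo0 hi1 ?hi_lo ?lo_hi ?ival0 ?ival1
      ?inv_I0 ?inv_I1 ?H0 ?H1 ?hK ?H0 ?hK ?paging_seam//; lra))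
    (fun b z t zt => ltac:(by rewrite /N1 /= !HB ?h'B ?(binding_paging _ zt)//; exact: bdryP)).
  apply: (@homotopic_trans _ _ _ _ _ k2).
    apply: (deform N1) => //.
    + by rewrite /N1; ct.
    + move=> v s; rewrite /N1 /= lo0 hi_lo ?ival0 ?invr_ge0 ?ler0n//.
      by rewrite !lerp_id inv_I0 H1 H0 hK.
    + move=> v s; rewrite /N1 /= hi1 lo_hi; last by rewrite ival1; lra.
      by rewrite !lerp_id inv_I1 H1 H0 hK.
    + by move=> v t s Bv; rewrite /N1 /= !HB// h'B.
    + by move=> k; rewrite /= fb gb.
    + by move=> k; rewrite /= fp gp /N1 /= !lerp0 -surjective_pairing.
  apply: (deform N2) => //.
  + by rewrite /N2; ct.
  + by move=> v s; rewrite /N2 /= tent0 lerp_id H0 hK.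
  + by move=> v s; rewrite /N2 /= tent1 lerp_id H0 hK.
  + by move=> v t s Bv; rewrite /N2 /= !HB// h'B.
  + by move=> k; rewrite k2p mid.
  + by move=> [v t]; rewrite /N2 /= lerp1 H0 hK.
(* In the other order the edges use H_0 = h, which cancels against h^-1, and leave H_{1-2t} and then
   H_{2t-1}; this tent is retracted to 1, where H_1 = id. *)
- pose tent t : I := clamp (Num.max (1 - 2 * ival t) (2 * ival t - 1)).
  have tent0 : tent i0 = i1 by rewrite /tent ival0 clamp_ge1// le_max; lra.
  have tent1 : tent i1 = i1 by rewrite /tent ival1 clamp_ge1// le_max; lra.
  have ctent : continuous tent by rewrite /tent; ct.
  pose N1 (p : (V * I) * I) := Hm (h' (Hm (p.1.1, inv_I (lerp p.2 p.1.2 (lo p.1.2)))),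
                                   lerp p.2 p.1.2 (hi p.1.2)).
  pose N2 (p : (V * I) * I) := Hm (p.1.1, lerp p.2 (tent p.1.2) i1).
  have deform (N : (V * I) * I -> V) : continuous N ->
      (forall v s, N ((v, i0), s) = v) -> (forall v s, N ((v, i1), s) = v) ->
      (forall v t s, B v -> N ((v, t), s) = v) -> forall f g : page_book -> page_book,
      (forall k, f (bind_book k) = bind_book k) -> (forall k, g (bind_book k) = bind_book k) ->
      (forall k, f (page_at k) = page_at (N (k, i0), k.2)) ->
      (forall k, g (page_at k) = page_at (N (k, i1), k.2)) ->
      homotopic_rel R [set page R B (set_val b)] f g.
    move=> cN N0 N1' NB f' g' f'b g'b f'p g'p.
    apply: (@cover_homotopic _ _ _ _ _ bind_book page_at K1c K2c page_book_hausdorff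
      bind_book_continuous page_at_continuous page_book_cover _
      (fun p => bind_book p.1) (fun p => page_at (N p, p.1.2))) => //.
    + by ct; exact: bind_book_continuous.
    + by ct; exact: page_at_continuous.
    + move=> s; apply: (@page_book_lift _ bind_book (fun k => page_at (N (k, s), k.2))).
        by move=> v; rewrite N0 N1' /page_at /= rim01.
      move=> c z' t zt; rewrite NB; last exact: bdryP.
      by rewrite /bind_book /page_at /= (disk_square_rim zt).
    + by move=> _ ->; exists (b, z).
  have mid : forall k, N1 (k, i1) = N2 (k, i0).
    move=> [v t]; rewrite /N1 /N2 /= !lerp1 lerp0.
    have [th|th] := leP (ival t) 2^-1.
      rewrite hi_lo// H0 h'K; congr (Hm (_, _)); apply: ival_inj.
      by rewrite ival_inv ival_lo// /tent clampK; have := ival_itv t => /andP[? ?]; mm.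
    rewrite lo_hi ?ltW// inv_I1 H0 hK; congr (Hm (_, _)); apply: ival_inj.
    by rewrite ival_hi ?ltW// /tent clampK; have := ival_itv t => /andP[? ?]; mm.
  have N10 v s : N1 ((v, i0), s) = v.
    rewrite /N1 /= lo0 hi_lo ?ival0 ?invr_ge0 ?ler0n//.
    by rewrite !lerp_id inv_I0 H1 H0 h'K.
  have N11 v s : N1 ((v, i1), s) = v.
    rewrite /N1 /= hi1 lo_hi; last by rewrite ival1; lra.
    by rewrite !lerp_id inv_I1 H0 hK H1.
  have N1B v t s : B v -> N1 ((v, t), s) = v.
    by move=> Bv; rewrite /N1 /= (HB _ Bv) (h'B Bv) HB.
  have [k2 [k2b k2p]] := @page_book_lift page_book bind_book
    (fun k => page_at (N1 (k, i1), k.2))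
    (fun v => ltac:(by cbv beta; rewrite N10 N11 /page_at /= rim01))
    (fun b z t zt => ltac:(by cbv beta; rewrite (N1B _ _ _ (bdryP b))
      /bind_book /page_at /= (disk_square_rim zt))).
  apply: (@homotopic_trans _ _ _ _ _ k2).
    apply: (deform N1) => //.
    + by rewrite /N1; ct.
    + by move=> k; rewrite /= gb fb.
    + by move=> k; rewrite /= gp fp /N1 /= !lerp0.
  apply: (deform N2) => //.
  + by rewrite /N2; ct.
  + by move=> v s; rewrite /N2 /= tent0 lerp_id H1.
  + by move=> v s; rewrite /N2 /= tent1 lerp_id H1.
  + by move=> v t s Bv; rewrite /N2 /= HB.
  + by move=> k; rewrite k2p mid.
  + by move=> [v t]; rewrite /N2 /= lerp1 H1.
Qed.

End OpenBookEquivalence.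

(** * Assembly *)

Lemma hausdorff_inj (X Y : topologicalType) (f : X -> Y) :
  continuous f -> injective f -> hausdorff_space Y -> hausdorff_space X.
Proof.
move=> cf fI hY x y xy; apply: fI; apply: hY => U W Ux Wy.
have [z [Uz Wz]] := xy _ _ (cf x _ Ux) (cf y _ Wy).
by exists (f z).
Qed.

Lemma within_setT_cont (X Y : topologicalType) (f : X -> Y) :
  {within setT, continuous f} -> continuous f.
Proof. by move=> cf; apply/continuous_subspace_setT. Qed.

Lemma homeo_phe (R : realType) (X Y : topologicalType) (f : X -> Y) (g : Y -> X) (x : X) :
  continuous f -> continuous g -> cancel f g -> cancel g f ->
  pointed_homotopy_equivalent R x (f x).
Proof.
move=> cf cg fK gK; exists f, g; split => //.
- have -> : g \o f = id by apply/funext => y; exact: fK.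
  by apply: homotopic_refl; exact: id_cont.
- have -> : f \o g = id by apply/funext => y; exact: gK.
  by apply: homotopic_refl; exact: id_cont.
Qed.

Theorem theorem1p1 (R : realType) (n : nat)
    (V : topologicalType) (AV : atlas R V n.-1)
    (V_manifold : smooth_manifold AV) (V_compact : compact [set: V])
    (V_boundary : boundary AV !=set0)
    (h : V -> V) (h_diffeo : diffeomorphism AV AV h)
    (h_boundary : forall v, boundary AV v -> h v = v)
    (M : topologicalType) (AM : atlas R M n)
    (M_manifold : smooth_manifold AM) (M_compact : compact [set: M])
    (M_closed : boundary AM = set0)
    (M_path_connected : path_connected_space R M)
    (Phi : open_book AV h -> M) (Phi_diffeo : open_book_diffeo AM Phi)
    (h_homotopic : homotopic_rel R (boundary AV) h id)
    (v0 : bdry AV) (m0 : M) :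
  let incl : bdry AV -> V := @bdry_incl R n.-1 V AV in
  let F : topologicalType := hofiber R incl (incl v0) in
  let f0 : F := hofiber_pt R incl v0 in
  let S2F : topologicalType := reduced_susp R (reduced_susp_pt R f0) in
  let s0 : S2F := reduced_susp_pt R (reduced_susp_pt R f0) in
  pointed_homotopy_equivalent R
    (X := loop_space R m0)
    (Y := (loop_space R (incl v0) * loop_space R s0)%type)
    (loop_pt R m0) (loop_pt R (incl v0), loop_pt R s0) /\
  forall k : nat,
    group_iso_prod
      (@hgroup_mul R M m0 k) (@hgroup_mul R V (incl v0) k) (@hgroup_mul R S2F s0 k).
Proof.
move=> incl F f0 S2F s0.
have [V_hausdorff _ _ _ _] := V_manifold; have [M_hausdorff _ _ _ _] := M_manifold.
have closedB := closed_boundary V_manifold.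
have Bv0 : boundary AV (set_val v0) := set_mem (svalP v0).
have [_ [h' [hK h'K [/within_setT_cont ch' _]]]] := h_diffeo.
have [Hm [cH H0 H1 HA]] := h_homotopic.
have HB v t : boundary AV v -> Hm (v, t) = v by move=> Bv; rewrite HA// h_boundary.
have [cPhi [Psi [cPsi PhiK PsiK]] _ _] := Phi_diffeo.
(* The glued quotient inherits the Hausdorff property from [M] through the injection [Phi]. *)
have OB_hausdorff : hausdorff_space (open_book AV h).
  exact: (hausdorff_inj cPhi (can_inj PhiK)).
have [x0 x0_page] := open_book_equiv V_compact V_hausdorff closedB OB_hausdorff
  ch' hK h'K h_boundary cH H0 H1 HB v0.
have page_m0 : pointed_homotopy_equivalent R (page R (boundary AV) (set_val v0)) m0.
  apply: phe_trans (phe_sym x0_page) _.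
  apply: phe_trans (homeo_phe R x0 cPhi cPsi PhiK PsiK) _.
  exact: (base_move M_manifold).
have [phi [psi [D [r cb]]]] := chart_ballP V_manifold (set_val v0).
have [d [eta [cd d0 ceta d_pt [d_B eta_pt d_eta]]]] :=
  boundary_contraction V_manifold cb Bv0.
have fibre_s0 : pointed_homotopy_equivalent R (fibre_pt R (boundary AV) (set_val v0)) s0.
  exact: (@fibre_susp2 R V (boundary AV) v0 closedB d eta cd d0 ceta d_pt d_B eta_pt d_eta).
have [sg [tau spl]] :=
  splits_equiv page_m0 fibre_s0 (book_splits R (boundary AV) (set_val v0)).
split; first exact: (splits_loop_space spl).
(* Simple connectivity is proved for the homotopy fibre, where square coordinates are available, and
   carried to the double suspension by the equivalence [f], [g]. *)
apply: (splits_hgroup spl) => b lb.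
have [f [g [cf cg [fe gs] _ fg]]] := fibre_s0.
apply: hom_trans (hom_sym (hom_homotopic lb fg)) _.
have triv (t : cube R 0) : t = (fun=> I0 R) by apply/funext => -[].
have lgb : floop (@cube_boundary R 0) (fibre_pt R (boundary AV) (set_val v0))
    (fun p => g (b p)).
  by rewrite -gs; exact: floop_push.
have := hom_push cf (fibre_loops_null Bv0 triv lgb).
by rewrite fe.
Qed.
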